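(* Let $K$ be a nontrivial knot in $S^3$. Then $b_n'(K) = 1$ for some $n \geq br(K)$ if and only if $K$ is the trefoil or the figure eight knot. Hence, if $K$ is a nontrivial knot that is neither the trefoil nor the figure eight knot, then $b_n'(K) \geq 3$ for all $n \geq br(K)$.
   Context: $B_n$ denotes the braid group on $n$ strands with standard generators $\sigma_1,\dots,\sigma_{n-1}$. The length (number of crossings) of a braid word is the number of letters $\sigma_i^{\pm1}$ in it. A braid $\beta$ represents a knot $K$ if its closure $\widehat{\beta}$ is isotopic to $K$. The braid index $br(K)$ is the minimum number of strands needed to express $K$ as a closed braid. For $n \geq br(K)$, $b_n(K)$ is the minimum length of an $n$-strand braid word whose closure is $K$, and $b_n'(K) = b_n(K) - n$. ''The trefoil'' means the trefoil of either handedness. *)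

(* Defs.v *)
From mathcomp Require Import all_boot all_order all_algebra.
From mathcomp Require Export all_classical all_reals all_analysis.
Set Implicit Arguments.
Unset Strict Implicit.
Unset Printing Implicit Defensive.
Import Order.TTheory GRing.Theory Num.Theory numFieldNormedType.Exports.
Local Open Scope classical_set_scope.
Local Open Scope ring_scope.

Notation R3 R := (R * R * R)%type.

(* The 3-sphere, as R^3 together with a point at infinity: [Some] is the
   inclusion of R^3 and [None] is the point at infinity. *)
Notation S3 R := (one_point_compactification (R3 R)).

Definition homeomorphism (T U : topologicalType) (f : T -> U) : Prop :=
  continuous f /\
  exists g : U -> T, [/\ continuous g, cancel f g & cancel g f].

Section Knots.
Variable R : realType.
Implicit Types K L : set (S3 R).

(* Ambient isotopy in S^3.  Subsets carry no orientation, so knots below are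
   unoriented; mirror images are not identified. *)
Definition isotopic K L : Prop :=
  exists H : R * S3 R -> S3 R,
    [/\ {within `[0, 1] `*` setT, continuous H},
        forall t : R, 0 <= t <= 1 -> homeomorphism (fun x => H (t, x)),
        forall x, H (0, x) = x
      & (fun x => H (1, x)) @` K = L].

Definition simple_closed_curve K : Prop :=
  let circle := [set p : R * R | p.1 ^+ 2 + p.2 ^+ 2 = 1] in
  exists f : R * R -> S3 R,
    [/\ {within circle, continuous f}, set_inj circle f & f @` circle = K].

Definition segment (a b : R3 R) : set (R3 R) :=
  [set a + t *: (b - a) | t in `[0, 1]].

Definition closed_polygon (s : seq (R3 R)) : set (R3 R) :=
  [set p | exists2 i, (i < size s)%N &
    segment (nth 0 s i) (nth 0 s (i.+1 %% size s)) p].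

(* Knots are tame: a knot is isotopic to a polygon (which is then a simple
   closed one, being homeomorphic to a circle). *)
Definition knot K : Prop :=
  simple_closed_curve K /\
  exists s : seq (R3 R), isotopic K (Some @` closed_polygon s).

Definition unknot : set (S3 R) :=
  range (fun t : R => Some (cos t, sin t, 0)).

Definition nontrivial K : Prop := ~ isotopic K unknot.

(* The torus knot T(2,3) on the standard torus with radii 2 and 1, and its
   reflection in the plane z = 0. *)
Definition trefoil (mirror : bool) : set (S3 R) :=
  range (fun t : R => Some ((2 + cos (3 * t)) * cos (2 * t),
                            (2 + cos (3 * t)) * sin (2 * t),
                            (-1) ^+ mirror * sin (3 * t))).

(* The usual trigonometric parametrization of the knot 4_1. *)
Definition figure_eight : set (S3 R) :=
  range (fun t : R => Some ((2 + cos (2 * t)) * cos (3 * t),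
                            (2 + cos (2 * t)) * sin (3 * t),
                            sin (4 * t))).

Definition is_trefoil K : Prop := exists mirror, isotopic K (trefoil mirror).

Definition is_figure_eight K : Prop := isotopic K figure_eight.

End Knots.

(* The letter [(i, e)], with [i < n - 1], is the generator sigma_(i+1) of B_n
   if [e] is true, and its inverse otherwise. *)
Definition braid_letter (n : nat) : Type := ('I_n.-1 * bool)%type.

Definition braid_word (n : nat) : Type := seq (braid_letter n).

Section Closure.
Variable R : realType.

(* Position at time [s] in [0, 1] of the strand that starts at position
   [j + 1] in the elementary braid [a] ([None] is the trivial braid).  The
   first coordinate is the one along which the strands are lined up, at
   1, ..., n; the second one is the height, which tells over from under. *)
Definition strand (n : nat) (a : option (braid_letter n)) (j : 'I_n) (s : R)
    : R * R :=
  if a is Some (i, e) then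
    let h := (-1) ^+ (~~ e) * (s * (1 - s)) in
    if j == i :> nat then (j.+1%:R + s, h)
    else if j == i.+1 :> nat then (j.+1%:R - s, - h)
    else (j.+1%:R, 0)
  else (j.+1%:R, 0).

(* The closed braid winds around the z-axis, a strand position being
   (distance to the axis, z).  The full turn is cut into [size w + 1] equal
   angular sectors: one for each letter of [w], in order, and a last one
   ([onth w (size w) = None]) for the parallel arcs closing the braid. *)
Definition braid_closure (n : nat) (w : braid_word n) : set (S3 R) :=
  [set x | exists (k : nat) (j : 'I_n) (s : R),
    let theta := 2 * pi * ((k%:R + s) / (size w).+1%:R) in
    let q := strand (onth w k) j s in
    [/\ (k <= size w)%N, 0 <= s <= 1
      & x = Some (q.1 * cos theta, q.1 * sin theta, q.2)]].

Definition represents (n : nat) (w : braid_word n) (K : set (S3 R)) : Prop :=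
  isotopic (braid_closure w) K.

Definition is_minimum (A : set nat) (m : nat) : Prop :=
  A m /\ forall k, A k -> (m <= k)%N.

(* [br(K) = m] *)
Definition braid_index (K : set (S3 R)) (m : nat) : Prop :=
  is_minimum [set n | exists w : braid_word n, represents w K] m.

(* [b_n(K) = b] *)
Definition min_length (n : nat) (K : set (S3 R)) (b : nat) : Prop :=
  is_minimum [set l | exists2 w : braid_word n, represents w K & size w = l] b.

(* [b_n'(K) = d] *)
Definition reduced_length (n : nat) (K : set (S3 R)) (d : int) : Prop :=
  exists2 b, min_length n K b & d = b%:Z - n%:Z.

End Closure.

(* Main.v *)
(* The closure of a braid on n strands is connected only if each of the n - 1
   generators occurs in the word, and the length then has the parity of n - 1, because
   the permutation of the braid is an n-cycle. A generator i that occurs only once can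
   be removed together with one strand: the letters of smaller index commute with
   those of larger index, so that the word is conjugate to i, smaller letters, larger
   letters. With the inner strands pushed down, the strand that runs inside the larger
   letters and then outside the smaller ones becomes a rising spiral, one turn of
   which can be pulled over the axis. Hence a word of length n - 1 closes to the
   unknot, and a word of length n + 1 reduces to at most three strands. There
   cancellation and the Yang-Baxter relation leave the cubes of the generator of B_2
   and the alternating words of length 4 in B_3, which are conjugate to each other by
   the half twist.

   Isotopies come from homotopies of closed braids that keep the strands apart: such a
   homotopy is cut into short steps, each of which extends to a displacement x + D x
   with D a contraction, which is a homeomorphism that is isotopic to the identity. *)
From HB Require Import structures.
Require Import Defs.
From mathcomp Require Import all_boot all_order all_fingroup all_algebra.
From mathcomp Require Import all_classical all_reals all_analysis.
From mathcomp Require Import ring lra zify.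
Import Order.TTheory GRing.Theory Num.Theory numFieldNormedType.Exports.
Local Open Scope classical_set_scope.
Local Open Scope ring_scope.

Set Implicit Arguments.
Unset Strict Implicit.
Unset Printing Implicit Defensive.

(** * Ambient isotopies of Euclidean space *)

(** The difficulty is that [isotopic] demands homeomorphisms of the whole sphere, jointly continuous
    in time. Everything is therefore reduced to one estimate on the link alone: at each stage of a
    homotopy, the displacements of two points differ by at most a constant times the present
    distance of the points. Along a single strand this follows from Lipschitz bounds, between
    strands from a uniform separation, both compactness consequences of a sign condition on
    differences of strands. Radii stay at least 1, since near the axis the distance no longer
    controls the angle; the single move across the axis is treated by hand. Words are sequences of
    optional letters. The idle sectors [None] give room for a move and can be inserted or deleted at
    will. Braid relations are not verified one by one: two words whose strands lie in the same
    layers and induce the same permutation have isotopic closures. No knot invariant is computed.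
    That lengths 3 and 4 are minimal for the two knots follows from nontriviality, as a shorter word
    closes to the unknot or violates the parity. *)

Section Space.
Variable R : realType.
Local Notation E := (R3 R).

Lemma norm3_le (p : E) (d : R) :
  (`|p| <= d) = [&& `|p.1.1| <= d, `|p.1.2| <= d & `|p.2| <= d].
Proof. by rewrite /Num.norm /= !ge_max andbA. Qed.

Lemma norm3_comp (p : E) :
  [/\ `|p.1.1| <= `|p|, `|p.1.2| <= `|p| & `|p.2| <= `|p|].
Proof. by have := lexx `|p|; rewrite {1}norm3_le => /and3P. Qed.

Lemma compact_box (r : R) : compact [set p : E | `|p| <= r].
Proof.
have -> : [set p : E | `|p| <= r] =
    (`[- r, r]%classic `*` `[- r, r]%classic) `*` `[- r, r]%classic.
  apply/seteqP; split=> -[[x y] z] /=; rewrite norm3_le /= !in_itv /= -!ler_norml.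
    by move=> /and3P[-> -> ->].
  by move=> [[-> ->] ->].
by do !apply: compact_setX; exact: segment_compact.
Qed.

Lemma continuous_bound (T : topologicalType) (f : T -> E) (B : T -> R) (x : T) :
  B @ x --> (0 : R) -> (forall y, `|f x - f y| <= B y) -> {for x, continuous f}.
Proof.
move=> B0 fB; apply/cvgrPdist_le => e e0.
move/cvgrPdist_le : B0 => /(_ e e0); apply: filterS => y.
rewrite sub0r normrN => Be; apply: le_trans (fB y) _.
by apply: le_trans Be; rewrite ler_norm.
Qed.

Lemma continuous_lipschitz3 (f : E -> E) (k : R) :
  (forall x y, `|f x - f y| <= k * `|x - y|) -> continuous f.
Proof.
move=> fk x; apply: (@continuous_bound E f (fun y => k * `|x - y|) x) => //.
rewrite -[X in _ --> X](mulr0 k); apply: cvgM; first exact: cvg_cst.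
rewrite -[X in _ --> X](@normr0 _ E) -(subrr x).
by apply: cvg_norm; apply: cvgB; [exact: cvg_cst|exact: cvg_id].
Qed.

(* A minimum of [|p - f p|] on a large enough box can only be [0]. *)
Lemma contraction_fixpoint3 (f : E -> E) (k : R) : 0 <= k -> k < 1 ->
  (forall x y, `|f x - f y| <= k * `|x - y|) -> exists p, p = f p.
Proof.
(* The ball of radius [r] is mapped into itself, because [k * r + |f 0| = r]. *)
move=> k0 k1 fk; pose r := `|f 0| / (1 - k).
have k'0 : 0 < 1 - k by rewrite subr_gt0.
have f0r : `|f 0| = r - k * r by rewrite /r; field; rewrite gt_eqF.
have r0 : 0 <= r by rewrite divr_ge0// ltW.
have cf := continuous_lipschitz3 fk.
have [||p pB pmin] := @compact_EVT_min E R (fun p => `|p - f p|) _ _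
    (@compact_box r).
- by exists 0; rewrite /= normr0.
- apply: continuous_subspaceT => x; apply: cvg_norm; apply: cvgB.
    exact: cvg_id.
  exact: cf.
have fpB : f p \in [set p : E | `|p| <= r].
  rewrite inE /=; move: pB; rewrite inE /= => pr.
  have : `|f p| <= `|f p - f 0| + `|f 0| by rewrite -{1}(subrK (f 0) (f p)) ler_normD.
  have := fk p 0; rewrite subr0.
  have : k * `|p| <= k * r by rewrite ler_wpM2l.
  lra.
have := pmin _ fpB; have := fk p (f p) => h1 h2.
have : `|p - f p| <= 0 by have := normr_ge0 (p - f p); nra.
by rewrite normr_le0 subr_eq0 => /eqP; exists p.
Qed.

(* Joint continuity of the inverse isotopy is what makes the extension by [None]
   continuous at infinity. *)
Definition iso3 (K L : set E) : Prop := exists h g : R * E -> E,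
  [/\ continuous h, continuous g,
      forall t x, g (t, h (t, x)) = x /\ h (t, g (t, x)) = x,
      forall x, h (0, x) = x & (fun x => h (1, x)) @` K = L].

Lemma iso3_refl K : iso3 K K.
Proof.
exists snd, snd; split=> //; first by move=> ?; apply: cvg_snd.
  by move=> ?; apply: cvg_snd.
by rewrite image_id.
Qed.

Lemma iso3_sym K L : iso3 K L -> iso3 L K.
Proof.
move=> [h [g [ch cg hg h0 <-]]]; exists g, h; split=> //.
- by move=> t x; have [] := hg t x.
- by move=> x; have := (hg 0 x).2; rewrite h0.
- rewrite image_comp (eq_imagel (f' := id)) => [|x _ /=]; last by have [] := hg 1 x.
  by rewrite image_id.
Qed.

Lemma continuous_pairing (T U V : topologicalType) (f : T -> U) (g : T -> V) x :
  {for x, continuous f} -> {for x, continuous g} ->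
  {for x, continuous (fun y => (f y, g y))}.
Proof. by move=> cf cg; exact: (cvg_pair cf cg). Qed.

Let slide_continuous (h1 h2 : R * E -> E) : continuous h1 -> continuous h2 ->
  continuous (fun tx : R * E => h2 (tx.1, h1 tx)).
Proof.
move=> c1 c2 tx.
apply: (@continuous_comp _ _ _ (fun tx : R * E => (tx.1, h1 tx)) h2 tx).
  by apply: continuous_pairing; [exact: cvg_fst|exact: c1].
exact: c2.
Qed.

Lemma iso3_trans K L M : iso3 K L -> iso3 L M -> iso3 K M.
Proof.
move=> [h [g [ch cg hg h0 <-]]] [h' [g' [ch' cg' hg' h0' <-]]].
exists (fun tx => h' (tx.1, h tx)), (fun tx => g (tx.1, g' tx)); split=> /=.
- exact: (slide_continuous ch ch').
- exact: (slide_continuous cg' cg).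
- by move=> t x; rewrite (hg' _ _).1 (hg _ _).1 (hg _ _).2 (hg' _ _).2.
- by move=> x; rewrite h0 h0'.
- by rewrite image_comp.
Qed.

(** The isotopy is conjugated by [f]. This transports isotopies to mirror images. *)
Lemma iso3_map (f f' : E -> E) K L : continuous f -> continuous f' ->
  cancel f f' -> cancel f' f -> iso3 K L -> iso3 (f @` K) (f @` L).
Proof.
move=> cf cf' fK f'K [h [g [ch cg hg h0 <-]]].
have cc (k : R * E -> E) : continuous k ->
    continuous (fun tx : R * E => f (k (tx.1, f' tx.2))).
  move=> ck tx; apply: (@continuous_comp _ _ _
    (fun tx : R * E => k (tx.1, f' tx.2)) f tx); last exact: cf.
  apply: (@continuous_comp _ _ _ (fun tx : R * E => (tx.1, f' tx.2)) k tx).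
    apply: continuous_pairing; first exact: cvg_fst.
    by apply: (@continuous_comp _ _ _ snd f' tx); [exact: cvg_snd|exact: cf'].
  exact: ck.
exists (fun tx => f (h (tx.1, f' tx.2))), (fun tx => f (g (tx.1, f' tx.2))).
split=> /=; [exact: cc|exact: cc| | |].
- by move=> t x; rewrite !fK (hg _ _).1 (hg _ _).2 f'K.
- by move=> x; rewrite h0 f'K.
- by rewrite !image_comp; apply: eq_imagel => x _ /=; rewrite fK.
Qed.

(* McShane's extension. *)
Lemma lipschitz_extension (S : Type) (A : set S) (c : S -> E) (w : S -> R)
    (k : R) : 0 <= k ->
  (forall a b, A a -> A b -> `|w a - w b| <= k * `|c a - c b|) ->
  exists D : E -> R, (forall x y, `|D x - D y| <= k * `|x - y|) /\
    forall a, A a -> D (c a) = w a.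
Proof.
move=> k0 wk; have [[a0 Aa0]|A0] := pselect (A !=set0); last first.
  exists (fun=> 0); split=> [x y|a Aa]; first by rewrite subrr normr0 mulr_ge0.
  by exfalso; apply: A0; exists a.
pose F (x : E) := [set w a + k * `|x - c a| | a in A].
have tri (x y z : E) : k * `|x - z| <= k * `|x - y| + k * `|y - z|.
  by rewrite -mulrDr ler_wpM2l// ler_distD.
have wk1 a b : A a -> A b -> w a <= w b + k * `|c a - c b|.
  by move=> Aa Ab; have /ler_normlP[_] := wk a b Aa Ab; lra.
have lbF x : has_lbound (F x).
  exists (w a0 - k * `|c a0 - x|) => _ [a Aa <-].
  have := wk1 _ _ Aa0 Aa; have := tri (c a0) x (c a); lra.
have F0 x : F x !=set0 by exists (w a0 + k * `|x - c a0|), a0.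
have DF x y : inf (F x) <= inf (F y) + k * `|x - y|.
  rewrite -lerBlDr; apply: lb_le_inf => // _ [a Aa <-].
  have : inf (F x) <= w a + k * `|x - c a| by apply: ge_inf => //; exists a.
  by have := tri x y (c a); lra.
exists (fun x => inf (F x)); split=> [x y|a Aa].
  apply/ler_normlP; split; last by have := DF x y; lra.
  by have := DF y x; rewrite (distrC y); lra.
apply/eqP; rewrite eq_le; apply/andP; split.
  have : inf (F (c a)) <= w a + k * `|c a - c a| by apply: ge_inf => //; exists a.
  by rewrite subrr normr0 mulr0 addr0.
by apply: lb_le_inf => // _ [b Ab <-]; exact: wk1.
Qed.

(** At each time the equation [x + c t D x = y] is a fixed point problem for a contraction, which
    gives the inverse; the lower bound [(1 - k) |x - y|] on image distances makes it continuous. *)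
Lemma perturbation_iso3 (D : E -> E) (k : R) (K : set E) : 0 <= k -> k < 1 ->
  (forall x y, `|D x - D y| <= k * `|x - y|) -> iso3 K [set x + D x | x in K].
Proof.
move=> k0 k1 Dk.
(* Time is clamped to [0, 1], since [iso3] asks for maps that are defined and invertible at all real
   times. *)
pose c (t : R) : R := Order.min 1 (Order.max 0 t).
have c01 t : 0 <= c t <= 1.
  by rewrite /c le_min ler01 le_max lexx ge_min lexx.
have cc : continuous c.
  by move=> t; apply: continuous_min; [exact: cvg_cst|apply: continuous_max;
    [exact: cvg_cst|exact: cvg_id]].
have fixex (ty : R * E) : exists p, p = ty.2 - c ty.1 *: D p.
  apply: (@contraction_fixpoint3 _ k) => // x y.
  rewrite opprB addrC addrA subrK -scalerBr normrZ distrC.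
  have /andP[c0 c1] := c01 ty.1; rewrite ger0_norm//.
  by apply: le_trans (Dk _ _); rewrite ler_piMl.
have [g gE] := choice fixex.
pose h (tx : R * E) : E := tx.2 + c tx.1 *: D tx.2.
have hcontr t x y : (1 - k) * `|x - y| <= `|h (t, x) - h (t, y)|.
  rewrite /h /= opprD addrACA -scalerBr.
  have : `|x - y| <= `|x - y + c t *: (D x - D y)| + `|c t *: (D x - D y)|.
    by rewrite -[X in `|X| <= _](addrK (c t *: (D x - D y))) ler_normB.
  rewrite normrZ; have /andP[c0 c1] := c01 t; rewrite (ger0_norm c0).
  have : c t * `|D x - D y| <= k * `|x - y|.
    by apply: le_trans (Dk _ _); rewrite ler_piMl.
  lra.
have hgK t x : h (t, g (t, x)) = x by rewrite /h /= {1}gE /= subrK.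
have hinj t x y : h (t, x) = h (t, y) -> x = y.
  move=> hxy; have := hcontr t x y; rewrite hxy subrr normr0 => le0.
  have : `|x - y| <= 0 by have := normr_ge0 (x - y); nra.
  by rewrite normr_le0 subr_eq0 => /eqP.
have cD := continuous_lipschitz3 Dk.
exists h, g; split.
- move=> tx; rewrite /h; apply: cvgD; first exact: cvg_snd.
  apply: cvgZ.
    by apply: (@continuous_comp _ _ _ fst c tx); [exact: cvg_fst|exact: cc].
  by apply: (@continuous_comp _ _ _ snd D tx); [exact: cvg_snd|exact: cD].
(* The expansion bound [hcontr] is applied at time [s] to the points [g (t, y)] and [g (s, z)]; the
   image of the first one differs from [y] only by the change of [c] times a fixed vector. *)
- move=> [t y].
  apply: (@continuous_bound (R * E)%type g (fun sz =>
    (1 - k)^-1 * (`|y - sz.2| + `|c t - c sz.1| * `|D (g (t, y))|)) (t, y)).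
    rewrite -[X in _ --> X](mulr0 (1 - k)^-1); apply: cvgM; first exact: cvg_cst.
    rewrite -[X in _ --> X]addr0; apply: cvgD.
      rewrite -[X in _ --> X](@normr0 _ E) -(subrr y).
      by apply: cvg_norm; apply: cvgB; [exact: cvg_cst|exact: cvg_snd].
    rewrite -[X in _ --> X](mul0r `|D (g (t, y))|).
    apply: cvgM; last exact: cvg_cst.
    rewrite -[X in _ --> X](@normr0 _ R) -(subrr (c t)).
    apply: cvg_norm; apply: cvgB; first exact: cvg_cst.
    by apply: (@continuous_comp _ _ _ fst c (t, y)); [exact: cvg_fst|exact: cc].
  move=> [s z] /=; rewrite ler_pdivlMl ?subr_gt0//.
  apply: le_trans (hcontr s _ _) _; rewrite hgK.
  have -> : h (s, g (t, y)) - z = (y - z) + (c s - c t) *: D (g (t, y)).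
    have := hgK t y; rewrite /h /=; move: (g (t, y)) => p <-.
    rewrite scalerBl addrACA [in RHS](addrAC p).
    by rewrite (addrC (- z)) addrA addrK.
  by rewrite (distrC (c t)) -normrZ ler_normD.
- by move=> t x; split; [apply: (hinj t); exact: hgK|exact: hgK].
- by move=> x; rewrite /h /= /c maxxx min_r ?ler01// scale0r addr0.
- apply: eq_imagel => x _; rewrite /h /= /c.
  by rewrite max_r ?ler01// minxx scale1r.
Qed.

(** A displacement known only on the link is extended coordinate by coordinate. For the sup norm
    this keeps the constant [k], so the extension is still a contraction. *)
Lemma small_displacement_iso3 (S : Type) (A : set S) (c v : S -> E) (k : R) :
  0 <= k -> k < 1 ->
  (forall a b, A a -> A b -> `|v a - v b| <= k * `|c a - c b|) ->
  iso3 (c @` A) [set c a + v a | a in A].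
Proof.
move=> k0 k1 vk.
have vk3 a b : A a -> A b -> [/\ `|(v a).1.1 - (v b).1.1| <= k * `|c a - c b|,
    `|(v a).1.2 - (v b).1.2| <= k * `|c a - c b| &
    `|(v a).2 - (v b).2| <= k * `|c a - c b|].
  by move=> Aa Ab; have := vk _ _ Aa Ab; rewrite norm3_le => /and3P.
have [D1 [D1k D1v]] := @lipschitz_extension S A c (fun a => (v a).1.1) k k0
  (fun a b Aa Ab => let: And3 h _ _ := vk3 a b Aa Ab in h).
have [D2 [D2k D2v]] := @lipschitz_extension S A c (fun a => (v a).1.2) k k0
  (fun a b Aa Ab => let: And3 _ h _ := vk3 a b Aa Ab in h).
have [D3 [D3k D3v]] := @lipschitz_extension S A c (fun a => (v a).2) k k0
  (fun a b Aa Ab => let: And3 _ _ h := vk3 a b Aa Ab in h).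
pose D x : E := (D1 x, D2 x, D3 x).
have := @perturbation_iso3 D k (c @` A) k0 k1.
rewrite image_comp => /(_ _)/iso3_trans; apply.
  by move=> x y; rewrite norm3_le /= D1k D2k D3k.
rewrite [X in iso3 X _](_ : _ = [set c a + v a | a in A]); first exact: iso3_refl.
apply: eq_imagel => a Aa /=; congr (_ + _).
by rewrite /D D1v// D2v// D3v//; case: (v a) => -[].
Qed.

(** Time is cut into [m > C] equal steps, so that the displacement of each step has a Lipschitz
    constant below 1 with respect to the position reached so far. *)
Lemma family_iso3 (S : Type) (A : set S) (c : R -> S -> E) (C : R) :
  (forall s t a b, 0 <= s <= 1 -> 0 <= t <= 1 -> A a -> A b ->
    `|(c t a - c s a) - (c t b - c s b)| <= C * `|t - s| * `|c s a - c s b|) ->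
  iso3 (c 0 @` A) (c 1 @` A).
Proof.
move=> cC; pose C' := Order.max C 0.
pose m := (Num.truncn C').+1.
have C'0 : 0 <= C' by rewrite le_max lexx orbT.
have m0 : 0 < m%:R :> R by rewrite ltr0n.
have C'm : C' / m%:R < 1.
  by rewrite ltr_pdivrMr// mul1r; have /andP[] := truncn_itv C'0.
have step (i : nat) : (i <= m)%N -> iso3 (c 0 @` A) (c (i%:R / m%:R) @` A).
  elim: i => [_|i IH im]; first by rewrite mul0r; exact: iso3_refl.
  apply: iso3_trans (IH (ltnW im)) _.
  set s := i%:R / m%:R; set t := i.+1%:R / m%:R.
  have s01 : 0 <= s <= 1.
    by rewrite divr_ge0//= ler_pdivrMr// mul1r ler_nat ltnW.
  have t01 : 0 <= t <= 1.
    by rewrite divr_ge0//= ler_pdivrMr// mul1r ler_nat.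
  have ts : `|t - s| = m%:R^-1.
    by rewrite -mulrBl -natrB// subSnn mul1r ger0_norm// invr_ge0.
  have -> : c t @` A = [set c s a + (c t a - c s a) | a in A].
    by apply: eq_imagel => a _; rewrite addrC subrK.
  apply: (@small_displacement_iso3 _ _ _ _ (C' / m%:R)) => //.
    by rewrite divr_ge0.
  move=> a b Aa Ab; apply: le_trans (cC s t a b s01 t01 Aa Ab) _.
  by rewrite ts ler_wpM2r// ler_wpM2r ?invr_ge0// le_max lexx.
by have := step m (leqnn m); rewrite divff// gt_eqF.
Qed.

(** The case of motion along straight lines: the bound is required against the distance of the two
    points at every intermediate time [t]. *)
Lemma linear_iso3 (S : Type) (A : set S) (c v : S -> E) (C : R) :
  (forall t a b, 0 <= t <= 1 -> A a -> A b ->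
    `|v a - v b| <= C * `|c a - c b + t *: (v a - v b)|) ->
  iso3 (c @` A) [set c a + v a | a in A].
Proof.
move=> vC; have := @family_iso3 S A (fun t a => c a + t *: v a) C.
have -> : (fun a => c a + 0 *: v a) @` A = c @` A.
  by apply: eq_imagel => a _; rewrite scale0r addr0.
have -> : (fun a => c a + 1 *: v a) @` A = [set c a + v a | a in A].
  by apply: eq_imagel => a _; rewrite scale1r.
apply=> s t a b s01 t01 Aa Ab.
have e x : c x + t *: v x - (c x + s *: v x) = (t - s) *: v x.
  by rewrite opprD addrACA subrr add0r scalerBl.
rewrite !e -scalerBr normrZ [C * _]mulrC -mulrA ler_wpM2l//.
rewrite opprD addrACA -scalerBr; exact: vC.
Qed.

End Space.
(** Makes compact subsets of time times sphere closed, for the inversion of isotopies. *)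
Lemma hausdorff_prod (U V : topologicalType) :
  hausdorff_space U -> hausdorff_space V -> hausdorff_space (U * V)%type.
Proof.
move=> hU hV [a b] [c d] cl; congr pair.
- apply: hU => A B nA nB.
  have [||[x y] [/= Ax Bx]] := cl (A `*` setT) (B `*` setT).
  + by exists (A, setT) => //; split => //=; exact: filterT.
  + by exists (B, setT) => //; split => //=; exact: filterT.
  by exists x; split; [case: Ax|case: Bx].
- apply: hV => A B nA nB.
  have [||[x y] [/= Ax Bx]] := cl (setT `*` A) (setT `*` B).
  + by exists (setT, A) => //; split => //=; exact: filterT.
  + by exists (setT, B) => //; split => //=; exact: filterT.
  by exists y; split; [case: Ax|case: Bx].
Qed.

(** * Isotopies of the 3-sphere *)

Section Sphere.
Variable R : realType.
Local Notation E := (R3 R).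
Local Notation S := (S3 R).
Local Notation strip := (`[(0 : R), 1] `*` [set: S]).

Lemma hausdorff_R3 : hausdorff_space E.
Proof. exact: norm_hausdorff. Qed.

Lemma hausdorff_S3 : hausdorff_space S.
Proof.
apply: one_point_compactification_hausdorff; last exact: hausdorff_R3.
move=> p _; rewrite withinET.
have cK : compact [set q : E | `|q| <= `|p| + 1] by exact: compact_box.
exists [set q : E | `|q| <= `|p| + 1]; last first.
  by split=> //; exact: compact_closed hausdorff_R3 cK.
apply/nbhs_ballP; exists 1 => //= q; rewrite -ball_normE /= => pq.
by rewrite -[q](subrK p) addrC (le_trans (ler_normD _ _))// lerD2l distrC ltW.
Qed.

Let optmap (h : R * E -> E) (tx : R * S) : S := omap (fun p => h (tx.1, p)) tx.2.

Let optmap_continuous (h g : R * E -> E) : continuous h -> continuous g ->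
  (forall t x, g (t, h (t, x)) = x) -> {within strip, continuous (optmap h)}.
Proof.
move=> ch cg gh; apply/subspace_continuousP => -[t [p|]] /= [t01 _].
  apply: cvg_within_filter => U.
  rewrite /= /optmap /= => /(ch (t, p)) [[A B] /= [nA nB] AB].
  exists (A, Some @` B) => /=.
    by split => //; exact: one_point_compactification_some_nbhs.
  by move=> [s _] [/= As [q Bq <-]] /=; exact: (AB (s, q)).
move=> U [C [cC clC] CU].
(* [D] contains every point that is carried into [C] at some time in [0, 1], so its complement is a
   neighbourhood of infinity that works for all these times. *)
pose D := (fun sq => g sq) @` (`[0, 1]%classic `*` C).
have cD : compact D.
  apply: continuous_compact; first exact: continuous_subspaceT.
  by apply: compact_setX => //; exact: segment_compact.
have clD : closed D by exact: compact_closed hausdorff_R3 cD.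
exists (setT, Some @` (~` D) `|` [set None]) => /=.
  by split; [exact: filterT|exists D].
move=> [s [q|]] [/= _ Dq] [s01 _]; last by apply: CU; right.
apply: CU; left; rewrite /optmap /=; exists (h (s, q)) => // Ch.
case: Dq => [[r Dr [rq]]|//]; apply: Dr; exists (s, h (s, q)) => //.
by rewrite gh rq.
Qed.

Lemma strip_section (H : R * S -> S) t : {within strip, continuous H} ->
  0 <= t <= 1 -> continuous (fun x => H (t, x)).
Proof.
move=> /subspace_continuousP cH t01 x U nU.
have [[A B] /= [nA nB] AB] := cH (t, x) (conj t01 I) _ nU.
apply: filterS nB => y By; apply: (AB (t, y)) => //=; split => //.
exact: nbhs_singleton nA.
Qed.

Lemma iso3_isotopic (K L : set E) :
  iso3 K L -> isotopic (Some @` K : set S) (Some @` L).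
Proof.
move=> [h [g [ch cg hg h0 <-]]]; exists (optmap h).
have ohg t x : optmap g (t, optmap h (t, x)) = x.
  by case: x => [p|//]; rewrite /optmap /= (hg _ _).1.
have ogh t x : optmap h (t, optmap g (t, x)) = x.
  by case: x => [p|//]; rewrite /optmap /= (hg _ _).2.
have cH := optmap_continuous ch cg (fun t x => (hg t x).1).
have cG := optmap_continuous cg ch (fun t x => (hg t x).2).
split => //.
- move=> t t01; split; first exact: strip_section.
  exists (fun x => optmap g (t, x)); split => //; first exact: strip_section.
- by case=> [p|//]; rewrite /optmap /= h0.
- by rewrite !image_comp.
Qed.

Lemma isotopic_trans (K L M : set S) : isotopic K L -> isotopic L M -> isotopic K M.
Proof.
move=> [H [cH hH H0 <-]] [H' [cH' hH' H0' <-]].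
exists (fun tx => H' (tx.1, H tx)); split.
- apply/subspace_continuousP => -[t x] At U nU.
  have [[A B] /= [nA nB] AB] := (subspace_continuousP _ _).1 cH' (t, H (t, x)) At _ nU.
  have [[C D] /= [nC nD] CD] := (subspace_continuousP _ _).1 cH (t, x) At _ nB.
  exists (A `&` C, D) => /=; first by split => //; exact: filterI.
  move=> [s y] [[/= As Cs] Dy] Asy; apply: (AB (s, H (s, y))) => //=.
    by split => //=; exact: (CD (s, y)).
- move=> t t01; have [c1 [g1 [cg1 K1 K1']]] := hH t t01.
  have [c2 [g2 [cg2 K2 K2']]] := hH' t t01; split.
    by move=> x; apply: (@continuous_comp _ _ _ (fun x => H (t, x))
      (fun x => H' (t, x))); [exact: c1|exact: c2].
  exists (g1 \o g2); split.
  + by move=> x; apply: continuous_comp; [exact: cg2|exact: cg1].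
  + by move=> x /=; rewrite K2 K1.
  + by move=> x /=; rewrite K1' K2'.
- by move=> x; rewrite H0 H0'.
- by rewrite image_comp.
Qed.

(** Continuity of the inverse in time is not part of [isotopic]. It comes from compactness: the map
    [(t, x) -> (t, H (t, x))] goes from a compact space to a Hausdorff one, hence is closed. *)
Lemma isotopic_sym (K L : set S) : isotopic K L -> isotopic L K.
Proof.
move=> [H [cH hH H0 <-]].
have /choice[G GP] : forall t, exists g : S -> S, 0 <= t <= 1 ->
    [/\ continuous g, cancel (fun x => H (t, x)) g & cancel g (fun x => H (t, x))].
  move=> t; case: (boolP (0 <= t <= 1)) => [t01|_]; last by exists id.
  by have [_ [g gP]] := hH t t01; exists g.
have t1 : 0 <= (1 : R) <= 1 by rewrite ler01 lexx.
have t0 : 0 <= (0 : R) <= 1 by rewrite ler01 lexx.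
exists (fun tx => G tx.1 tx.2); split.
- apply/subspace_continuousP => -[t y] /= [t01 _] U.
  rewrite nbhsE => -[V [oV Vy VU]].
  pose Z := (fun tx : R * S => (tx.1, H tx)) @` (`[0, 1]%classic `*` ~` V).
  have cZ : compact Z.
    apply: continuous_compact.
      apply/subspace_continuousP => -[s x] /= [s01 Vx] W [[A B] /= [nA nB] AB].
      have [[C D] /= [nC nD] CD] :=
        (subspace_continuousP _ _).1 cH (s, x) (conj s01 I) _ nB.
      exists (A `&` C, D) => /=; first by split => //; exact: filterI.
      move=> [r z] [[/= Ar Cr] Dz] [r01 Vz]; apply: AB => /=; split => //=.
      exact: (CD (r, z)).
    apply: compact_setX; first exact: segment_compact.
    rewrite -[X in compact X]setTI.
    apply: compact_closedI; first exact: one_point_compactification_compact.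
    exact: open_closedC.
  have clZ : closed Z.
    apply: compact_closed cZ; apply: hausdorff_prod; last exact: hausdorff_S3.
    exact: Rhausdorff.
  have nZ : nbhs (t, y) (~` Z).
    apply: open_nbhs_nbhs; split; first exact: closed_openC.
    move=> [[s x] /= [s01 Vx] [st Hy]]; apply: Vx.
    have [_ K1 _] := GP t t01; move: Vy.
    by rewrite -Hy st /from_subspace /= K1.
  apply: filterS nZ => -[s z] /= Zsz [s01 _]; apply: VU; apply: contrapT => Vz.
  apply: Zsz; exists (s, G s z) => //=; congr pair.
  by have [_ _ ->] := GP s s01.
- move=> t t01; have [cg K1 K2] := GP t t01; split => //.
  by exists (fun x => H (t, x)); split => //; have [] := hH t t01.
- by move=> x /=; have [_ + _] := GP 0 t0 => /(_ x); rewrite H0.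
- rewrite image_comp (eq_imagel (f' := id)) ?image_id// => x _ /=.
  by have [_ K1 _] := GP 1 t1; exact: K1.
Qed.

Lemma isotopic_connected (K L : set S) : isotopic K L -> connected K -> connected L.
Proof.
move=> [H [cH hH H0 <-]] cK; apply: connected_continuous_connected => //.
apply: continuous_subspaceT; apply: strip_section => //.
by rewrite ler01 lexx.
Qed.

Lemma connected_Some (C : set E) : connected ((Some @` C) : set S) -> connected C.
Proof.
have injS (A B : set E) : Some @` (A `&` B) = ((Some @` A) : set S) `&` (Some @` B).
  apply/seteqP; split=> [_ [x [Ax Bx] <-]|_ [[x Ax <-] [y By [yx]]]].
    by split; exists x.
  by exists x => //; split => //; rewrite -yx.
move=> cC B [b Bb] [W oW BW] [D cD BD].
have SB : Some @` B = (Some @` C : set S).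
  apply: cC.
  - by exists (Some b), b.
  - exists (Some @` W); first exact: one_point_compactification_open_some.
    by rewrite BW injS.
  (* The point at infinity is included, since the image of an unbounded closed set [D] alone is not
     closed in the sphere. *)
  - exists (~` (Some @` (~` D))).
      by apply: open_closedC; apply: one_point_compactification_open_some; exact: closed_openC.
    rewrite BD injS; apply/seteqP; split=> [_ [[x Cx <-] [y Dy [yx]]]|_ [[x Cx <-] Dx]].
      split; first by exists x.
      by move=> [z Dz [zx]]; apply: Dz; rewrite zx -yx.
    split; exists x => //; apply: contrapT => nDx; apply: Dx.
    by exists x.
apply/seteqP; split=> x Bx.
  have : (Some @` C : set S) (Some x) by rewrite -SB; exists x.
  by move=> [y Cy [<-]].
have : (Some @` B : set S) (Some x) by rewrite SB; exists x.
by move=> [y Cy [<-]].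
Qed.

Lemma iso3_connected (K L : set E) : iso3 K L -> connected K -> connected L.
Proof.
move=> [h [g [ch cg hg h0 <-]]] cK; apply: connected_continuous_connected => //.
apply: continuous_subspaceT => x.
apply: (@continuous_comp _ _ _ (fun x : E => (1 : R, x)) h); last exact: ch.
by apply: continuous_pairing; [exact: cvg_cst|exact: cvg_id].
Qed.

Lemma simple_closed_curve_connected (K : set S) : simple_closed_curve K -> connected K.
Proof.
move=> [f [cf _ <-]]; apply: connected_continuous_connected => //.
set circle := [set p : R * R | _].
have -> : circle = range (fun t : R => (cos t, sin t)).
  apply/seteqP; split=> [[x y] /= xy|_ [t _ <-]]; last exact: cos2Dsin2.
  have x1 : -1 <= x <= 1.
    by rewrite -ler_norml -(@ler_sqr _
      _ 1) ?nnegrE// expr1n real_normK ?num_real// -xy lerDl sqr_ge0.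
  have y2 : 1 - x ^+ 2 = y ^+ 2 by rewrite -xy addrC addKr.
  have [y0|y0] := leP 0 y.
    exists (acos x) => //; rewrite acosK ?in_itv// sin_acos// y2 sqrtr_sqr.
    by rewrite ger0_norm.
  exists (- acos x) => //; rewrite cosN sinN acosK ?in_itv// sin_acos// y2 sqrtr_sqr.
  by rewrite ltr0_norm// opprK.
apply: connected_continuous_connected.
  by apply/connected_intervalP.
apply: continuous_subspaceT => t; apply: continuous_pairing.
  exact: continuous_cos.
exact: continuous_sin.
Qed.

End Sphere.
(** * Cylindrical coordinates *)

Section Trigo.
Variable R : realType.
Implicit Types x y t : R.

Lemma sin_lipschitz x y : `|sin x - sin y| <= `|x - y|.
Proof.
wlog yx : x y / y <= x => [H|].
  by case: (leP y x) => [/H//|/ltW/H]; rewrite distrC (distrC y).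
have ds z : z \in `]y, x[ -> is_derive z 1 sin (cos z).
  by move=> _; exact: is_derive_sin.
have [|c _ ->] := MVT_segment yx ds.
  by apply: continuous_subspaceT; exact: continuous_sin.
by rewrite normrM ler_piMl// cos_max.
Qed.

Lemma cos_lipschitz x y : `|cos x - cos y| <= `|x - y|.
Proof.
have := sin_lipschitz (x + pi / 2) (y + pi / 2).
by rewrite !sinDpihalf opprD addrACA subrr addr0.
Qed.

Lemma normr_sin_le x : `|sin x| <= `|x|.
Proof. by have := sin_lipschitz x 0; rewrite sin0 !subr0. Qed.

Lemma normr_cosB1_le x : `|cos x - 1| <= `|x|.
Proof. by have := cos_lipschitz x 0; rewrite cos0 !subr0. Qed.

(** Jordan's inequality with [1 / 2] for [2 / pi]: doubling the angle and the mean value theorem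
    leave two cosines on [0, pi / 4], whose squares are at least [1 / 2]. *)
Lemma sin_ge_half x : 0 <= x <= pi / 2 -> x / 2 <= sin x.
Proof.
move=> /andP[x0 xpi].
have cos_ge c : 0 <= c <= pi / 4 -> 0 <= cos c /\ 1 / 2 <= cos c ^+ 2.
  move=> /andP[c0 cpi]; split.
    by apply: cos_ge0_pihalf; apply/andP; have := pi_ge0 R; split; lra.
  have : 0 <= cos (c *+ 2).
    by apply: cos_ge0_pihalf; apply/andP; have := pi_ge0 R; split; lra.
  by rewrite cos_mulr2n; lra.
have h0 : 0 <= x / 2 by lra.
have ds z : z \in `]0, x / 2[ -> is_derive z 1 sin (cos z).
  by move=> _; exact: is_derive_sin.
have [|c] := MVT_segment h0 ds.
  by apply: continuous_subspaceT; exact: continuous_sin.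
rewrite in_itv /= sin0 !subr0 => /andP[c0 cx] sx.
have [c1 c2] : 0 <= cos c /\ 1 / 2 <= cos c ^+ 2 by apply: cos_ge; apply/andP; split; lra.
have [x1 x2] : 0 <= cos (x / 2) /\ 1 / 2 <= cos (x / 2) ^+ 2 by apply: cos_ge; apply/andP;
  split; lra.
have -> : x = (x / 2) *+ 2 by lra.
have xc : 1 / 2 <= cos (x / 2) * cos c.
  have m0 : 0 <= cos (x / 2) * cos c by rewrite mulr_ge0.
  have : 1 / 2 * (1 / 2) <= cos (x / 2) ^+ 2 * cos c ^+ 2 by apply: ler_pM; lra.
  by rewrite -exprMn; nra.
rewrite sin_mulr2n sx.
have : 1 / 2 * (x / 2) <= cos (x / 2) * cos c * (x / 2) by rewrite ler_wpM2r.
by lra.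
Qed.

(** Applied to half the difference of two angles, it says that they are close modulo a full turn. *)
Lemma sin_small x t : 0 <= x <= pi -> sin x <= t -> x <= 2 * t \/ pi - x <= 2 * t.
Proof.
move=> /andP[x0 xpi] st; have [xh|xh] := leP x (pi / 2).
  by left; have := @sin_ge_half x; rewrite x0 xh => /(_ isT); lra.
right; have := @sin_ge_half (pi - x).
have -> : sin (pi - x) = sin x by rewrite sinB sinpi cospi; ring.
have -> : 0 <= pi - x <= pi / 2 by apply/andP; split; lra.
by move=> /(_ isT); lra.
Qed.

(** A second difference is needed, not a first one: when the angle of every point of a strand
    changes, this bounds how fast the displacement varies along the strand. *)
Lemma cosB_mixed (a b c d : R) : `|cos a - cos b - (cos c - cos d)| <=
  2 * (`|b - d| * `|a - b| + `|(a - b) - (c - d)|).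
Proof.
have e u v : cos u - cos v = cos v * (cos (u - v) - 1) - sin v * sin (u - v).
  by have := cosD v (u - v); rewrite addrC subrK => ->; ring.
rewrite !e.
have -> : cos b * (cos (a - b) - 1) - sin b * sin (a - b) -
   (cos d * (cos (c - d) - 1) - sin d * sin (c - d)) =
   ((cos b - cos d) * (cos (a - b) - 1) + cos d * (cos (a - b) - cos (c - d))) -
   ((sin b - sin d) * sin (a - b) + sin d * (sin (a - b) - sin (c - d))) by ring.
apply: le_trans (ler_normB _ _) _.
have -> u : 2 * u = u + u :> R by ring.
apply: lerD; apply: le_trans (ler_normD _ _) _; rewrite !normrM; apply: lerD.
- by apply: ler_pM => //; [exact: cos_lipschitz|exact: normr_cosB1_le].
- rewrite -[leRHS]mul1r; apply: ler_pM => //; [exact: cos_max|exact: cos_lipschitz].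
- by apply: ler_pM => //; [exact: sin_lipschitz|exact: normr_sin_le].
- rewrite -[leRHS]mul1r; apply: ler_pM => //; [exact: sin_max|exact: sin_lipschitz].
Qed.

Lemma sinB_mixed (a b c d : R) : `|sin a - sin b - (sin c - sin d)| <=
  2 * (`|b - d| * `|a - b| + `|(a - b) - (c - d)|).
Proof.
have := cosB_mixed (a - pi / 2) (b - pi / 2) (c - pi / 2) (d - pi / 2).
have e u v : u - pi / 2 - (v - pi / 2) = u - v :> R by ring.
by rewrite !cosBpihalf !e.
Qed.

End Trigo.

Section Cylinder.
Variable R : realType.
Local Notation E := (R3 R).

Definition cyl (q : R * R) (t : R) : E := (q.1 * cos t, q.1 * sin t, q.2).

Lemma eq3 (p q : E) : p.1.1 = q.1.1 -> p.1.2 = q.1.2 -> p.2 = q.2 -> p = q.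
Proof. by case: p q => [[? ?] ?] [[? ?] ?] /= -> -> ->. Qed.

Lemma norm2_le (p : R * R) (d : R) : (`|p| <= d) = (`|p.1| <= d) && (`|p.2| <= d).
Proof. by rewrite /Num.norm /= ge_max. Qed.

Lemma norm2_comp (p : R * R) : `|p.1| <= `|p| /\ `|p.2| <= `|p|.
Proof. by have := lexx `|p|; rewrite {1}norm2_le => /andP. Qed.

Lemma cylD p q t : cyl (p + q) t = cyl p t + cyl q t.
Proof. by rewrite /cyl /= !mulrDl. Qed.

Lemma cylZ (a : R) q t : cyl (a *: q) t = a *: cyl q t.
Proof. by rewrite /cyl /= -!scalerAl. Qed.

Lemma cylN q t : cyl (- q) t = - cyl q t.
Proof. by rewrite /cyl /= !mulNr. Qed.

Lemma norm_cyl_le q t : `|cyl q t| <= `|q|.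
Proof.
have [h1 h2] := norm2_comp q; rewrite norm3_le /= h2 !normrM andbT.
by apply/andP; split; rewrite -[leRHS]mulr1 ler_pM// (cos_max,sin_max).
Qed.

Lemma cyl_angle_le q s t : `|cyl q s - cyl q t| <= `|q| * `|s - t|.
Proof.
have [h1 h2] := norm2_comp q; rewrite norm3_le /= subrr normr0 mulr_ge0// andbT.
rewrite -!mulrBr !normrM.
by apply/andP; split; rewrite ler_pM// (cos_lipschitz,sin_lipschitz).
Qed.

Lemma cyl_lipschitz p q s t : `|cyl p s - cyl q t| <= `|p - q| + `|q| * `|s - t|.
Proof.
have -> : cyl p s - cyl q t = cyl (p - q) s + (cyl q s - cyl q t).
  by rewrite cylD cylN addrA subrK.
apply: le_trans (ler_normD _ _) _; apply: lerD; first exact: norm_cyl_le.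
exact: cyl_angle_le.
Qed.

(* The law of cosines gives all three bounds. *)
Lemma cyl_dist (p q : R * R) s t (D : R) : 1 <= p.1 -> 1 <= q.1 ->
  `|cyl p s - cyl q t| <= D ->
  `|p - q| <= 2 * D /\ sin ((t - s) / 2) <= D.
Proof.
case: p q => [r z] [r' z'] /= r1 r'1; rewrite norm3_le /= => /and3P[hx hy hz].
have D0 : 0 <= D by apply: le_trans hz.
have cx : cos (t - s) = 1 - 2 * sin ((t - s) / 2) ^+ 2.
  have -> : cos (t - s) = cos (((t - s) / 2) *+ 2) by congr cos; lra.
  by rewrite cos_mulr2n cos2sin2; ring.
have e : (r * cos s - r' * cos t) ^+ 2 + (r * sin s - r' * sin t) ^+ 2 =
    (r - r') ^+ 2 + 4 * (r * r') * sin ((t - s) / 2) ^+ 2.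
  transitivity (r ^+ 2 * (cos s ^+ 2 + sin s ^+ 2) +
    r' ^+ 2 * (cos t ^+ 2 + sin t ^+ 2) - 2 * (r * r') * cos (t - s)).
    by rewrite cosB; ring.
  by rewrite !cos2Dsin2 cx; ring.
have sq (x : R) : `|x| <= D -> x ^+ 2 <= D ^+ 2.
  by move=> xD; rewrite -(real_normK (num_real x)) ler_sqr ?nnegrE.
have hxy := lerD (sq _ hx) (sq _ hy); rewrite e in hxy.
have s0 := sqr_ge0 (sin ((t - s) / 2)).
have rr : 1 <= r * r' by nra.
split.
  rewrite norm2_le /=; apply/andP; split; last by lra.
  rewrite -ler_sqr ?nnegrE ?mulr_ge0// real_normK ?num_real//.
  have : 0 <= 4 * (r * r') * sin ((t - s) / 2) ^+ 2 by rewrite mulr_ge0//; lra.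
  by nra.
have h : sin ((t - s) / 2) ^+ 2 <= D ^+ 2.
  have : 0 <= (r - r') ^+ 2 := sqr_ge0 _.
  have : sin ((t - s) / 2) ^+ 2 <= (r * r') * sin ((t - s) / 2) ^+ 2.
    by rewrite ler_peMl.
  by nra.
by apply: le_trans (ler_norm _) _; rewrite -ler_sqr ?nnegrE// real_normK ?num_real.
Qed.

End Cylinder.
(** * Closed braids around the axis *)

Section Sites.
Variable R : realType.
Local Notation E := (R3 R).
Implicit Types (N n k l : nat) (s t : R).

Lemma cosD2pi (x : R) : cos (x + 2 * pi) = cos x.
Proof. by rewrite mulr_natl cosD2pi. Qed.

Lemma sinD2pi (x : R) : sin (x + 2 * pi) = sin x.
Proof. by rewrite mulr_natl sinD2pi. Qed.

Lemma cylD2pi q (x : R) : cyl q (x + 2 * pi) = cyl q x.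
Proof. by rewrite /cyl cosD2pi sinD2pi. Qed.

(* A closed braid is cut into sectors.  The strand that starts in position [q] of the sector
   [k] is at [F k q s] (distance to the axis, height) at time [s] of this sector, it ends in
   position [p k q], and [Th u] is the angle after [u] sectors. *)
Definition site : Type := (nat * nat * R)%type.

Definition sites N n : set site :=
  [set a | [/\ (a.1.1 < N)%N, (a.1.2 < n)%N & 0 <= a.2 <= 1]].

Definition turn (a : site) : R := a.1.1%:R + a.2.

Definition place (F : nat -> nat -> R -> R * R) (Th : R -> R) (a : site) : E :=
  cyl (F a.1.1 a.1.2 a.2) (Th (turn a)).

(** The lower speed [c] lets angles bound times; the increment [2 * pi] closes the last sector up
    with the first one. *)
Definition clock N (Th : R -> R) (c C : R) : Prop :=
  [/\ 0 < c, Th N%:R = Th 0 + 2 * pi &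
      forall u v, 0 <= u -> u <= v -> v <= N%:R ->
        c * (v - u) <= Th v - Th u <= C * (v - u)].

(** The quantitative form of a closed braid: [C] bounds the speed of its strands, and [d] separates
    distinct strands at equal times. *)
Definition strands N n (p : nat -> nat -> nat) (F : nat -> nat -> R -> R * R)
    (C d : R) : Prop :=
  forall k q, (k < N)%N -> (q < n)%N ->
  [/\ (p k q < n)%N, F k q 1 = F (k.+1 %% N)%N (p k q) 0,
      forall s, 0 <= s <= 1 -> 1 <= (F k q s).1,
      forall s t, 0 <= s <= 1 -> 0 <= t <= 1 -> `|F k q s - F k q t| <= C * `|s - t|
    & forall q' s, (q' < n)%N -> q' <> q -> 0 <= s <= 1 -> d <= `|F k q s - F k q' s|].

(** Closeness along one strand. The second alternative goes forward across the end of a sector, so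
    the relation is tried in both orders. *)
Definition near_sites N (p : nat -> nat -> nat) (e : R) (a b : site) : Prop :=
  [/\ b.1.1 = a.1.1, b.1.2 = a.1.2 & `|a.2 - b.2| <= e] \/
  [/\ b.1.1 = (a.1.1.+1 %% N)%N, b.1.2 = p a.1.1 a.1.2 & 1 - a.2 + b.2 <= e].

(** Times that agree up to less than half a sector, modulo [N], lie in the same sector or in
    cyclically consecutive ones. *)
Lemma turn_close N k l (s t e : R) : (k < N)%N -> (l < N)%N ->
  0 <= s <= 1 -> 0 <= t <= 1 -> e < 1 / 2 ->
  `|k%:R + s - (l%:R + t)| <= e \/ N%:R - `|k%:R + s - (l%:R + t)| <= e ->
  [\/ l = k /\ `|s - t| <= e,
      l = (k.+1 %% N)%N /\ 1 - s + t <= e | k = (l.+1 %% N)%N /\ 1 - t + s <= e].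
Proof.
wlog : k l s t / (k <= l)%N => [H|kl kN lN s01 t01 e2].
  case: (leqP k l) => [kl|/ltnW lk]; first exact: H.
  move=> kN lN s01 t01 e2; rewrite distrC => h.
  have [[-> ?]|?|?] := H l k t s lk lN kN t01 s01 e2 h.
  - by apply: Or31; rewrite distrC.
  - exact: Or33.
  - exact: Or32.
move: (s01) (t01) => /andP[s0 s1] /andP[t0 t1].
case: (ltngtP k l) kl => // [kl _|<-{l lN} _]; last first.
  rewrite opprD addrACA subrr add0r => -[h|h]; first exact: Or31.
  (* A sector can be close to itself around the circle only if it is the only one, being its own
     successor. *)
  have N1 : N = 1%N.
    have : N%:R < 2 :> R by have : `|s - t| <= 1 by [apply/ler_normlP; split; lra]; lra.
    by rewrite (ltr_nat R N 2); case: N kN {h} => [|[]].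
  have k0 : k = 0%N by move: kN; rewrite N1; case: k.
  move: h; rewrite N1 k0 modn1; have [st|st] := leP s t.
    by rewrite ler0_norm ?subr_le0// => h; apply: Or33; split => //; lra.
  by rewrite gtr0_norm ?subr_gt0// => h; apply: Or32; split => //; lra.
have kl1 : k%:R + 1 <= l%:R :> R by rewrite natr1 ler_nat.
rewrite ler0_norm; last by lra.
move=> [h|h].
  have lk : l = k.+1.
    apply/eqP; rewrite eqn_leq kl andbT leqNgt; apply/negP => kl2.
    have : k%:R + 2 <= l%:R :> R by rewrite -natrD ler_nat addn2.
    by lra.
  apply: Or32; rewrite modn_small -?lk//; split => //.
  by move: h; rewrite lk -natr1; lra.
have Nl : N = l.+1.
  apply/eqP; rewrite eqn_leq lN andbT leqNgt; apply/negP => lN2.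
  have : l%:R + 2 <= N%:R :> R by rewrite -natrD ler_nat addn2.
  have : 0 <= k%:R :> R by [].
  by lra.
have k0 : k = 0%N.
  apply/eqP; rewrite -leqn0 leqNgt; apply/negP => k1.
  have : 1 <= k%:R :> R by rewrite ler1n.
  by move: h; rewrite Nl -natr1; lra.
apply: Or33; rewrite Nl modnn; split => //.
by move: h; rewrite Nl k0 -natr1; lra.
Qed.

(** The factor 4 collects the halving of the angle and the factor 2 of [sin_small]; the division by
    [c] turns angles into times. *)
Lemma clock_close N (Th : R -> R) (c C D : R) (u v : R) : clock N Th c C ->
  0 <= u <= N%:R -> 0 <= v <= N%:R ->
  sin ((Th v - Th u) / 2) <= D -> sin ((Th u - Th v) / 2) <= D ->
  `|u - v| <= 4 / c * D \/ N%:R - `|u - v| <= 4 / c * D.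
Proof.
move=> [c0 per gr]; wlog uv : u v / u <= v => [H|].
  case: (leP u v) => [/H//|/ltW/H] h u0 v0 s1 s2.
  by rewrite distrC; exact: h.
move=> /andP[u0 uN] /andP[v0 vN] h _.
have /andP[g1 _] := gr u v u0 uv vN.
have /andP[g2 _] := gr 0 u (lexx _) u0 uN.
have /andP[g3 _] := gr v N%:R v0 vN (lexx _).
rewrite ler0_norm ?subr_le0// opprB mulrAC ler_pdivlMr// ler_pdivlMr//.
have p1 := mulr_ge0 (ltW c0) (ltac:(lra) : 0 <= v - u).
have p2 := mulr_ge0 (ltW c0) (ltac:(lra) : 0 <= u - 0).
have p3 := mulr_ge0 (ltW c0) (ltac:(lra) : 0 <= N%:R - v).
have [|k1|k1] := @sin_small R ((Th v - Th u) / 2) D _ h.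
- by apply/andP; split; lra.
- by left; lra.
- by right; lra.
Qed.

(** Points close in space have close angles, hence close times, and then the separation [d] forces
    them onto one strand. [K] is chosen before [F] and [Th], so that one constant serves all stages
    of a homotopy. *)
Lemma sites_near N n p (C d c : R) : 0 <= C -> 0 < d -> 0 < c ->
  exists2 K, 0 < K & forall F Th C', strands N n p F C d -> clock N Th c C' ->
  forall a b, sites N n a -> sites N n b ->
  let e := K * `|place F Th a - place F Th b| in
  [\/ 1 <= e, near_sites N p e a b | near_sites N p e b a].
Proof.
move=> C0 d0 c0; pose K1 := 4 / c.
have K10 : 0 < K1 by rewrite divr_gt0.
have CK : 0 <= C * K1 by rewrite mulr_ge0// ltW.
have K20 : 0 <= (2 + C * K1) / d by apply: divr_ge0; lra.
exists (2 * K1 + (2 + C * K1) / d); first by lra.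
move=> F Th C' st ck [[k q] s] [[l r] t] /= [/= kN qn s01] [/= lN rn t01].
set D := `|_ - _|; set K := 2 * K1 + _.
have D0 : 0 <= D by exact: normr_ge0.
have /= [pk jk rk lk sk] := st k q kN qn.
have /= [pl jl rl ll sl] := st l r lN rn.
have [h1 h2] := cyl_dist (rk s s01) (rl t t01) (lexx D).
have h3 : sin ((Th (turn (k, q, s)) - Th (turn (l, r, t))) / 2) <= D.
  have DE : `|place F Th (l, r, t) - place F Th (k, q, s)| <= D by rewrite distrC.
  by have [] := cyl_dist (rl t t01) (rk s s01) DE.
have tN i (x : R) : (i < N)%N -> 0 <= x <= 1 -> 0 <= i%:R + x <= N%:R.
  move=> iN /andP[x0 x1]; rewrite addr_ge0//=.
  by rewrite (@le_trans _ _ i.+1%:R) ?ler_nat// -natr1 lerD2l.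
have KD : K * D = 2 * (K1 * D) + (2 + C * K1) / d * D by rewrite /K; ring.
have KD2 : 0 <= (2 + C * K1) / d * D by rewrite mulr_ge0.
have KD1 : 0 <= K1 * D by rewrite mulr_ge0// ltW.
have [big|small] := leP (1 / 2) (K1 * D); first by apply: Or31; lra.
(* On distinct strands, [d] is at most the distance of the positions plus the motion during the time
   difference [x], which is itself a multiple of [D]. *)
have far (x : R) : d <= 2 * D + C * x -> x <= K1 * D -> 1 <= K * D.
  move=> dx xD; suff : 1 <= (2 + C * K1) / d * D by lra.
  rewrite mulrAC ler_pdivlMr// mul1r.
  have : C * x <= C * (K1 * D) by rewrite ler_wpM2l.
  by lra.
have tri (x y z w : R * R) : `|x - w| <= `|x - y| + `|y - z| + `|z - w|.
  by have := ler_distD z x w; have := ler_distD y x z; lra.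
have i01 : 0 <= (1 : R) <= 1 by rewrite ler01 lexx.
have o01 : 0 <= (0 : R) <= 1 by rewrite ler01 lexx.
have [[lE tE]|[lE tE]|[kE tE]] := turn_close kN lN s01 t01 small
  (clock_close ck (tN k s kN s01) (tN l t lN t01) h2 h3).
- have [rq|rq] := eqVneq r q.
    by apply: Or32; left; split => //=; lra.
  apply: Or31; apply: far (tE) => //.
  move: h1; rewrite lE => h1.
  have := sk r s rn (elimN eqP rq) s01.
  have := ler_distD (F k r t) (F k q s) (F k r s).
  have := ll t s t01 s01; rewrite lE (distrC t); lra.
- have [rq|rq] := eqVneq r (p k q).
    by apply: Or32; right; split => //=; lra.
  apply: Or31; apply: far (tE) => //.
  have [_ _ _ _ sp] := st l (p k q) lN pk.
  have := sp r 0 rn (elimN eqP rq) o01.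
  rewrite lE -jk -lE.
  have := tri (F k q 1) (F k q s) (F l r t) (F l r 0).
  have := lk 1 s i01 s01; have := ll t 0 t01 o01.
  rewrite subr0; move: (s01) (t01) => /andP[s0 s1] /andP[t0 t1].
  rewrite (ger0_norm t0) (@ger0_norm _ (1 - s)) ?subr_ge0//; lra.
- have [rq|rq] := eqVneq q (p l r).
    by apply: Or33; right; split => //=; lra.
  apply: Or31; apply: far (tE) => //.
  have [_ _ _ _ sp] := st k (p l r) kN pl.
  have := sp q 0 qn (elimN eqP rq) o01.
  rewrite kE -jl -kE.
  have := tri (F l r 1) (F l r t) (F k q s) (F k q 0).
  have := ll 1 t i01 t01; have := lk s 0 s01 o01.
  rewrite subr0; move: (s01) (t01) => /andP[s0 s1] /andP[t0 t1].
  rewrite (ger0_norm s0) (@ger0_norm _ (1 - t)) ?subr_ge0// (distrC (F l r t)); lra.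
Qed.

(** Displacements of the points of a closed braid: bounded, Lipschitz along each strand, and
    matching across sector boundaries. *)
Definition field N n p (w : site -> E) (B : R) : Prop :=
  forall k q, (k < N)%N -> (q < n)%N ->
  [/\ (p k q < n)%N, w (k, q, 1) = w ((k.+1 %% N)%N, p k q, 0),
      forall s, 0 <= s <= 1 -> `|w (k, q, s)| <= B
    & forall s t, 0 <= s <= 1 -> 0 <= t <= 1 ->
        `|w (k, q, s) - w (k, q, t)| <= B * `|s - t|].

(** Near sites are compared along their common strand; for [1 <= e] the bound [2 * B] on the
    difference is enough. With [sites_near] this gives the estimate that [linear_iso3] and
    [family_iso3] ask for. *)
Lemma field_lipschitz N n p w (B e : R) a b : field N n p w B -> 0 <= B ->
  sites N n a -> sites N n b ->
  [\/ 1 <= e, near_sites N p e a b | near_sites N p e b a] ->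
  `|w a - w b| <= 2 * B * e.
Proof.
move=> fw B0; have i01 : 0 <= (1 : R) <= 1 by rewrite ler01 lexx.
have o01 : 0 <= (0 : R) <= 1 by rewrite ler01 lexx.
have near x y : sites N n x -> sites N n y -> near_sites N p e x y ->
    `|w x - w y| <= 2 * B * e.
  move=> [] + + + []; case: x y => [[k q] s] [[l r] t] /= kN qn s01 lN rn t01.
  have [_ jk _ lk] := fw k q kN qn; have [_ _ _ ll] := fw l r lN rn.
  move=> [[/= lE rE stE]|[/= lE rE stE]].
    move: ll => _; rewrite lE rE; apply: le_trans (lk s t s01 t01) _.
    have := normr_ge0 (s - t) => st0.
    by have : B * `|s - t| <= B * e by [rewrite ler_wpM2l];
      have := mulr_ge0 B0 (le_trans st0 stE); lra.
  have := lk s 1 s01 i01; have := ll 0 t o01 t01.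
  rewrite jk lE rE -lE -rE.
  have := ler_distD (w (l, r, 0)) (w (k, q, s)) (w (l, r, t)).
  move: (s01) (t01) => /andP[s0 s1] /andP[t0 t1].
  rewrite sub0r normrN (ger0_norm t0) ler0_norm ?subr_le0// opprB.
  have : B * (1 - s + t) <= B * e by rewrite ler_wpM2l.
  have : 0 <= B * e by rewrite mulr_ge0//; lra.
  by lra.
move=> sa sb [e1|h|h]; [|exact: near|by rewrite distrC; exact: near].
apply: (@le_trans _ _ (2 * B)); last by rewrite ler_peMr// mulr_ge0.
apply: le_trans (ler_normB _ _) _.
case: a b sa sb => [[k q] s] [[l r] t] [/= kN qn s01] [/= lN rn t01].
have [_ _ /(_ s s01) + _] := fw k q kN qn; have [_ _ /(_ t t01) + _] := fw l r lN rn.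
by lra.
Qed.

End Sites.

(** * Lipschitz functions on the unit interval *)

Section Lipschitz.
Variable R : realType.
Implicit Types f g : R -> R.

Definition lip1 f : Prop := exists C, forall s t, 0 <= s <= 1 -> 0 <= t <= 1 ->
  `|f s - f t| <= C * `|s - t|.

Lemma lip1_cst (a : R) : lip1 (fun=> a).
Proof. by exists 0 => s t _ _; rewrite subrr normr0 mul0r. Qed.

Lemma lip1_id : lip1 id.
Proof. by exists 1 => s t _ _; rewrite mul1r. Qed.

Lemma lip1N f : lip1 f -> lip1 (fun s => - f s).
Proof.
by move=> [C fC]; exists C => s t s01 t01; rewrite -opprD normrN; exact: fC.
Qed.

Lemma lip1D f g : lip1 f -> lip1 g -> lip1 (fun s => f s + g s).
Proof.
move=> [C fC] [D gD]; exists (C + D) => s t s01 t01.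
rewrite opprD addrACA mulrDl; apply: le_trans (ler_normD _ _) _.
by apply: lerD; [exact: fC|exact: gD].
Qed.

Lemma lip1B f g : lip1 f -> lip1 g -> lip1 (fun s => f s - g s).
Proof. by move=> fC /lip1N gD; exact: lip1D. Qed.

Lemma lip1_bounded f : lip1 f -> exists C, forall s, 0 <= s <= 1 -> `|f s| <= C.
Proof.
move=> [C fC]; exists (`|C| + `|f 0|) => s s01.
rewrite -[f s](subrK (f 0)); apply: le_trans (ler_normD _ _) _; rewrite lerD2r.
apply: le_trans (fC s 0 s01 _) _; first by rewrite lexx ler01.
move: s01 => /andP[s0 s1]; rewrite subr0 (ger0_norm s0).
have := ler_norm C; have := normr_ge0 C; nra.
Qed.

Lemma lip1M f g : lip1 f -> lip1 g -> lip1 (fun s => f s * g s).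
Proof.
move=> lf lg; have [A fA] := lip1_bounded lf; have [B gB] := lip1_bounded lg.
move: lf lg => [C fC] [D gD]; exists (B * C + A * D) => s t s01 t01.
have -> : f s * g s - f t * g t = g s * (f s - f t) + f t * (g s - g t) by ring.
apply: le_trans (ler_normD _ _) _; rewrite !normrM mulrDl -!mulrA.
by apply: lerD; apply: ler_pM => //; [exact: gB|exact: fC|exact: fA|exact: gD].
Qed.

Lemma lip1_cos f : lip1 f -> lip1 (fun s => cos (f s)).
Proof.
by move=> [C fC]; exists C => s t s01 t01; apply: le_trans (cos_lipschitz _ _) (fC _ _ _ _).
Qed.

Lemma lip1_sin f : lip1 f -> lip1 (fun s => sin (f s)).
Proof.
by move=> [C fC]; exists C => s t s01 t01; apply: le_trans (sin_lipschitz _ _) (fC _ _ _ _).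
Qed.

Lemma max_lipschitz (a b c d : R) :
  `|Order.max a b - Order.max c d| <= Order.max `|a - c| `|b - d|.
Proof.
have h1 : `|a - c| <= Order.max `|a - c| `|b - d| by rewrite le_max lexx.
have h2 : `|b - d| <= Order.max `|a - c| `|b - d| by rewrite le_max lexx orbT.
move: h1 h2; set m := Order.max `|a - c| _ => /ler_normlP[h1 h1'] /ler_normlP[h2 h2'].
by apply/ler_normlP; split; rewrite !maxEle; do 2?case: ifPn; lra.
Qed.

Lemma lip1_max f g : lip1 f -> lip1 g -> lip1 (fun s => Order.max (f s) (g s)).
Proof.
move=> [C fC] [D gD]; exists (Order.max C D) => s t s01 t01.
apply: le_trans (max_lipschitz _ _ _ _) _; rewrite ge_max; apply/andP; split.
  by apply: le_trans (fC _ _ s01 t01) _; rewrite ler_wpM2r// le_max lexx.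
by apply: le_trans (gD _ _ s01 t01) _; rewrite ler_wpM2r// le_max lexx orbT.
Qed.

Lemma lip1_within_continuous f : lip1 f -> {within `[0, 1], continuous f}.
Proof.
move=> [C fC]; apply/subspace_continuousP => x x01.
apply/cvgrPdist_le => e e0.
have C0 : 0 < `|C| + 1 by rewrite ltr_pwDr.
near=> y; have y01 : y \in `[0, 1] by near: y; exact: withinT.
rewrite !in_itv /= in x01 y01; apply: le_trans (fC x y x01 y01) _.
apply: (@le_trans _ _ ((`|C| + 1) * `|x - y|)).
  by rewrite ler_wpM2r// (le_trans (ler_norm _))// lerDl.
rewrite mulrC -ler_pdivlMr//; near: y.
apply: cvg_within; have /cvgrPdist_le := @cvg_id _ (nbhs x).
by apply; rewrite divr_gt0.
Unshelve. all: by end_near. Qed.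

Lemma lip1_pos f : lip1 f -> (forall s, 0 <= s <= 1 -> 0 < f s) ->
  exists2 m, 0 < m & forall s, 0 <= s <= 1 -> m <= f s.
Proof.
move=> lf f0; have [c c01 fc] := EVT_min ler01 (lip1_within_continuous lf).
rewrite in_itv /= in c01; exists (f c); first exact: f0.
by move=> s s01; apply: fc; rewrite in_itv.
Qed.

(** Since a constant may always be increased, the maximum serves all indices. This turns the
    qualitative [picture] into uniform bounds. *)
Lemma fin_bound (N : nat) (P : nat -> R -> Prop) :
  (forall k C D, C <= D -> P k C -> P k D) ->
  (forall k, (k < N)%N -> exists C, P k C) ->
  exists C, 0 <= C /\ forall k, (k < N)%N -> P k C.
Proof.
move=> mono; elim: N => [_|N IH h]; first by exists 0.
have [|C [C0 CP]] := IH; first by move=> k kN; apply: h; exact: ltnW.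
have [D DP] := h N (ltnSn N); exists (Order.max C D); split.
  by rewrite le_max C0.
move=> k; rewrite ltnS leq_eqVlt => /predU1P[->|/CP Pk].
  by apply: mono DP; rewrite le_max lexx orbT.
by apply: mono Pk; rewrite le_max lexx.
Qed.

End Lipschitz.

(** * Homotopies of closed braids *)

Section Pictures.
Variable R : realType.
Local Notation E := (R3 R).
Implicit Types (N n k : nat) (F G : nat -> nat -> R -> R * R) (p : nat -> nat -> nat).

Definition closed_picture N n F (Th : R -> R) : set E := place F Th @` sites N n.

Definition picture N n p F : Prop := forall k q, (k < N)%N -> (q < n)%N ->
  [/\ (p k q < n)%N, F k q 1 = F (k.+1 %% N)%N (p k q) 0,
      lip1 (fun s => (F k q s).1), lip1 (fun s => (F k q s).2)
    & forall s, 0 <= s <= 1 -> 1 <= (F k q s).1].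

(* Under this condition the straight-line homotopy from [F] to [G] does not
   make two strands collide. *)
Definition same_order N n F G : Prop := forall k q q' (s : R),
  (k < N)%N -> (q < n)%N -> (q' < n)%N -> q <> q' -> 0 <= s <= 1 ->
  0 < (F k q s - F k q' s).1 * (G k q s - G k q' s).1 \/
  0 < (F k q s - F k q' s).2 * (G k q s - G k q' s).2.

Lemma picture_bound N n p F : picture N n p F -> exists C, 0 <= C /\
  forall k, (k < N)%N -> forall q, (q < n)%N ->
    (forall s, 0 <= s <= 1 -> `|F k q s| <= C) /\
    forall s t, 0 <= s <= 1 -> 0 <= t <= 1 -> `|F k q s - F k q t| <= C * `|s - t|.
Proof.
move=> Fp; apply: fin_bound => [k C D CD h q qn|k kN].
  have [h1 h2] := h q qn; split=> [s s01|s t s01 t01].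
    exact: le_trans (h1 _ s01) CD.
  by apply: le_trans (h2 _ _ s01 t01) _; rewrite ler_wpM2r.
suff [C [_ CP]] : exists C, 0 <= C /\ forall q, (q < n)%N ->
    (forall s, 0 <= s <= 1 -> `|F k q s| <= C) /\
    forall s t, 0 <= s <= 1 -> 0 <= t <= 1 -> `|F k q s - F k q t| <= C * `|s - t|.
  by exists C.
apply: fin_bound => [q C D CD [h1 h2]|q qn].
  split=> [s s01|s t s01 t01]; first exact: le_trans (h1 _ s01) CD.
  by apply: le_trans (h2 _ _ s01 t01) _; rewrite ler_wpM2r.
have [_ _ l1 l2 _] := Fp k q kN qn.
have [A1 b1] := lip1_bounded l1; have [A2 b2] := lip1_bounded l2.
move: l1 l2 => [C1 c1] [C2 c2].
exists (Order.max (Order.max A1 A2) (Order.max C1 C2)); split=> [s s01|s t s01 t01].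
  by rewrite norm2_le !le_max b1// b2// !orbT.
rewrite norm2_le; apply/andP; split.
  by apply: le_trans (c1 _ _ s01 t01) _; rewrite ler_wpM2r// !le_max lexx !orbT.
by apply: le_trans (c2 _ _ s01 t01) _; rewrite ler_wpM2r// !le_max lexx !orbT.
Qed.

(** A positive product forces equal signs, and each factor is at least [m / B] in absolute value
    because the other one is at most [B]; so is every point of the segment between them. *)
Lemma segment_away0 (x y B m t : R) : 0 < B -> `|x| <= B -> `|y| <= B ->
  m <= x * y -> 0 < m -> 0 <= t <= 1 -> m / B <= `|x + t * (y - x)|.
Proof.
move=> B0; wlog x0 : x y / 0 <= x => [H|] xB yB mxy m0 t01.
  case: (leP 0 x) => [/H|/ltW x0]; first exact.
  have := H (- x) (- y); rewrite oppr_ge0 !normrN mulrNN => /(_ x0 xB yB mxy m0 t01).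
  by rewrite -opprD mulrN -opprD normrN.
have x1 : 0 < x by rewrite lt_neqAle x0 andbT; apply/eqP => xE; rewrite -xE in mxy; nra.
have y1 : 0 < y by nra.
rewrite gtr0_norm in xB => //; rewrite gtr0_norm in yB => //.
move: t01 => /andP[t0 t1].
have xm : m / B <= x by rewrite ler_pdivrMr//; nra.
have ym : m / B <= y by rewrite ler_pdivrMr//; nra.
apply: le_trans (ler_norm _).
have : 0 <= (1 - t) * (x - m / B) by rewrite mulr_ge0//; lra.
have : 0 <= t * (y - m / B) by rewrite mulr_ge0//; lra.
lra.
Qed.

(** Compactness makes the strict inequalities of [same_order] uniform, and [segment_away0] extends
    them to the whole straight-line homotopy. *)
Lemma same_order_away N n p F G : picture N n p F -> picture N n p G ->
  same_order N n F G -> exists2 d, 0 < d &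
  forall k q q' (s t : R), (k < N)%N -> (q < n)%N -> (q' < n)%N -> q <> q' ->
    0 <= s <= 1 -> 0 <= t <= 1 ->
    d <= `|F k q s - F k q' s + t *: (G k q s - G k q' s - (F k q s - F k q' s))|.
Proof.
move=> Fp Gp FG.
(* The separation is recorded through an upper bound [C] of its inverse, because [fin_bound] needs a
   property that is monotone in the constant. *)
pose W k q q' (C : R) := forall s t : R, q <> q' -> 0 <= s <= 1 -> 0 <= t <= 1 ->
  1 <= C * `|F k q s - F k q' s + t *: (G k q s - G k q' s - (F k q s - F k q' s))|.
have Wm k q q' C D : C <= D -> W k q q' C -> W k q q' D.
  by move=> CD h s t qq' s01 t01; apply: le_trans (h s t qq' s01 t01) _; rewrite ler_wpM2r.
suff [C [C0 CP]] : exists C, 0 <= C /\ forall k, (k < N)%N ->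
    forall q, (q < n)%N -> forall q', (q' < n)%N -> W k q q' C.
  exists (C + 1)^-1; first by rewrite invr_gt0; lra.
  move=> k q q' s t kN qn q'n qq' s01 t01.
  have := CP k kN q qn q' q'n s t qq' s01 t01; set m := `|_| => Cm.
  have m0 : 0 <= m by exact: normr_ge0.
  have C1 : 0 < C + 1 by rewrite ltr_wpDl.
  rewrite -[leLHS]mul1r ler_pdivrMr// mulrDr mulr1 mulrC.
  by rewrite (le_trans Cm)// lerDl.
apply: fin_bound => [k C D CD h q qn q' q'n|k kN]; first exact: Wm (h q qn q' q'n).
suff [C [C0 CP]] : exists C, 0 <= C /\
    forall q, (q < n)%N -> forall q', (q' < n)%N -> W k q q' C by exists C.
apply: fin_bound => [q C D CD h q' q'n|q qn]; first exact: Wm (h q' q'n).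
suff [C [C0 CP]] : exists C, 0 <= C /\
    forall q', (q' < n)%N -> W k q q' C by exists C.
apply: fin_bound => [q' C D CD h|q' q'n]; first exact: Wm h.
have [->|/eqP qq'] := eqVneq q q'; first by exists 0 => s t.
have [_ _ f1 f2 _] := Fp k q kN qn; have [_ _ f1' f2' _] := Fp k q' kN q'n.
have [_ _ g1 g2 _] := Gp k q kN qn; have [_ _ g1' g2' _] := Gp k q' kN q'n.
have lx1 := lip1B f1 f1'; have lx2 := lip1B f2 f2'.
have ly1 := lip1B g1 g1'; have ly2 := lip1B g2 g2'.
(* The maximum of the two products is a single Lipschitz function that is positive everywhere,
   whichever coordinate separates the strands at a given time. *)
have [||m m0 mP] := @lip1_pos R (fun s => Order.max
  (((F k q s).1 - (F k q' s).1) * ((G k q s).1 - (G k q' s).1))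
  (((F k q s).2 - (F k q' s).2) * ((G k q s).2 - (G k q' s).2))).
- by apply: lip1_max; exact: lip1M.
- by move=> s s01; rewrite lt_max; apply/orP; exact: (FG k q q' s kN qn q'n qq' s01).
have [B1 b1] := lip1_bounded lx1; have [B2 b2] := lip1_bounded lx2.
have [B3 b3] := lip1_bounded ly1; have [B4 b4] := lip1_bounded ly2.
pose B := `|B1| + `|B2| + `|B3| + `|B4| + 1.
have hB : [/\ B1 <= B, B2 <= B, B3 <= B, B4 <= B & 0 < B].
  have := (ler_norm B1, ler_norm B2, ler_norm B3, ler_norm B4).
  have := (normr_ge0 B1, normr_ge0 B2, normr_ge0 B3, normr_ge0 B4).
  by rewrite /B; clear => -[[[? ?] ?] ?] [[[? ?] ?] ?]; split; lra.
case: hB => h1 h2 h3 h4 B0.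
exists (B / m) => s t _ s01 t01; set w := _ + _.
suff : m / B <= `|w|.
  by rewrite ler_pdivrMr// mulrAC ler_pdivlMr// mul1r mulrC.
have [c1 c2] := norm2_comp w.
have := mP s s01; rewrite le_max => /orP[h|h].
  apply: le_trans c1; apply: segment_away0 h _ t01 => //.
    exact: le_trans (b1 s s01) h1.
  exact: le_trans (b3 s s01) h3.
apply: le_trans c2; apply: segment_away0 h _ t01 => //.
  exact: le_trans (b2 s s01) h2.
exact: le_trans (b4 s s01) h4.
Qed.

Lemma clock_lipschitz N Th (c C : R) k s t : clock N Th c C -> (k < N)%N ->
  0 <= s <= 1 -> 0 <= t <= 1 ->
  0 <= C /\ `|Th (k%:R + s) - Th (k%:R + t)| <= C * `|s - t|.
Proof.
move=> [c0 _ gr] kN s01 t01.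
have k0 : 0 <= k%:R :> R by [].
have k1 : k%:R + 1 <= N%:R :> R by rewrite natr1 ler_nat.
split; first by have /andP[] := gr k%:R (k%:R + 1) k0 ltac:(lra) k1; nra.
wlog st : s t s01 t01 / t <= s => [H|].
  case: (leP t s) => [/H|/ltW/H]; first exact.
  by rewrite distrC (distrC s); exact.
move: s01 t01 => /andP[s0 s1] /andP[t0 t1].
have /andP[g1 g2] := gr (k%:R + t) (k%:R + s) ltac:(lra) ltac:(lra) ltac:(lra).
rewrite (@ger0_norm _ (s - t)) ?subr_ge0// ger0_norm; first by lra.
by have : 0 <= c * (s - t) by [rewrite mulr_ge0 ?subr_ge0// ltW]; lra.
Qed.

Lemma place_junction N F Th (c C : R) k q q' : clock N Th c C -> (k < N)%N ->
  F k q 1 = F (k.+1 %% N)%N q' 0 ->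
  place F Th (k, q, 1) = place F Th ((k.+1 %% N)%N, q', 0).
Proof.
move=> [_ per _] kN FE; rewrite /place /turn /= FE addr0.
have [kN1|] := ltnP k.+1 N; first by rewrite modn_small// natr1.
move=> Nk; have -> : N = k.+1 by apply/eqP; rewrite eqn_leq Nk.
have Nk1 : N = k.+1 by apply/eqP; rewrite eqn_leq Nk.
by rewrite modnn natr1 -Nk1 per cylD2pi.
Qed.

(** With the clock fixed, interpolating the positions is a straight-line motion in space, as [cyl]
    is linear in the position; the intermediate pictures are uniformly embedded by
    [same_order_away]. *)
Theorem picture_homotopy N n p F G Th (c C : R) :
  picture N n p F -> picture N n p G -> same_order N n F G -> clock N Th c C ->
  iso3 (closed_picture N n F Th) (closed_picture N n G Th).
Proof.
move=> Fp Gp FG ck.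
have [A [A0 FA]] := picture_bound Fp; have [B [B0 GB]] := picture_bound Gp.
have [d d0 dP] := same_order_away Fp Gp FG.
pose L (t : R) := fun k q s => F k q s + t *: (G k q s - F k q s).
have AB0 : 0 <= A + B by rewrite addr_ge0.
have c0 : 0 < c by case: ck.
have [K K0 KP] := @sites_near R N n p (A + (A + B)) d c (addr_ge0 A0 AB0) d0 c0.
have Ls (t : R) : 0 <= t <= 1 -> strands N n p (L t) (A + (A + B)) d.
  move=> t01 k q kN qn; have [pk jF _ _ rF] := Fp k q kN qn.
  have [_ jG _ _ rG] := Gp k q kN qn; have [_ lF] := FA k kN q qn.
  have [_ lG] := GB k kN q qn; move: (t01) => /andP[t0 t1]; split => //.
  - by rewrite /L jF jG.
  - move=> s s01; have h1 := rF s s01; have h2 := rG s s01.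
    have h3 : 0 <= (1 - t) * ((F k q s).1 - 1) by rewrite mulr_ge0// subr_ge0.
    have h4 : 0 <= t * ((G k q s).1 - 1) by rewrite mulr_ge0// subr_ge0.
    suff : 1 <= (F k q s).1 + t * ((G k q s).1 - (F k q s).1) by [].
    by move: h3 h4; clear; lra.
  - move=> s s' s01 s'01; rewrite /L.
    have -> : F k q s + t *: (G k q s - F k q s) -
        (F k q s' + t *: (G k q s' - F k q s')) = (F k q s - F k q s') +
        t *: ((G k q s - G k q s') - (F k q s - F k q s')).
      by rewrite opprD addrACA -scalerBr !opprB; congr (_ + _ *: _);
        rewrite addrACA [RHS]addrACA; congr (_ + _); rewrite addrC.
    apply: le_trans (ler_normD _ _) _; rewrite mulrDl; apply: lerD; first exact: lF.
    rewrite normrZ (ger0_norm t0); apply: (@le_trans _ _ (1 * `|G k q s - G k q s' -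
      (F k q s - F k q s')|)).
      by rewrite ler_wpM2r.
    rewrite mul1r; apply: le_trans (ler_normB _ _) _.
    by rewrite addrC mulrDl; apply: lerD; [exact: lF|exact: lG].
  - move=> q' s q'n qq' s01; rewrite /L.
    have -> : F k q s + t *: (G k q s - F k q s) -
        (F k q' s + t *: (G k q' s - F k q' s)) = (F k q s - F k q' s) +
        t *: ((G k q s - G k q' s) - (F k q s - F k q' s)).
      by rewrite opprD addrACA -scalerBr !opprB; congr (_ + _ *: _);
        rewrite addrACA [RHS]addrACA; congr (_ + _); rewrite addrC.
    by apply: dP => //; exact: nesym.
pose V k q s := G k q s - F k q s.
have fV : field N n p (place V Th) ((A + B) * (1 + C)).
  move=> k q kN qn; have [pk jF _ _ rF] := Fp k q kN qn.
  have [_ jG _ _ rG] := Gp k q kN qn; have [bF lF] := FA k kN q qn.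
  have [bG lG] := GB k kN q qn.
  have i01 : 0 <= (1 : R) <= 1 by rewrite ler01 lexx.
  have [C0 _] := clock_lipschitz ck kN i01 i01.
  have bV s : 0 <= s <= 1 -> `|V k q s| <= A + B.
    move=> s01; apply: le_trans (ler_normB _ _) _.
    by rewrite addrC; apply: lerD; [exact: bF|exact: bG].
  split => //.
  - by apply: place_junction ck kN _; rewrite /V jF jG.
  - move=> s s01; apply: le_trans (norm_cyl_le _ _) _; apply: le_trans (bV s s01) _.
    by rewrite ler_peMr// lerDl.
  - move=> s t s01 t01; apply: le_trans (cyl_lipschitz _ _ _ _) _.
    have [_ Thst] := clock_lipschitz ck kN s01 t01.
    rewrite mulrDr mulr1 mulrDl; apply: lerD.
      have -> : V k q s - V k q t = (G k q s - G k q t) - (F k q s - F k q t).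
        by rewrite /V !opprB addrACA [RHS]addrACA; congr (_ + _); rewrite addrC.
      apply: le_trans (ler_normB _ _) _.
      by rewrite addrC mulrDl; apply: lerD; [exact: lF|exact: lG].
    rewrite -mulrA; apply: ler_pM => //; exact: bV.
have C0 (a : site R) : sites N n a -> 0 <= C.
  move=> [aN _ a01]; by have [] := clock_lipschitz ck aN a01 a01.
have -> : closed_picture N n G Th =
    [set place F Th a + place V Th a | a in sites N n].
  apply: eq_imagel => a _; rewrite /place -cylD; congr cyl.
  by rewrite /V addrC subrK.
apply: (@linear_iso3 _ _ _ _ _ (2 * ((A + B) * (1 + C)) * K)) => t a b t01 sa sb.
have B'0 : 0 <= (A + B) * (1 + C) by rewrite mulr_ge0// addr_ge0// (C0 a).
have LE x : place (L t) Th x = place F Th x + t *: place V Th x.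
  by rewrite /place -cylZ -cylD.
have -> : place F Th a - place F Th b + t *: (place V Th a - place V Th b) =
    place (L t) Th a - place (L t) Th b.
  by rewrite !LE opprD addrACA -scalerBr.
rewrite -[leRHS]mulrA.
exact: (field_lipschitz fV B'0 sa sb (KP (L t) Th C (Ls t t01) ck a b sa sb)).
Qed.

Lemma embedded_strands N n p F : picture N n p F -> same_order N n F F ->
  exists A d, [/\ 0 <= A, 0 < d, strands N n p F A d &
    forall k q, (k < N)%N -> (q < n)%N -> forall s, 0 <= s <= 1 -> `|F k q s| <= A].
Proof.
move=> Fp FF; have [A [A0 FA]] := picture_bound Fp.
have [d d0 dP] := same_order_away Fp Fp FF; exists A, d; split => //.
  move=> k q kN qn; have [pk jF _ _ rF] := Fp k q kN qn; have [_ lF] := FA k kN q qn.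
  split => // q' s q'n qq' s01.
  have := dP k q q' s 0 kN qn q'n (nesym qq') s01.
  by rewrite scale0r addr0 lexx ler01 => /(_ isT).
by move=> k q kN qn; have [] := FA k kN q qn.
Qed.

(** Clocks are interpolated linearly. Points then move on circles, so [family_iso3] replaces
    [linear_iso3], and the second differences of sine and cosine enter. *)
Theorem clock_change N n p F Th0 Th1 (c0 C0 c1 C1 : R) :
  picture N n p F -> same_order N n F F ->
  clock N Th0 c0 C0 -> clock N Th1 c1 C1 ->
  iso3 (closed_picture N n F Th0) (closed_picture N n F Th1).
Proof.
move=> Fp FF ck0 ck1; have [A [d [A0 d0 Fs FA]]] := embedded_strands Fp FF.
have [c00 per0 gr0] := ck0; have [c10 per1 gr1] := ck1.
pose c := Order.min c0 c1; pose C := Order.max C0 C1.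
have c_gt0 : 0 < c by rewrite lt_min c00.
pose Th (t : R) u := Th0 u + t * (Th1 u - Th0 u).
have ckT (t : R) : 0 <= t <= 1 -> clock N (Th t) c C.
  move=> /andP[t0 t1]; split=> // [|u v u0 uv vN]; first by rewrite /Th per0 per1; ring.
  have /andP[a1 a2] := gr0 u v u0 uv vN; have /andP[b1 b2] := gr1 u v u0 uv vN.
  have vu : 0 <= v - u by rewrite subr_ge0.
  have h1 : c * (v - u) <= c0 * (v - u) by rewrite ler_wpM2r// ge_min lexx.
  have h2 : c * (v - u) <= c1 * (v - u) by rewrite ler_wpM2r// ge_min lexx orbT.
  have h3 : C0 * (v - u) <= C * (v - u) by rewrite ler_wpM2r// le_max lexx.
  have h4 : C1 * (v - u) <= C * (v - u) by rewrite ler_wpM2r// le_max lexx orbT.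
  rewrite /Th; move: h1 h2 h3 h4 a1 a2 b1 b2.
  move: (c * (v - u)) (C * (v - u)) (c0 * (v - u)) (C0 * (v - u)) (c1 * (v - u))
    (C1 * (v - u)) => m M m0 M0 m1 M1 h1 h2 h3 h4 a1 a2 b1 b2.
  have t1' : 0 <= 1 - t by rewrite subr_ge0.
  have e1 := mulr_ge0 t1' (ltac:(lra) : 0 <= Th0 v - Th0 u - m).
  have e2 := mulr_ge0 t0 (ltac:(lra) : 0 <= Th1 v - Th1 u - m).
  have e3 := mulr_ge0 t1' (ltac:(lra) : 0 <= M - (Th0 v - Th0 u)).
  have e4 := mulr_ge0 t0 (ltac:(lra) : 0 <= M - (Th1 v - Th1 u)).
  by apply/andP; split; move: e1 e2 e3 e4; clear; lra.
have [K K0 KP] := @sites_near R N n p A d c A0 d0 c_gt0.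
pose D u := Th1 u - Th0 u.
have DE (s t u : R) : Th t u - Th s u = (t - s) * D u by rewrite /Th /D; ring.
have [Dl [Dl0 DlP]] : exists B, 0 <= B /\ forall k, (k < N)%N ->
    (forall s, 0 <= s <= 1 -> `|D (k%:R + s)| <= B) /\
    forall s t, 0 <= s <= 1 -> 0 <= t <= 1 ->
      `|D (k%:R + s) - D (k%:R + t)| <= B * `|s - t|.
  apply: fin_bound => [k B B' BB [h1 h2]|k kN].
    split=> [s s01|s t s01 t01]; first exact: le_trans (h1 _ s01) BB.
    by apply: le_trans (h2 _ _ s01 t01) _; rewrite ler_wpM2r.
  have lD : lip1 (fun s => D (k%:R + s)).
    apply: lip1B.
      by exists C1 => s t s01 t01; have [] := clock_lipschitz ck1 kN s01 t01.
    by exists C0 => s t s01 t01; have [] := clock_lipschitz ck0 kN s01 t01.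
  have [B bB] := lip1_bounded lD; case: lD => B' bB'.
  exists (Order.max B B'); split=> [s s01|s t s01 t01].
    by rewrite le_max bB.
  by apply: le_trans (bB' _ _ s01 t01) _; rewrite ler_wpM2r// le_max lexx orbT.
(* The first term bounds the effect of the change of position along a strand, the second one that of
   the change of angle through [cosB_mixed] and [sinB_mixed]. *)
pose B := A * Dl + 2 * A * (C * Dl + Dl).
have -> : closed_picture N n F Th0 = place F (Th 0) @` sites N n.
  by apply: eq_imagel => a _; rewrite /place /Th mul0r addr0.
have -> : closed_picture N n F Th1 = place F (Th 1) @` sites N n.
  by apply: eq_imagel => a _; rewrite /place /Th mul1r addrC subrK.
apply: (@family_iso3 _ _ _ (fun t => place F (Th t)) (2 * B * K)).
move=> s t a b s01 t01 sa sb.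
have C00 : 0 <= C.
  by case: sa => aN _ a01; have [] := clock_lipschitz (ckT s s01) aN a01 a01.
have B0 : 0 <= B by rewrite /B addr_ge0// ?mulr_ge0// addr_ge0// mulr_ge0.
pose w a := place F (Th t) a - place F (Th s) a.
have fw : field N n p w (B * `|t - s|).
  move=> k q kN qn; have [pk jF rF lF _] := Fs k q kN qn; split => //.
  - rewrite /w; rewrite (place_junction (ckT t t01) kN jF).
    by rewrite (place_junction (ckT s s01) kN jF).
  - move=> x x01; rewrite /w /place /turn /=; have [bD _] := DlP k kN.
    apply: le_trans (cyl_angle_le _ _ _) _; rewrite DE normrM mulrCA.
    rewrite mulrC ler_wpM2r// (@le_trans _ _ (A * Dl))//.
      by apply: ler_pM => //; [exact: FA|exact: bD].
    by rewrite /B lerDl !mulr_ge0// addr_ge0// mulr_ge0.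
  - move=> x y x01 y01; rewrite /w /place /turn /=; have [bD lD] := DlP k kN.
    have [_ lT] := clock_lipschitz (ckT s s01) kN x01 y01.
    have := lF x y x01 y01; have := FA k q kN qn x x01; have := FA k q kN qn y y01.
    have := bD x x01; have := lD x y x01 y01; move: lT.
    have := DE s t (k%:R + x); have := DE s t (k%:R + y).
    move: (D (k%:R + x)) (D (k%:R + y)) (F k q x) (F k q y).
    move: (Th s (k%:R + x)) (Th s (k%:R + y)) (Th t (k%:R + x)) (Th t (k%:R + y)).
    move=> b1 b2 a1 a2 D1 D2 f1 f2 e2 e1 lT lDD bD1 bf2 bf1 lff.
    have m1 : `|a1 - b1| <= `|t - s| * Dl by rewrite e1 normrM ler_wpM2l.
    have m2 : `|a1 - b1 - (a2 - b2)| <= `|t - s| * (Dl * `|x - y|).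
      by rewrite e1 e2 -mulrBr normrM ler_wpM2l.
    have mm : 2 * (`|b1 - b2| * `|a1 - b1| + `|(a1 - b1) - (a2 - b2)|) <=
        2 * ((C * Dl + Dl) * `|t - s| * `|x - y|).
      rewrite ler_wpM2l//.
      have -> : (C * Dl + Dl) * `|t - s| * `|x - y| =
        (C * `|x - y|) * (`|t - s| * Dl) + `|t - s| * (Dl * `|x - y|) by ring.
      by apply: lerD => //; apply: ler_pM.
    have -> : cyl f1 a1 - cyl f1 b1 - (cyl f2 a2 - cyl f2 b2) =
      (cyl (f1 - f2) a1 - cyl (f1 - f2) b1) +
      ((cyl f2 a1 - cyl f2 b1) - (cyl f2 a2 - cyl f2 b2)).
      by apply: eq3 => /=; ring.
    have ->  : B * `|t - s| * `|x - y| = (A * `|x - y|) * (`|t - s| * Dl) +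
      A * (2 * ((C * Dl + Dl) * `|t - s| * `|x - y|)) by rewrite /B; ring.
    apply: le_trans (ler_normD _ _) _; apply: lerD.
      by apply: le_trans (cyl_angle_le _ _ _) _; apply: ler_pM.
    have [n1 n2] := norm2_comp f2.
    rewrite norm3_le /= !subrr normr0 !mulr_ge0 ?addr_ge0 ?mulr_ge0// andbT.
    rewrite -!mulrBr !normrM; apply/andP; split; apply: ler_pM => //.
    + exact: le_trans n1 bf2.
    + exact: le_trans (cosB_mixed _ _ _ _) mm.
    + exact: le_trans n1 bf2.
    + exact: le_trans (sinB_mixed _ _ _ _) mm.
have wB0 : 0 <= B * `|t - s| by rewrite mulr_ge0.
have := field_lipschitz fw wB0 sa sb (KP F (Th s) C Fs (ckT s s01) a b sa sb).
by rewrite /w; congr (_ <= _); ring.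
Qed.

(* A family of strands that is closed under following the strands is a union of
   components. *)
Theorem split_picture N n p F Th (c C : R) (S : nat -> nat -> bool) k q q' :
  picture N n p F -> same_order N n F F -> clock N Th c C ->
  (forall k q, (k < N)%N -> (q < n)%N -> S (k.+1 %% N)%N (p k q) = S k q) ->
  (k < N)%N -> (q < n)%N -> (q' < n)%N -> S k q -> ~~ S k q' ->
  ~ connected (closed_picture N n F Th).
Proof.
move=> Fp FF ck Sp kN qn q'n Sq Sq'.
have [A [d [A0 d0 Fs _]]] := embedded_strands Fp FF; have [c0 _ _] := ck.
have [K K0 KP] := @sites_near R N n p A d c A0 d0 c0.
pose cl (a : site R) := S a.1.1 a.1.2.
have sep a b : sites N n a -> sites N n b -> cl a -> ~~ cl b ->
    K^-1 <= `|place F Th a - place F Th b|.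
  move=> sa sb ca cb.
  have near x y e : sites N n x -> near_sites N p e x y -> cl x = cl y.
    move=> [xN xn _] [[h1 h2 _]|[h1 h2 _]]; first by rewrite /cl h1 h2.
    by rewrite /cl h1 h2 Sp.
  have [h|h|h] := KP F Th C Fs ck a b sa sb.
  - by rewrite -[leLHS]mul1r ler_pdivrMr// mulrC.
  - by rewrite (near _ _ _ sa h) (negbTE cb) in ca.
  - by rewrite -(near _ _ _ sb h) (negbTE cb) in ca.
have s01 : 0 <= (0 : R) <= 1 by rewrite lexx ler01.
(* The radius is the distance that separates the two families of strands, so the balls around one
   family miss the other. *)
pose U (P : set (site R)) := \bigcup_(a in sites N n `&` P) ball (place F Th a) K^-1.
have oU P : open (U P).
  apply: bigcup_open => a _; apply: ball_open; rewrite invr_gt0//.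
have inU P a : sites N n a -> P a -> U P (place F Th a).
  by move=> sa Pa; exists a => //; apply: ballxx; rewrite invr_gt0.
have notU P a : sites N n a -> (forall b, sites N n b -> P b -> cl a != cl b) ->
    ~ U P (place F Th a).
  move=> sa h [b [sb Pb]]; rewrite -ball_normE /= => ab.
  have := h b sb Pb; case: (boolP (cl a)) (boolP (cl b)) => [ca [//|cb] _|ca [cb _|//]].
    by have := sep a b sa sb ca cb; rewrite distrC leNgt ab.
  by have := sep b a sb sa cb ca; rewrite leNgt ab.
have sq : sites N n (k, q, 0 : R) by exact: (And3 kN qn s01).
have sq' : sites N n (k, q', 0 : R) by exact: (And3 kN q'n s01).
move=> cC; pose Y := place F Th @` [set a | sites N n a /\ cl a].
have YC : Y = closed_picture N n F Th.
  apply: cC.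
  - by exists (place F Th (k, q, 0)), (k, q, 0).
  - exists (U [set a | cl a]) => //; apply/seteqP; split=> [_ [a [sa ca] <-]|].
      by split; [exists a|exact: inU].
    move=> _ [[a sa <-] Ua]; exists a => //; split => //.
    apply: contrapT => /negP ca; move: Ua; apply: notU => // b _ cb.
    by rewrite (negbTE ca) cb.
  - exists (~` U [set a | ~~ cl a]); first exact: open_closedC.
    apply/seteqP; split=> [_ [a [sa ca] <-]|].
      split; first by exists a.
      by apply: notU => // b _ /= cb; rewrite ca (negbTE cb).
    move=> _ [[a sa <-] Ua]; exists a => //; split => //.
    by apply: contrapT => /negP ca; apply: Ua; exact: inU.
have : closed_picture N n F Th (place F Th (k, q', 0)) by exists (k, q', 0).
rewrite -YC => -[a [sa ca] e]; have := sep a (k, q', 0) sa sq' ca Sq'.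
by rewrite e subrr normr0 leNgt invr_gt0 K0.
Qed.

End Pictures.
(** * Closures of words *)

(** The index carries no bound, so that one word can be read in braid groups with different numbers
    of strands. *)
Definition letter : Type := (nat * bool)%type.

Definition swap (a : option letter) (q : nat) : nat :=
  if a is Some (i, _) then
    if q == i then i.+1 else if q == i.+1 then i else q
  else q.

Definition fits (n : nat) (a : option letter) : bool :=
  if a is Some (i, _) then (i.+1 < n)%N else true.

Lemma swapK a : involutive (swap a).
Proof.
case: a => [[i e]|] q //=; have [->|qi] := eqVneq q i.
  by rewrite eqn_leq ltnn /= eqxx.
have [->|qi1] := eqVneq q i.+1; first by rewrite eqxx.
by rewrite (negbTE qi) (negbTE qi1).
Qed.

Lemma swap_lt n a q : fits n a -> (q < n)%N -> (swap a q < n)%N.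
Proof. by case: a => [[i e]|] //= ai qn; do 2?case: ifP => _ //; exact: ltnW. Qed.

Fixpoint trail (v : seq (option letter)) (k q : nat) : nat :=
  if k is k'.+1 then swap (nth None v k') (trail v k' q) else q.

Lemma trail_lt n v k q : all (fits n) v -> (q < n)%N -> (trail v k q < n)%N.
Proof.
move=> vn qn; elim: k => //= k IH; apply: swap_lt => //.
have [kv|kv] := ltnP k (size v); last by rewrite nth_default.
exact: (all_nthP None vn).
Qed.

Lemma trail_inj v k : injective (trail v k).
Proof. by elim: k => //= k IH q q' /(can_inj (swapK _)); exact: IH. Qed.

Lemma trail_surj n v k q : all (fits n) v -> (q < n)%N ->
  exists2 q', (q' < n)%N & trail v k q' = q.
Proof.
move=> vn; elim: k q => [|k IH] q qn /=; first by exists q.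
have [|q' q'n e] := IH (swap (nth None v k) q).
  apply: swap_lt => //; have [kv|kv] := ltnP k (size v); last by rewrite nth_default.
  exact: (all_nthP None vn).
by exists q' => //; rewrite e swapK.
Qed.

Section Words.
Variable R : realType.
Local Notation E := (R3 R).
Implicit Types (a : option letter) (v y : seq (option letter)).

(** The [strand] of the statement, with natural numbers as positions. *)
Definition arc a (q : nat) (s : R) : R * R :=
  if a is Some (i, e) then
    let h := (-1) ^+ (~~ e) * (s * (1 - s)) in
    if q == i then (q.+1%:R + s, h)
    else if q == i.+1 then (q.+1%:R - s, - h)
    else (q.+1%:R, 0)
  else (q.+1%:R, 0).

Lemma arc0 a q : arc a q 0 = (q.+1%:R, 0).
Proof.
case: a => [[i e]|] //=; rewrite !mul0r mulr0 oppr0 addr0.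
by do 2?case: ifP.
Qed.

Lemma arc1 a q : arc a q 1 = ((swap a q).+1%:R, 0).
Proof.
case: a => [[i e]|] //=; rewrite subrr !mulr0 oppr0.
case: eqP => [->|_]; first by rewrite natr1.
by case: eqP => [->|//]; rewrite -natr1 addrK.
Qed.

Lemma lip1_arc a q : lip1 (fun s => (arc a q s).1) /\ lip1 (fun s => (arc a q s).2).
Proof.
have c x := @lip1_cst R x; have d := @lip1_id R.
case: a => [[i e]|] /=; last by split; exact: c.
have h : lip1 (fun s : R => (-1) ^+ (~~ e) * (s * (1 - s))).
  by apply: lip1M => //; apply: lip1M => //; exact: lip1B.
case: (q == i) => /=; first by split; [exact: lip1D|exact: h].
case: (q == i.+1) => /=; first by split; [exact: lip1B|exact: lip1N].
by split; exact: c.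
Qed.

Lemma arc_ge1 a q (s : R) : 0 <= s <= 1 -> 1 <= (arc a q s).1.
Proof.
move=> /andP[s0 s1]; case: a => [[i e]|] /=; last by rewrite ler1n.
case: eqP => [_|_] /=; first by rewrite -natr1; have : 0 <= q%:R :> R by []; lra.
case: eqP => [->|_] /=; last by rewrite ler1n.
by rewrite -!natr1; have : 0 <= i%:R :> R by []; lra.
Qed.

(* The strand of larger [rank] passes over the other one. *)
Definition agrees (rank : nat -> nat) a : bool :=
  if a is Some (i, e) then
    if e then (rank i.+1 < rank i)%N else (rank i < rank i.+1)%N
  else true.

(** Ranks belong to strands, so they are carried along by each letter. In a layered word every
    strand can be kept at a height of its own. *)
Fixpoint layered (rank : nat -> nat) v : bool :=
  if v is a :: v' then agrees rank a && layered (rank \o swap a) v' else true.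

(** Two arcs of a sector have equal radius only at the crossing, at time [1 / 2], and there the
    heights follow the ranks. *)
Lemma arc_order rank a q q' (s : R) : agrees rank a -> q <> q' -> 0 <= s <= 1 ->
  (arc a q s).1 != (arc a q' s).1 \/
  [/\ 0 < s < 1 &
    0 < ((arc a q s).2 - (arc a q' s).2) * ((rank q)%:R - (rank q')%:R)].
Proof.
move=> ra /eqP qq' /andP[s0 s1].
have natE (x y : nat) (u : R) : (x < y)%N -> 0 <= u -> u < 1 -> x%:R + u != y%:R.
  move=> xy u0 u1; rewrite lt_eqF//.
  by rewrite (@lt_le_trans _ _ x.+1%:R) ?ler_nat// -natr1 ltrD2l.
case: a ra => [[i e]|] /= ra; last by left; rewrite eqr_nat eqSS.
wlog qlt : q q' qq' / (q < q')%N => [H|].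
  case: (ltngtP q q') qq' => // [qq' _|q'q _]; first by apply: H; rewrite ?ltn_eqF.
  have [|h|[h1 h2]] := H q' q _ q'q; first by rewrite ltn_eqF.
    by left; rewrite eq_sym.
  by right; split => //; rewrite -mulrNN !opprB.
have nat1 (x y : nat) : (x < y)%N -> x%:R + 1 <= y%:R :> R by rewrite natr1 ler_nat.
have ltne (x y : R) : x < y -> x != y by move=> xy; rewrite lt_eqF.
have h := nat1 _ _ qlt.
case: (eqVneq q i) => [qi|qi] /=.
  case: (eqVneq q' i) => [q'i|q'i] /=; first by rewrite q'i qi ltnn in qlt.
  case: (eqVneq q' i.+1) => [q'i1|q'i1] /=; last first.
    left; apply: ltne; have : (i.+2 <= q')%N by rewrite ltn_neqAle eq_sym q'i1 -qi.
    by move=> /nat1; rewrite qi -!natr1; move: s0 s1; clear; lra.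
  have [s2|s2] := eqVneq s (1 / 2); last first.
    left; apply: contra s2 => /eqP; rewrite qi q'i1 -[i.+2%:R]natr1 -[i.+1%:R]natr1.
    by move=> es; apply/eqP; move: es; clear; lra.
  right; split; first by rewrite s2; apply/andP; split; lra.
  rewrite qi q'i1 opprK s2; case: e ra => /= ra; have := nat1 _ _ ra.
    by rewrite expr0 mul1r; clear; nra.
  by rewrite expr1 mulN1r; clear; nra.
case: (eqVneq q i.+1) => [qi1|qi1] /=.
  left; case: (eqVneq q' i) => [q'i|q'i] /=.
    by rewrite q'i qi1 ltnNge leqnSn in qlt.
  case: (eqVneq q' i.+1) => [q'i1|q'i1] /=; first by rewrite q'i1 qi1 ltnn in qlt.
  by apply: ltne; rewrite -!natr1; move: s0 s1 h; clear; lra.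
left; case: (eqVneq q' i) => [q'i|q'i] /=.
  by apply: ltne; rewrite -!natr1; move: s0 s1 h; clear; lra.
case: (eqVneq q' i.+1) => [q'i1|q'i1] /=.
  have qi2 : (q < i)%N by rewrite ltn_neqAle qi -ltnS -q'i1.
  apply: ltne; have := nat1 _ _ qi2; rewrite q'i1 -!natr1.
  by move: s0 s1; clear; lra.
by rewrite eqr_nat eqSS ltn_eqF.
Qed.

Definition movie v (k q : nat) (s : R) : R * R := arc (nth None v k) q s.

Definition steady (N : nat) (u : R) : R := 2 * pi * (u / N%:R).

Definition closure n v : set E :=
  closed_picture (size v) n (movie v) (steady (size v)).

Lemma steady_clock N : (0 < N)%N ->
  clock N (steady N) (2 * pi / N%:R) (2 * pi / N%:R).
Proof.
move=> N0; have N0' : 0 < N%:R :> R by rewrite ltr0n.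
have p0 := pi_gt0 R.
split; first by rewrite divr_gt0// mulr_gt0.
  by rewrite /steady divff ?gt_eqF// mul0r mulr0 mulr1 add0r.
move=> u v _ _ _; rewrite /steady.
have -> : 2 * pi * (v / N%:R) - 2 * pi * (u / N%:R) = 2 * pi / N%:R * (v - u).
  by ring.
by rewrite lexx.
Qed.

Lemma movie_picture n v : all (fits n) v ->
  picture (size v) n (fun k => swap (nth None v k)) (movie v).
Proof.
move=> vn k q kN qn; have ak := all_nthP None vn k kN; split.
- exact: swap_lt.
- by rewrite /movie arc1 arc0.
- exact: (lip1_arc _ _).1.
- exact: (lip1_arc _ _).2.
- by move=> s s01; exact: arc_ge1.
Qed.

(** Ranks for which the single letter [a] is layered; being injective, they also show that every
    sector is embedded. *)
Definition ranking a : nat -> nat := if a is Some (_, true) then swap a else id.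

Lemma ranking_agrees a : agrees (ranking a) a.
Proof.
case: a => [[i []]|] //=; rewrite ?eqxx ?ltnSn//.
by rewrite (gtn_eqF (ltnSn i)) ltnSn.
Qed.

Lemma ranking_inj a : injective (ranking a).
Proof. by case: a => [[i []]|] //=; exact: (can_inj (swapK (Some (i, true)))). Qed.

Lemma sqr_pos (x : R) : x != 0 -> 0 < x * x.
Proof. by move=> x0; rewrite -expr2 lt0r sqrf_eq0 x0 sqr_ge0. Qed.

Lemma arc_embedded a q q' (s : R) : q <> q' -> 0 <= s <= 1 ->
  0 < (arc a q s - arc a q' s).1 * (arc a q s - arc a q' s).1 \/
  0 < (arc a q s - arc a q' s).2 * (arc a q s - arc a q' s).2.
Proof.
move=> qq' s01; have [h|[_ h]] := arc_order (ranking_agrees a) qq' s01.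
  by left; apply: sqr_pos; rewrite /= subr_eq0.
right; apply: sqr_pos; apply/eqP => e; move: h => /=; rewrite [X in X * _]e.
by rewrite mul0r ltxx.
Qed.

Lemma movie_embedded n v : same_order (size v) n (movie v) (movie v).
Proof. by move=> k q q' s _ _ _; exact: arc_embedded. Qed.

(* [f] moves the strands during the first [m] units of time, where they are
   labelled by their initial positions. *)
Definition layered_path m n (tau rank : nat -> nat) (f : nat -> nat -> R -> R * R) :=
  [/\ forall q, (q < n)%N ->
        [/\ (tau q < n)%N, f 0 q 0 = (q.+1%:R, 0) & f m.-1 q 1 = ((tau q).+1%:R, 0)],
      forall k q, (k.+1 < m)%N -> (q < n)%N -> f k q 1 = f k.+1 q 0,
      forall k q, (k < m)%N -> (q < n)%N ->
        [/\ lip1 (fun s => (f k q s).1), lip1 (fun s => (f k q s).2)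
          & forall s, 0 <= s <= 1 -> 1 <= (f k q s).1]
    & forall k q q' (s : R), (k < m)%N -> (q < n)%N -> (q' < n)%N -> q <> q' ->
        0 <= s <= 1 -> (f k q s).1 != (f k q' s).1 \/
        [/\ 0 < k%:R + s < m%:R &
          0 < ((f k q s).2 - (f k q' s).2) * ((rank q)%:R - (rank q')%:R)]].

Definition glue m (f : nat -> nat -> R -> R * R) y k q s : R * R :=
  if (k < m)%N then f k q s else arc (nth None y (k - m)) q s.

(** Labels change from initial to current positions once, at the end of the first [m] sectors,
    through [tau]. *)
Definition glue_moves m (tau : nat -> nat) y k q : nat :=
  if (k.+1 < m)%N then q
  else if k.+1 == m then tau q else swap (nth None y (k - m)) q.

Lemma glue_picture m n tau rank f y : (0 < m)%N -> layered_path m n tau rank f ->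
  all (fits n) y -> picture (m + size y) n (glue_moves m tau y) (glue m f y).
Proof.
move=> m0 [ends jct reg _] yn k q kN qn; rewrite /glue /glue_moves.
have start q' : (q' < n)%N ->
    (if (0 < m)%N then f 0 q' 0 else arc (nth None y (0 - m)) q' 0) = (q'.+1%:R, 0).
  by move=> q'n; rewrite m0; have [] := ends q' q'n.
have [km|mk] := ltnP k m.
  have [l1 l2 r1] := reg k q km qn.
  have [k1m|] := ltnP k.+1 m.
    split => //; rewrite modn_small ?k1m; first exact: jct.
    by rewrite (leq_trans k1m) ?leq_addr.
  rewrite leq_eqVlt ltnS [X in _ || X]leqNgt km orbF => /eqP mE; subst m.
  rewrite eqxx; have [tn _ e] := ends q qn.
  split => //; rewrite [LHS]e; have [y0|y0] := posnP (size y).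
    by rewrite y0 addn0 modnn start.
  rewrite modn_small; last by rewrite -[X in (X < _)%N]addn0 ltn_add2l.
  by rewrite ltnn subnn arc0.
have ak : fits n (nth None y (k - m)).
  by apply: (all_nthP None yn); rewrite ltn_subLR.
have mk1 : (k.+1 < m)%N = false by rewrite ltnNge (leq_trans mk (leqnSn k)).
have mk2 : (k.+1 == m) = false by rewrite gtn_eqF.
rewrite mk1 mk2.
split; [exact: swap_lt| |exact: (lip1_arc _ _).1|exact: (lip1_arc _ _).2|].
  rewrite arc1; have [kN1|] := ltnP k.+1 (m + size y).
    by rewrite modn_small// mk1 arc0.
  rewrite leq_eqVlt ltnS [X in _ || X]leqNgt kN orbF => /eqP <-.
  by rewrite modnn start// swap_lt.
by move=> s s01; exact: arc_ge1.
Qed.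

(* First push the strands to heights given by [rank], then adjust the radii. *)
Lemma layered_homotopy m n tau rank f g y Th (c C : R) : (0 < m)%N ->
  {in gtn n &, injective rank} ->
  layered_path m n tau rank f -> layered_path m n tau rank g -> all (fits n) y ->
  clock (m + size y) Th c C ->
  iso3 (closed_picture (m + size y) n (glue m f y) Th)
       (closed_picture (m + size y) n (glue m g y) Th).
Proof.
move=> m0 rinj.
(* A bump over the [m] sectors, zero at both ends, where the path has to join the rest of the braid,
   and positive in between. *)
pose b (k : nat) (s : R) := (k%:R + s) * (m%:R - (k%:R + s)).
pose lift (f : nat -> nat -> R -> R * R) k q s := ((f k q s).1, (rank q)%:R * b k s).
have b_gt0 k (s : R) : 0 < k%:R + s < m%:R -> 0 < b k s.
  by move=> /andP[h1 h2]; rewrite mulr_gt0// subr_gt0.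
have rk q q' : (q < n)%N -> (q' < n)%N -> q <> q' ->
    (rank q)%:R - (rank q')%:R != 0 :> R.
  by move=> qn q'n qq'; rewrite subr_eq0 eqr_nat; apply/eqP => e; apply: qq'; exact: rinj e.
have b0 : b 0 0 = 0 by rewrite /b addr0 mul0r.
have bm : b m.-1 1 = 0 by rewrite /b natr1 prednK// subrr mulr0.
have time k (s : R) : (k < m)%N -> 0 <= s <= 1 ->
    [\/ k = 0%N /\ s = 0, k = m.-1 /\ s = 1 | 0 < k%:R + s < m%:R].
  move=> km /andP[s0 s1].
  have k0 : 0 <= k%:R :> R by [].
  have k1 : k%:R + 1 <= m%:R :> R by rewrite natr1 ler_nat.
  have [sE|s0'] := eqVneq s 0.
    have [kE|k0'] := posnP k; first by apply: Or31.
    apply: Or33; have : 1 <= k%:R :> R by rewrite ler1n.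
    by rewrite sE => k1'; apply/andP; split; lra.
  have s0'' : 0 < s by rewrite lt0r s0'.
  have [sE|s1'] := eqVneq s 1.
    have [kE|k1'] := eqVneq k m.-1; first by apply: Or32.
    apply: Or33; have km1 : (k.+2 <= m)%N.
      by rewrite -(prednK m0) ltnS ltn_neqAle k1' -ltnS prednK.
    have : k%:R + 2 <= m%:R :> R by rewrite -natrD ler_nat addn2.
    by rewrite sE => ?; apply/andP; split; lra.
  have s1'' : s < 1 by rewrite lt_neqAle s1'.
  by apply: Or33; apply/andP; split; lra.
have lift_layered h : layered_path m n tau rank h -> layered_path m n tau rank (lift h).
  move=> [ends jct reg ord]; split.
  - by move=> q qn; have [tn e0 e1] := ends q qn; rewrite /lift e0 e1 b0 bm !mulr0.
  - move=> k q km qn; rewrite /lift jct//; congr (_, _ * _).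
    by rewrite /b -natr1 addr0.
  - move=> k q km qn; have [l1 l2 r1] := reg k q km qn; split => //=.
    have lc x := @lip1_cst R x; have li := @lip1_id R.
    apply: lip1M => //; apply: lip1M; first exact: lip1D.
    by apply: lip1B => //; exact: lip1D.
  - move=> k q q' s km qn q'n qq' s01.
    have [h1|[h1 _]] := ord k q q' s km qn q'n qq' s01; first by left.
    right; split => //=; rewrite -mulrBl mulrAC mulr_gt0 ?b_gt0//.
    by apply: sqr_pos; exact: rk.
have step1 h : layered_path m n tau rank h -> all (fits n) y ->
    clock (m + size y) Th c C ->
    iso3 (closed_picture (m + size y) n (glue m h y) Th)
         (closed_picture (m + size y) n (glue m (lift h) y) Th).
  move=> hl yn ck; have := hl => -[_ _ _ ord].
  apply: (picture_homotopy (glue_picture m0 hl yn)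
    (glue_picture m0 (lift_layered h hl) yn) _ ck).
  move=> k q q' s kN qn q'n qq' s01; rewrite /glue.
  have [km|_] := ltnP k m; last exact: arc_embedded.
  have [h1|[h1 h2]] := ord k q q' s km qn q'n qq' s01.
    by left; apply: sqr_pos; rewrite /= subr_eq0.
  by right; rewrite /= -mulrBl mulrA mulr_gt0// b_gt0.
(* After lifting, both paths have the same heights, which separate the strands inside the path; at
   its two ends the common positions do. *)
move=> fl gl yn ck; apply: iso3_trans (step1 _ fl yn ck) _.
apply: iso3_trans (iso3_sym (step1 _ gl yn ck)).
apply: (picture_homotopy (glue_picture m0 (lift_layered f fl) yn)
  (glue_picture m0 (lift_layered g gl) yn) _ ck).
move=> k q q' s kN qn q'n qq' s01; rewrite /glue.
have [km|_] := ltnP k m; last exact: arc_embedded.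
have [fe _ _ _] := fl; have [ge _ _ _] := gl.
have [tn f0 f1] := fe q qn; have [tn' f0' f1'] := fe q' q'n.
have [_ g0 g1] := ge q qn; have [_ g0' g1'] := ge q' q'n.
(* At the final time heights cannot separate strands, so the order condition yields distinct end
   positions. *)
have tinj : tau q != tau q'.
  apply/eqP => tt; have [_ _ _ ord] := fl.
  have i01 : 0 <= (1 : R) <= 1 by rewrite ler01 lexx.
  have m1 : (m.-1 < m)%N by rewrite prednK.
  have [|[]] := ord m.-1 q q' 1 m1 qn q'n qq' i01.
    by rewrite f1 f1' tt eqxx.
  by rewrite natr1 prednK// ltxx andbF.
have [[kE sE]|[kE sE]|h] := time k s km s01.
- left; rewrite kE sE /= f0 f0' g0 g0' /=; apply: sqr_pos.
  by rewrite subr_eq0 eqr_nat eqSS; apply/eqP.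
- left; rewrite kE sE /= f1 f1' g1 g1' /=; apply: sqr_pos.
  by rewrite subr_eq0 eqr_nat eqSS.
- right; rewrite /= -mulrBl mulrACA mulr_gt0//; first by apply: sqr_pos; exact: rk.
  by apply: sqr_pos; rewrite gt_eqF// b_gt0.
Qed.

Lemma layered_trail rank v k : layered rank v -> (k < size v)%N ->
  exists2 rk, agrees rk (nth None v k) & forall q, rk (trail v k q) = rank q.
Proof.
elim: v rank k => // a v IH rank [|k] /= /andP[ra rv]; first by exists rank.
rewrite ltnS => kv; have [rk h1 h2] := IH _ _ rv kv; exists rk => // q.
have trS : forall k q, trail (a :: v) k.+1 q = trail v k (swap a q).
  by elim=> //= l IHl p; rewrite -IHl.
by have := h2 (swap a q); rewrite /= swapK -trS /=.
Qed.

Definition word_path v k q (s : R) : R * R := arc (nth None v k) (trail v k q) s.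

Lemma word_path_layered n v rank : (0 < size v)%N -> all (fits n) v ->
  layered rank v ->
  layered_path (size v) n (trail v (size v)) rank (word_path v).
Proof.
move=> v0 vn rv; split.
- move=> q qn; rewrite trail_lt// /word_path arc0; split => //.
  by rewrite arc1 -[in RHS](prednK v0).
- by move=> k q kv qn; rewrite /word_path arc0 arc1.
- move=> k q kv qn; have [h1 h2] := lip1_arc (nth None v k) (trail v k q).
  by split => // s s01; exact: arc_ge1.
- move=> k q q' s kv qn q'n qq' s01; have [rk h1 h2] := layered_trail rv kv.
  have tq : trail v k q <> trail v k q' by move=> /trail_inj.
  have [h|[/andP[s0 s1] h]] := arc_order h1 tq s01; first by left.
  right; split; last by rewrite !h2 in h.
  have k0 : 0 <= k%:R :> R by [].
  have k1 : k%:R + 1 <= (size v)%:R :> R by rewrite natr1 ler_nat.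
  by apply/andP; split; lra.
Qed.

Lemma relabel_picture N n F G (Th : R -> R) (sg : nat -> nat -> nat) :
  (forall k q, (k < N)%N -> (q < n)%N -> (sg k q < n)%N) ->
  (forall k q, (k < N)%N -> (q < n)%N -> exists2 q', (q' < n)%N & sg k q' = q) ->
  (forall k q s, (k < N)%N -> (q < n)%N -> F k q s = G k (sg k q) s) ->
  closed_picture N n F Th = closed_picture N n G Th.
Proof.
move=> sgn sgs FG; apply/seteqP; split=> _ [[[k q] s] [/= kN qn s01] <-].
  exists (k, sg k q, s); first by split => //=; exact: sgn.
  by rewrite /place /= FG.
have [q' q'n e] := sgs k q kN qn; exists (k, q', s) => //.
by rewrite /place /= FG// e.
Qed.

Lemma closure_glue n v y : all (fits n) v ->
  closure n (v ++ y) = closed_picture (size v + size y) n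
    (glue (size v) (word_path v) y) (steady (size v + size y)).
Proof.
move=> vn; rewrite /closure size_cat; apply/esym.
apply: (@relabel_picture _ _ _ _ _
  (fun k q => if (k < size v)%N then trail v k q else q)).
- by move=> k q _ qn; case: ifP => // _; exact: trail_lt.
- by move=> k q _ qn; case: (k < size v)%N; [exact: trail_surj|exists q].
- by move=> k q s _ _; rewrite /glue /movie /word_path nth_cat; case: ifP.
Qed.

(** With each strand in a layer of its own, the radial motion is free, and only the permutation
    remains. Commutation, cancellation and the Yang-Baxter relation are all instances. *)
Theorem layered_closure n v1 v2 y rank : size v1 = size v2 ->
  all (fits n) v1 -> all (fits n) v2 -> all (fits n) y ->
  {in gtn n &, injective rank} -> layered rank v1 -> layered rank v2 ->
  (forall q, (q < n)%N -> trail v1 (size v1) q = trail v2 (size v2) q) ->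
  iso3 (closure n (v1 ++ y)) (closure n (v2 ++ y)).
Proof.
move=> v12 v1n v2n yn rinj r1 r2 tr; have [v0|v0] := posnP (size v1).
  have v20 : size v2 = 0%N by rewrite -v12.
  by rewrite (size0nil v0) (size0nil v20); exact: iso3_refl.
have v20 : (0 < size v2)%N by rewrite -v12.
rewrite !closure_glue// -v12.
have N0 : (0 < size v1 + size y)%N by rewrite (leq_trans v0) ?leq_addr.
apply: layered_homotopy v0 rinj (word_path_layered v0 v1n r1) _ yn (steady_clock N0).
have [ends jct reg ord] := word_path_layered v20 v2n r2.
split; rewrite v12 // => q qn; have [h1 h2 h3] := ends q qn.
by rewrite -v12 tr// v12.
Qed.

End Words.

(** * Moves on words *)

Section WordMoves.
Variable R : realType.
Local Notation E := (R3 R).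
Local Notation closure := (@closure R).
Implicit Types (a : option letter) (v x y : seq (option letter)) (w : seq letter).

(** The two closures are the same picture, read with clocks that differ by one sector. *)
Lemma closure_rot1 n a v : fits n a -> all (fits n) v ->
  iso3 (closure n (a :: v)) (closure n (rcons v a)).
Proof.
move=> an vn; set N := size (rcons v a).
have NE : N = (size v).+1 by rewrite /N size_rcons.
have N0 : (0 < N)%N by rewrite NE.
have N0' : N%:R != 0 :> R by rewrite gt_eqF// ltr0n.
have vna : all (fits n) (rcons v a) by rewrite all_rcons an.
pose Th (u : R) : R := steady N (u + 1).
have ThE u : Th u = steady N u + 2 * pi / N%:R by rewrite /Th /steady; ring.
have ck := @steady_clock R N N0; have [c0 per gr] := ck.
have ckT : clock N Th (2 * pi / N%:R) (2 * pi / N%:R).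
  split=> // [|u u' h1 h2 h3]; first by rewrite !ThE per; ring.
  by have := gr u u' h1 h2 h3; rewrite !ThE; congr (_ && _); congr (_ <= _); ring.
have -> : closure n (a :: v) = closed_picture N n (movie (rcons v a)) Th.
  have ThN (s : R) : Th ((size v)%:R + s) = steady N s + 2 * pi.
    by rewrite /Th /steady addrAC natr1 -NE; field.
  apply/seteqP; split=> _ [[[k q] s] [/= kN qn s01] <-].
    case: k kN => [|k] kN.
      exists (size v, q, s); first by split => //=; rewrite NE.
      rewrite /place /turn /movie /= ThN cylD2pi nth_rcons ltnn eqxx add0r.
      by rewrite NE.
    exists (k, q, s); first by split => //=; rewrite NE ltnW.
    have kv : (k < size v)%N by [].
    by rewrite /place /turn /movie /= nth_rcons kv /Th addrAC natr1 NE.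
  rewrite NE ltnS leq_eqVlt in kN; case/orP: kN => [/eqP->|kN].
    exists (0%N, q, s); first by split.
    by rewrite /place /turn /movie /= ThN cylD2pi nth_rcons ltnn eqxx add0r NE.
  exists (k.+1, q, s); first by split.
  by rewrite /place /turn /movie /= nth_rcons kN /Th addrAC natr1 NE.
have mp := movie_picture R vna; have me := @movie_embedded R n (rcons v a).
exact: (clock_change mp me ckT ck).
Qed.

Lemma closure_rot n x y : all (fits n) x -> all (fits n) y ->
  iso3 (closure n (x ++ y)) (closure n (y ++ x)).
Proof.
elim: x y => [|a x IH] y; first by rewrite cats0 => _ _; exact: iso3_refl.
move=> /= /andP[an xn] yn; apply: iso3_trans (@closure_rot1 n a (x ++ y) an _) _.
  by rewrite all_cat xn.
rewrite rcons_cat -cat_rcons; apply: IH => //.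
by rewrite all_rcons an.
Qed.

Lemma glue_embedded m n tau rank f y : layered_path m n tau rank f ->
  same_order (m + size y) n (glue m f y) (glue m f y : nat -> nat -> R -> R * R).
Proof.
move=> [_ _ _ ord] k q q' s kN qn q'n qq' s01; rewrite /glue.
have [km|_] := ltnP k m; last exact: arc_embedded.
have [h|[_ h]] := ord k q q' s km qn q'n qq' s01.
  by left; apply: sqr_pos; rewrite /= subr_eq0.
right; apply: sqr_pos; apply/eqP => e; move: h => /=; rewrite [X in X * _]e.
by rewrite mul0r ltxx.
Qed.

(** The letter is slowed down so as to fill the idle sector as well; then a change of clock
    compresses the two sectors into one. *)
Lemma closure_idle n a y : fits n a -> all (fits n) y ->
  iso3 (closure n (a :: None :: y)) (closure n (a :: y)).
Proof.
move=> an yn; pose v := [:: a; None].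
have vn : all (fits n) v by rewrite /= an.
rewrite -[a :: None :: y]/(v ++ y) closure_glue//.
have rv : layered (ranking a) v by rewrite /= ranking_agrees.
(* The arc of [a] at half speed, spread over two sectors. *)
pose slow k q (s : R) := arc a q ((k%:R + s) / 2).
have half k (s : R) : (k < 2)%N -> 0 <= s <= 1 -> 0 <= (k%:R + s) / 2 <= 1.
  by case: k => [|[|]] // _ /andP[s0 s1]; apply/andP; split; lra.
have lip_half (f : R -> R) k : (k < 2)%N -> lip1 f ->
    lip1 (fun s => f ((k%:R + s) / 2)).
  move=> k2 [C fC]; exists (C / 2) => s t s01 t01.
  apply: le_trans (fC _ _ (half _ _ k2 s01) (half _ _ k2 t01)) _.
  rewrite -mulrBl opprD addrACA subrr add0r normrM.
  by rewrite (@ger0_norm _ 2^-1)// mulrA mulrAC.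
have ls : layered_path 2 n (trail v 2) (ranking a) slow.
  split.
  - move=> q qn; rewrite trail_lt// /slow addr0 mul0r arc0.
    by rewrite (_ : (1 + 1) / 2 = 1 :> R) ?arc1//; lra.
  - move=> [|k] q //= _ _; rewrite /slow; congr arc; lra.
  - move=> k q k2 qn; have [h1 h2] := @lip1_arc R a q; split.
    + exact: (lip_half (fun s => (arc a q s).1)).
    + exact: (lip_half (fun s => (arc a q s).2)).
    + by move=> s s01; apply: arc_ge1; exact: half.
  - move=> k q q' s k2 qn q'n qq' s01.
    have [h|[h1 h2]] := arc_order (ranking_agrees a) qq' (half k s k2 s01).
      by left.
    by right; split => //; move: h1 => /andP[h1 h3]; apply/andP; split; lra.
set N := (2 + size y)%N.
have ck := @steady_clock R N isT.
have rinj : {in gtn n &, injective (ranking a)} by move=> ? ? _ _; exact: ranking_inj.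
have wl : layered_path 2 n (trail v 2) (ranking a) (word_path v : nat -> nat -> R -> R * R).
  exact: word_path_layered.
apply: iso3_trans (layered_homotopy (isT : (0 < 2)%N) rinj wl ls yn ck) _.
pose M := (size y).+1.
have [M0 perM grM] := @steady_clock R M isT.
(* Half speed on the first two sectors, then full speed with a delay of one sector. *)
pose phi (u : R) := Order.max (u / 2) (u - 1).
pose Th (u : R) := steady M (phi u).
have phiB u u' : u <= u' -> (u' - u) / 2 <= phi u' - phi u <= u' - u.
  by move=> uu; rewrite /phi !maxEle; apply/andP; split; do 2?case: ifPn; lra.
have sy : 0 <= (size y)%:R :> R by [].
have phiN : phi N%:R = M%:R by rewrite /phi /N /M natrD -[(size y).+1%:R]natr1 max_r; lra.
have phi0 : phi 0 = 0 by rewrite /phi max_l; lra.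
have ckT : clock N Th (2 * pi / M%:R / 2) (2 * pi / M%:R).
  split.
  - by rewrite divr_gt0.
  - by rewrite /Th phiN phi0 perM.
  - move=> u u' h1 h2 h3; have /andP[p1 p2] := phiB u u' h2.
    rewrite /Th /steady.
    have -> : 2 * pi * (phi u' / M%:R) - 2 * pi * (phi u / M%:R) =
      2 * pi / M%:R * (phi u' - phi u) by ring.
    by rewrite -mulrA !ler_pM2l// [_^-1 * _]mulrC p1.
have gp := glue_picture (isT : (0 < 2)%N) ls yn.
have ge := @glue_embedded 2 n _ _ slow y ls.
apply: iso3_trans (clock_change gp ge ck ckT) _.
rewrite (_ : closed_picture _ _ _ _ = closure n (a :: y)); first exact: iso3_refl.
have small k (s : R) : (k < 2)%N -> 0 <= s <= 1 -> phi (k%:R + s) = (k%:R + s) / 2.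
  by move=> k2 s01; have /andP[h1 h2] := half k s k2 s01; rewrite /phi max_l; lra.
have large k (s : R) : 0 <= s <= 1 -> phi (k.+2%:R + s) = k.+1%:R + s.
  move=> /andP[s0 s1]; have k0 : 0 <= k%:R :> R by [].
  by rewrite /phi -[k.+2%:R]natr1 -[k.+1%:R]natr1 max_r; lra.
apply/seteqP; split=> _ [[[k q] s] [/= kN qn s01] <-].
  have [k2|k2] := ltnP k 2.
    exists (0%N, q, (k%:R + s) / 2); first by split => //=; exact: half.
    rewrite /place /turn /= /glue k2 /Th small// add0r.
    by [].
  case: k k2 kN => [|[|k]] // _ kN.
  exists (k.+1, q, s); first by split.
  by rewrite /place /turn /= /glue /Th large// subSS subSS subn0.
case: k kN => [|k] kN.
  have [s2|s2] := leP s (1 / 2).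
    have h : 0 <= 2 * s <= 1 by move: s01 => /andP[s0 s1]; apply/andP; split; lra.
    exists (0%N, q, 2 * s); first by split.
    rewrite /place /turn /= /glue /Th small// /slow.
    have -> : (0 + 2 * s) / 2 = s by lra.
    by rewrite add0r.
  have h : 0 <= 2 * s - 1 <= 1 by move: s01 => /andP[s0 s1]; apply/andP; split; lra.
  exists (1%N, q, 2 * s - 1); first by split.
  rewrite /place /turn /= /glue /Th small// /slow.
  have -> : (1 + (2 * s - 1)) / 2 = s by lra.
  by rewrite add0r.
exists (k.+2, q, s); first by split.
by rewrite /place /turn /= /glue /Th large// subSS subSS subn0.
Qed.

(** The word is rotated until the idle sector follows some letter or another idle sector [b], where
    [closure_idle] applies. *)
Lemma closure_delete n x y : all (fits n) x -> all (fits n) y -> x ++ y <> [::] ->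
  iso3 (closure n (x ++ None :: y)) (closure n (x ++ y)).
Proof.
move=> xn yn xy0.
have h1 : all (fits n) (None :: y) by [].
apply: iso3_trans (closure_rot xn h1) _.
apply: iso3_trans (closure_rot yn xn); rewrite cat_cons.
have yxn : all (fits n) (y ++ x) by rewrite all_cat yn.
have : y ++ x <> [::] by case: y x xy0 {xn yn h1 yxn} => [|? ?] [].
case/lastP: (y ++ x) yxn => // z b; rewrite all_rcons => /andP[bn zn] _.
rewrite -cats1 -cat_cons.
apply: iso3_trans (@closure_rot n (None :: z) [:: b] zn _) _; first by rewrite /= bn.
apply: iso3_trans (closure_idle bn zn) _.
by apply: (@closure_rot n [:: b] z); rewrite //= bn.
Qed.

(* With the leading [None], the closure of the empty word is the trivial braid. *)
Definition closed_word n w : set E := closure n (None :: map Some w).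

Definition fit n (l : letter) : bool := (l.1.+1 < n)%N.

Lemma fits_Some n w : all (fits n) (map Some w) = all (fit n) w.
Proof. by rewrite all_map; apply: eq_all => -[]. Qed.

Lemma closure_erase n v : v <> [::] -> all (fits n) v ->
  iso3 (closure n v) (closed_word n (pmap id v)).
Proof.
(* The leading [None] is inserted first, so that the prefix in front of a deleted sector is never
   empty. *)
move=> v0 vn; apply: iso3_trans (iso3_sym (@closure_delete n [::] v isT vn v0)) _.
rewrite /closed_word.
suff h x : x <> [::] -> all (fits n) x ->
    iso3 (closure n (x ++ v)) (closure n (x ++ map Some (pmap id v))).
  exact: (h [:: None]).
elim: v vn x {v0} => [|[l|] v IH] /= vn x x0 xn; first exact: iso3_refl.
  have/andP[ln vn'] := vn; rewrite -(cat_rcons (Some l) x v).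
    rewrite -(cat_rcons (Some l) x (map Some _)); apply: IH => //.
    by case: (x).
  by rewrite all_rcons xn andbT.
apply: iso3_trans (closure_delete xn vn _) (IH vn x x0 xn).
by case: (x) x0.
Qed.

Lemma map_SomeK w : pmap id (map Some w) = w.
Proof. by elim: w => //= l w ->. Qed.

Lemma closed_word_closure n w : w <> [::] -> all (fit n) w ->
  iso3 (closure n (map Some w)) (closed_word n w).
Proof.
move=> w0 wn; have := @closure_erase n (map Some w).
by rewrite fits_Some map_SomeK; apply=> //; case: w w0 {wn}.
Qed.

Lemma closed_word_rot n w w' : all (fit n) w -> all (fit n) w' ->
  iso3 (closed_word n (w ++ w')) (closed_word n (w' ++ w)).
Proof.
move=> wn wn'; have wwn : all (fit n) (w ++ w') by rewrite all_cat wn.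
have wwn' : all (fit n) (w' ++ w) by rewrite all_cat wn wn'.
have [ww0|ww0] := eqVneq (w ++ w') [::].
  have [-> ->] : w = [::] /\ w' = [::] by case: w w' ww0 {wn wn' wwn wwn'} => [|? ?] [].
  exact: iso3_refl.
have ww0' : w' ++ w <> [::] by case: w w' ww0 {wn wn' wwn wwn'} => [|? ?] [].
apply: iso3_trans (iso3_sym (closed_word_closure (elimN eqP ww0) wwn)) _.
apply: iso3_trans (closed_word_closure ww0' wwn').
by rewrite !map_cat; apply: closure_rot; rewrite fits_Some.
Qed.

Lemma closed_word_layered n v1 v2 rank w : size v1 = size v2 ->
  all (fits n) v1 -> all (fits n) v2 -> all (fit n) w ->
  {in gtn n &, injective rank} -> layered rank v1 -> layered rank v2 ->
  (forall q, (q < n)%N -> trail v1 (size v1) q = trail v2 (size v2) q) ->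
  iso3 (closed_word n (pmap id v1 ++ w)) (closed_word n (pmap id v2 ++ w)).
Proof.
(* The trailing [None] keeps the word nonempty, as [closure_erase] requires. *)
move=> s12 v1n v2n wn rinj r1 r2 tr; pose y := rcons (map Some w) None.
have yn : all (fits n) y by rewrite all_rcons fits_Some.
have e v : all (fits n) v ->
    iso3 (closure n (v ++ y)) (closed_word n (pmap id v ++ w)).
  move=> vn; have := @closure_erase n (v ++ y).
  rewrite pmap_cat /y -cats1 pmap_cat map_SomeK /= cats0 cats1; apply.
    by case: (v) (w) => [|? ?] [].
  by rewrite all_cat vn.
apply: iso3_trans (iso3_sym (e _ v1n)) _; apply: iso3_trans (e _ v2n).
exact: layered_closure rinj r1 r2 tr.
Qed.

Definition flip (l : letter) : letter := (l.1, ~~ l.2).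

Lemma flipK : involutive flip. Proof. by case=> i e; rewrite /flip /= negbK. Qed.

Definition reflect (p : E) : E := (p.1, - p.2).

Lemma reflectK : involutive reflect. Proof. by case=> p z; rewrite /reflect /= opprK. Qed.

Lemma reflect_continuous : continuous reflect.
Proof.
apply: (@continuous_lipschitz3 _ _ 1) => x y; rewrite mul1r norm3_le /=.
by have [-> -> h] := norm3_comp (x - y); rewrite -opprD normrN h.
Qed.

Lemma closed_word_flip n w : closed_word n (map flip w) = reflect @` closed_word n w.
Proof.
rewrite /closed_word /closure /closed_picture image_comp /= !size_map.
apply: eq_imagel => -[[k q] s] _; rewrite /place /reflect /cyl /movie /=.
have -> : arc (nth None (None :: map Some (map flip w)) k) q s =
    ((arc (nth None (None :: map Some w) k) q s).1,
     - (arc (nth None (None :: map Some w) k) q s).2).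
  case: k => [|k] /=; first by rewrite oppr0.
  have [kw|kw] := ltnP k (size w); last first.
    by rewrite !nth_default ?size_map//= oppr0.
  rewrite (nth_map (0%N, true)) ?size_map// (nth_map (0%N, true))//.
  rewrite (nth_map (0%N, true))//; case: (nth _ w k) => i e /=.
  have -> (x : R) : (-1) ^+ (~~ ~~ e) * x = - ((-1) ^+ (~~ e) * x).
    by case: e; rewrite /= expr0 expr1 mulN1r mul1r ?opprK.
  by do 2?[case: ifP => _ //=]; rewrite ?oppr0.
by [].
Qed.

(** Reduces a statement about a letter of either sign to one sign, by reflection in the plane
    [z = 0]. *)
Lemma closed_word_unflip n m w w' :
  iso3 (closed_word n (map flip w)) (closed_word m (map flip w')) ->
  iso3 (closed_word n w) (closed_word m w').
Proof.
move=> h; have := iso3_map reflect_continuous reflect_continuous reflectK reflectK h.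
by rewrite -!closed_word_flip -!map_comp !(@eq_map _ _ (flip \o flip) id) ?map_id//; exact: flipK.
Qed.

(** The inverse of [trail]: it finds the initial position of the strand that is in position [q] at
    time [k]. *)
Fixpoint backtrail v k q : nat :=
  if k is k'.+1 then backtrail v k' (swap (nth None v k') q) else q.

Lemma trail_lt_back n v k q : all (fits n) v -> (q < n)%N -> (backtrail v k q < n)%N.
Proof.
move=> vn; elim: k q => //= k IH q qn; apply: IH; apply: swap_lt => //.
have [kv|kv] := ltnP k (size v); last by rewrite nth_default.
exact: (all_nthP None vn).
Qed.

Lemma backtrailK v k : cancel (backtrail v k) (trail v k).
Proof. by elim: k => //= k IH q; rewrite IH swapK. Qed.

(** The strands that start in a set of positions stable under the permutation of the braid form a
    union of components; [backtrail] recognises them in every sector. *)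
Theorem connected_closure n v (S : nat -> bool) q q' :
  (0 < size v)%N -> all (fits n) v -> connected (closure n v) ->
  (forall p, (p < n)%N -> S (trail v (size v) p) = S p) ->
  (q < n)%N -> (q' < n)%N -> S q -> S q'.
Proof.
move=> v0 vn cv Sv qn q'n Sq; apply: contrapT => /negP Sq'.
apply: (split_picture (S := fun k p => S (backtrail v k p)) (movie_picture R vn)
  (@movie_embedded R n v) (steady_clock R v0) _ v0 qn q'n Sq Sq') cv.
move=> k p kv pn; have [kv1|] := ltnP k.+1 (size v).
  by rewrite modn_small//= swapK.
rewrite leq_eqVlt ltnS [X in _ || X]leqNgt kv orbF => /eqP e.
rewrite e modnn /= -[RHS]Sv; last exact: trail_lt_back.
by rewrite e /= backtrailK.
Qed.

End WordMoves.
(** * Removing a generator that occurs once *)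

Section Contraction.
Variable R : realType.
Local Notation E := (R3 R).

(** The Euclidean triangle inequality for a displacement that is bounded by [D] in each coordinate,
    hence has length at most [2 * D]. *)
Lemma planar_bound (a b d1 d2 r r1 D : R) : 0 <= r -> a ^+ 2 + b ^+ 2 <= r ^+ 2 ->
  0 <= r1 -> r1 ^+ 2 <= (a + d1) ^+ 2 + (b + d2) ^+ 2 -> `|d1| <= D -> `|d2| <= D ->
  r1 <= r + 2 * D.
Proof.
move=> r0 ab r10 h h1 h2; have D0 : 0 <= D by apply: le_trans h1.
have le_abs (x : R) : x ^+ 2 <= r ^+ 2 -> `|x| <= r.
  by move=> xr; rewrite -ler_sqr ?nnegrE// real_normK ?num_real.
have a1 : `|a| <= r by apply: le_abs; have := sqr_ge0 b; lra.
have b1 : `|b| <= r by apply: le_abs; have := sqr_ge0 a; lra.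
have m1 : a * d1 <= r * D by rewrite (le_trans (ler_norm _))// normrM ler_pM.
have m2 : b * d2 <= r * D by rewrite (le_trans (ler_norm _))// normrM ler_pM.
have sq (x : R) : `|x| <= D -> x ^+ 2 <= D ^+ 2.
  by move=> xD; rewrite -(real_normK (num_real x)) ler_sqr ?nnegrE.
have s1 := sq _ h1; have s2 := sq _ h2; have D2 := sqr_ge0 D.
have rD : 0 <= r + 2 * D by rewrite addr_ge0// mulr_ge0.
rewrite -ler_sqr ?nnegrE//; move: h ab m1 m2 s1 s2 D2; clear.
rewrite !sqrrD exprMn; lra.
Qed.

(* A rising arc that winds once more around the axis than its replacement.
   Nothing is above its beginning, and the rest lies below or outside, so that it can be
   pulled over the axis. *)
Lemma unwind_arc (X : set E) (r0 r1 L b0 b1 : R) : 0 < r0 -> r0 < r1 -> 0 < L ->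
  (forall p, X p -> p.2 <= 0 \/ r1 ^+ 2 <= p.1.1 ^+ 2 + p.1.2 ^+ 2) ->
  let r x := r0 + (r1 - r0) * (x / L) in
  let new x := b0 + b1 * x in
  let old x := new x + 2 * pi * (x / L) in
  iso3 (X `|` [set cyl (r x, x) (old x) | x in [set x | 0 <= x <= L]])
       (X `|` [set cyl (r x, x) (new x) | x in [set x | 0 <= x <= L]]).
Proof.
move=> r00 r01 L0 XP r new old.
(* The displacement is horizontal, and it vanishes at both ends, where the two angles differ by 0
   and by a full turn. *)
pose v x := cyl (r x, 0) (new x) - cyl (r x, 0) (old x).
pose c (a : E + R) := match a with inl p => p | inr x => cyl (r x, x) (old x) end.
pose w (a : E + R) : E := match a with inl p => 0 | inr x => v x end.
pose A : set (E + R) := [set a | match a with inl p => X p | inr x => 0 <= x <= L end].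
have -> : X `|` [set cyl (r x, x) (old x) | x in [set x | 0 <= x <= L]] = c @` A.
  apply/seteqP; split=> p.
    by move=> [Xp|[x x0 <-]]; [exists (inl p)|exists (inr x)].
  by move=> [[q Xq <-|x x0 <-]]; [left|right; exists x].
have -> : X `|` [set cyl (r x, x) (new x) | x in [set x | 0 <= x <= L]] =
    [set c a + w a | a in A].
  have e x : cyl (r x, x) (old x) + v x = cyl (r x, x) (new x).
    by apply: eq3; rewrite /v /=; ring.
  apply/seteqP; split=> p.
    move=> [Xp|[x x0 <-]]; first by exists (inl p) => //=; rewrite addr0.
    by exists (inr x) => //=; exact: e.
  move=> [[q Xq <-|x x0 <-]] /=; first by rewrite addr0; left.
  by right; exists x => //; rewrite e.
have rB x : 0 <= x <= L -> r0 <= r x <= r1.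
  move=> /andP[x0 xL]; have q0 : 0 <= x / L by rewrite divr_ge0// ltW.
  have q1 : x / L <= 1 by rewrite ler_pdivrMr// mul1r.
  have h1 : 0 <= (r1 - r0) * (x / L) by rewrite mulr_ge0// subr_ge0 ltW.
  have h2 : 0 <= (r1 - r0) * (1 - x / L) by rewrite mulr_ge0 ?subr_ge0// ltW.
  by rewrite /r; apply/andP; split; lra.
pose s := (r1 - r0) / L.
have s0 : 0 < s by rewrite divr_gt0// subr_gt0.
have rl x y : r x - r y = s * (x - y) by rewrite /r /s; ring.
pose b2 := b1 + 2 * pi / L.
have oldl x y : old x - old y = b2 * (x - y) by rewrite /old /new /b2; ring.
have newl x y : new x - new y = b1 * (x - y) by rewrite /new; ring.
have lipc b (f : R -> R) x y : 0 <= y <= L -> (forall x y, f x - f y = b * (x - y)) ->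
    `|cyl (r x, 0) (f x) - cyl (r y, 0) (f y)| <= (s + r1 * `|b|) * `|x - y|.
  move=> yL fb; apply: le_trans (cyl_lipschitz _ _ _ _) _.
  have /andP[ry0 ry1] := rB y yL.
  rewrite mulrDl; apply: lerD.
    by rewrite norm2_le /= subrr normr0 rl normrM (gtr0_norm s0) lexx mulr_ge0// ltW.
  rewrite fb normrM mulrA ler_wpM2r// ler_wpM2r// norm2_le /= normr0.
  by rewrite ger0_norm ?ry1 /=; lra.
pose B := (s + r1 * `|b1|) + (s + r1 * `|b2|).
have B0 : 0 <= B.
  have p1 : 0 <= r1 * `|b1| by rewrite mulr_ge0//; lra.
  have p2 : 0 <= r1 * `|b2| by rewrite mulr_ge0//; lra.
  by rewrite /B; lra.
have vl x y : 0 <= y <= L -> `|v x - v y| <= B * `|x - y|.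
  move=> yL; rewrite /v opprD addrACA mulrDl; apply: le_trans (ler_normD _ _) _.
  apply: lerD; first exact: lipc yL newl.
  by rewrite -opprD normrN; exact: lipc yL oldl.
have v0 : v 0 = 0 by rewrite /v /old mul0r mulr0 addr0 subrr.
have vL : v L = 0 by rewrite /v /old divff ?gt_eqF// mulr1 cylD2pi subrr.
(* [v x] is at most a multiple of [x] and of [L - x]. If [p] is at or below the start of the arc,
   the height gap bounds [x]; otherwise the radial gap bounds [L - x]. *)
have mixed t x p : 0 <= t <= 1 -> 0 <= x <= L -> X p ->
    `|v x| <= (B * (1 + 2 / s)) * `|cyl (r x, x) (old x) - p + t *: v x|.
  move=> /andP[t0 t1] xL Xp; set D := `|_ - p + _|.
  have [h1 h2 h3] := norm3_comp (cyl (r x, x) (old x) - p + t *: v x).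
  have D0 : 0 <= D by exact: normr_ge0.
  have vx : `|v x| <= B * x.
    have := vl x 0; rewrite v0 !subr0 lexx (ltW L0) => /(_ isT).
    by rewrite ger0_norm; case/andP: xL.
  have vx' : `|v x| <= B * (L - x).
    have := vl x L; rewrite vL subr0 lexx (ltW L0) => /(_ isT).
    by move: xL => /andP[_ xL]; rewrite (distrC x L) ger0_norm ?subr_ge0.
  have is0 : 0 < s^-1 by rewrite invr_gt0.
  have [pz|pr] := XP p Xp.
    apply: le_trans vx _; rewrite -mulrA ler_wpM2l//.
    have : x <= D.
      have e : x - p.2 <= D.
        apply: le_trans h3; apply: le_trans (ler_norm _).
        by rewrite -[leRHS]/(x - p.2 + t * (0 - 0)) subrr mulr0 addr0.
      by lra.
    have : 0 <= 2 / s * D by rewrite !mulr_ge0// ltW.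
    by lra.
  apply: le_trans vx' _; rewrite -mulrA ler_wpM2l//.
  have /andP[rx0 rx1] := rB x xL.
  (* The moving point is [r x] times a convex combination of two unit vectors, so it stays within
     radius [r x]. *)
  pose ca := (1 - t) * cos (old x) + t * cos (new x).
  pose sa := (1 - t) * sin (old x) + t * sin (new x).
  have cs : ca ^+ 2 + sa ^+ 2 <= 1.
    have e : ca ^+ 2 + sa ^+ 2 = (1 - t) ^+ 2 * (cos (old x) ^+ 2 + sin (old x) ^+ 2) +
        t ^+ 2 * (cos (new x) ^+ 2 + sin (new x) ^+ 2) +
        2 * (1 - t) * t * cos (old x - new x) by rewrite cosB /ca /sa; ring.
    rewrite e !cos2Dsin2; have := cos_le1 (old x - new x) => c1.
    have : 0 <= (2 * (1 - t) * t) * (1 - cos (old x - new x)).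
      by apply: mulr_ge0; [rewrite !mulr_ge0// subr_ge0|lra].
    by clear; lra.
  have : r1 <= r x + 2 * D.
    apply: (@planar_bound (r x * ca) (r x * sa) (p.1.1 - r x * ca) (p.1.2 - r x * sa)).
    - by lra.
    - rewrite !exprMn -mulrDr ler_piMr// sqr_ge0//.
    - by lra.
    - by rewrite !addrA !(addrC _ p.1.1) !(addrC _ p.1.2) !addrK.
    - rewrite distrC; apply: le_trans h1; rewrite le_eqVlt; apply/orP; left; apply/eqP.
      congr `|_|; rewrite -[RHS]/(r x * cos (old x) - p.1.1 +
        t * (r x * cos (new x) - r x * cos (old x))) /ca; ring.
    - rewrite distrC; apply: le_trans h2; rewrite le_eqVlt; apply/orP; left; apply/eqP.
      congr `|_|; rewrite -[RHS]/(r x * sin (old x) - p.1.2 +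
        t * (r x * sin (new x) - r x * sin (old x))) /sa; ring.
  have -> : r1 = r x + s * (L - x) by rewrite /r /s; field; rewrite gt_eqF.
  rewrite lerD2l => h.
  have h' : L - x <= 2 / s * D by rewrite mulrAC ler_pdivlMr// mulrC.
  by lra.
apply: (@linear_iso3 _ _ _ _ _ (B * (1 + 2 / s))).
have C0 : B <= B * (1 + 2 / s).
  by rewrite ler_peMr// lerDl divr_ge0// ltW.
move=> t [p|x] [q|y] t01 /= Ap Aq.
- by rewrite subrr normr0 mulr_ge0// (le_trans B0).
- rewrite sub0r normrN; apply: le_trans (mixed t y p t01 Aq Ap) _.
  rewrite ler_wpM2l ?(le_trans B0)// le_eqVlt; apply/orP; left; apply/eqP.
  by rewrite -[RHS]normrN scalerN opprD opprK opprB.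
- by rewrite subr0; exact: mixed.
(* Heights do not change during the move, and those of two points of the arc differ by [x - y]. *)
- apply: le_trans (vl x y Aq) _; apply: ler_pM => //.
  have [_ _ h] := norm3_comp (cyl (r x, x) (old x) - cyl (r y, y) (old y) + t *: (v x - v y)).
  apply: le_trans h; rewrite le_eqVlt; apply/orP; left; apply/eqP.
  by congr `|_|; rewrite -[RHS]/(x - y + t * (0 - 0 - (0 - 0))); ring.
Qed.

End Contraction.
(* [lia] is very slow when real inequalities are in the context. *)
Ltac nlia := repeat match goal with H : ?T |- _ =>
  lazymatch T with
  | nat => fail
  | is_true (leq _ _) => fail
  | is_true (andb (leq _ _) (leq _ _)) => fail
  | @eq nat _ _ => fail
  | not (@eq nat _ _) => fail
  | is_true (negb _) => fail
  | @eq bool (leq _ _) _ => fail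
  | _ => clear H
  end end; lia.

Lemma real_split (R : realType) (m : nat) (y : R) : (0 < m)%N -> 0 <= y <= m%:R ->
  exists k s, [/\ (k < m)%N, 0 <= s <= 1 & y = k%:R + s].
Proof.
elim: m => // -[|m] IH _ /andP[y0 ym]; first by exists 0%N, y; rewrite y0 add0r.
have [ym'|ym'] := leP y m.+1%:R.
  have [//||k [s [km s01 e]]] := IH; first by rewrite y0.
  by exists k, s; split=> //; exact: ltnW.
exists m.+1, (y - m.+1%:R); split => //; last by ring.
by rewrite subr_ge0 ltW//= lerBlDl natr1.
Qed.

(** * The spiral: merging two neighbouring strands *)

Section Merge.
Variables (R : realType) (i n P M : nat) (V : nat -> option letter).
Local Notation E := (R3 R).
Implicit Types (a : option letter) (k q : nat) (s : R).

Definition below a : bool := if a is Some (j, _) then (j < i)%N else true.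
Definition above a : bool := if a is Some (j, _) then (i < j)%N else true.
Definition lower a : option letter :=
  if a is Some (j, e) then Some (j.-1, e) else None.

Lemma nat1R (j k : nat) : (j < k)%N -> j%:R + 1 <= k%:R :> R.
Proof. by move=> jk; rewrite natr1 ler_nat. Qed.

Lemma arc_height_le a q s : 0 <= s <= 1 -> (arc a q s).2 <= 1.
Proof.
move=> /andP[s0 s1]; have h0 : 0 <= s * (1 - s) by rewrite mulr_ge0// subr_ge0.
have h1 : s * (1 - s) <= 1 by have := sqr_ge0 s; rewrite expr2; lra.
case: a => [[j e]|] /=; last by lra.
by do 2?[case: ifP => _ /=]; rewrite ?ler01//; case: e; rewrite /= ?expr0 ?expr1; lra.
Qed.

Lemma arc_below_in a q s : below a -> (q <= i)%N -> 0 <= s <= 1 ->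
  (arc a q s).1 <= i.+1%:R.
Proof.
case: a => [[j e]|] /= h qi /andP[s0 s1]; last by rewrite ler_nat.
case: eqP => [->|_] /=.
  by have := nat1R h; rewrite -[j.+1%:R]natr1 -[i.+1%:R]natr1; lra.
case: eqP => [_|_] /=; last by rewrite ler_nat.
have : q.+1%:R <= i.+1%:R :> R by rewrite ler_nat.
by lra.
Qed.

Lemma arc_below_out a q s : below a -> (i < q)%N -> arc a q s = (q.+1%:R, 0).
Proof. by case: a => [[j e]|] //= h iq; do 2?case: eqP => //=; nlia. Qed.

Lemma swap_below_in a q : below a -> (q <= i)%N -> (swap a q <= i)%N.
Proof. by case: a => [[j e]|] //= h iq; do 2?case: eqP => //=; nlia. Qed.

Lemma swap_below_out a q : below a -> (i < q)%N -> swap a q = q.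
Proof. by case: a => [[j e]|] //= h iq; do 2?case: eqP => //=; nlia. Qed.

Lemma arc_above_in a q s : above a -> (q <= i)%N -> arc a q s = (q.+1%:R, 0).
Proof. by case: a => [[j e]|] //= h iq; do 2?case: eqP => //=; nlia. Qed.

Lemma arc_above_out a q s : above a -> (i < q)%N -> 0 <= s <= 1 ->
  i.+2%:R <= (arc a q s).1.
Proof.
case: a => [[j e]|] /= h qi /andP[s0 s1]; last by rewrite ler_nat.
have iq : i.+2%:R <= q.+1%:R :> R by rewrite ler_nat.
case: eqP => [_|_] /=; first by lra.
case: eqP => [qj|_] //=.
have : i.+3%:R <= q.+1%:R :> R by rewrite ler_nat qj; nlia.
by rewrite -[i.+3%:R]natr1; lra.
Qed.

Lemma swap_above_in a q : above a -> (q <= i)%N -> swap a q = q.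
Proof. by case: a => [[j e]|] //= h iq; do 2?case: eqP => //=; nlia. Qed.

Lemma swap_above_out a q : above a -> (i < q)%N -> (i < swap a q)%N.
Proof. by case: a => [[j e]|] //= h iq; do 2?case: eqP => //=; nlia. Qed.

Lemma arc_lower_out a q s : above a -> (i <= q)%N ->
  arc a q.+1 s = ((arc (lower a) q s).1 + 1, (arc (lower a) q s).2).
Proof.
case: a => [[[|j] e]|] //= h iq; last by rewrite natr1.
rewrite !eqSS; case: eqP => [_|_] /=; first by rewrite -[q.+2%:R]natr1 addrAC.
by case: eqP => [_|_] /=; rewrite -[q.+2%:R]natr1 // addrAC.
Qed.

Lemma swap_lower_out a q : above a -> (i <= q)%N -> swap a q.+1 = (swap (lower a) q).+1.
Proof. by case: a => [[[|j] e]|] //= h iq; rewrite !eqSS; do 2?case: eqP => //=. Qed.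

Lemma arc_lower_in a q s : above a -> (q < i)%N -> arc (lower a) q s = (q.+1%:R, 0).
Proof. by case: a => [[[|j] e]|] //= h iq; do 2?case: eqP => //=; nlia. Qed.

Lemma swap_lower_in a q : above a -> (q < i)%N -> swap (lower a) q = q.
Proof. by case: a => [[[|j] e]|] //= h iq; do 2?case: eqP => //=; nlia. Qed.

Hypotheses (iLn : (i < n)%N) (P0 : (0 < P)%N) (PM : (P.+2 < M)%N).
(** The generator comes first, then the smaller letters, three idle sectors, and the larger letters.
    In the idle sectors the strand [i] climbs back from height -1, the spiral passes, and its end
    falls back to height 0. *)
Hypotheses (V0 : V 0 = Some (i, true))
  (Vlow : forall k, (0 < k < P)%N -> below (V k))
  (Vmid : forall k, (P <= k <= P.+2)%N -> V k = None)
  (Vhigh : forall k, (P.+2 < k)%N -> above (V k))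
  (Vn : forall k, fits n.+1 (V k)).

Definition merged k : option letter :=
  if k == 0%N then None else if (k <= P.+2)%N then V k else lower (V k).

(** The height is the time elapsed since the beginning of sector [P.+1]. The spiral lasts [M.+1]
    sectors, one turn and one sector; without the turn only sector [P.+1] remains. *)
Definition spiral (x : R) : R * R := (i.+1%:R + x / M.+1%:R, x).

(** Arcs have height at most 1, so this puts them at height at most 0, as [unwind_arc] requires of
    what lies inside the spiral. *)
Definition pressed a q s : R * R := ((arc a q s).1, (arc a q s).2 - 1).

(* The strand in position [i] from time [P.+1] on, followed by the strand in position
   [i.+1] until time [P.+2], becomes a rising spiral; what is inside it is lowered. *)
Definition wound k q s : R * R :=
  if (q < i)%N then pressed (V k) q s
  else if q == i then
    if k == 0%N then spiral (M%:R - P.+1%:R + s)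
    else if (k < P)%N then pressed (V k) q s
    else if k == P then (i.+1%:R, s - 1)
    else spiral (k%:R - P.+1%:R + s)
  else if q == i.+1 then
    if k == 0%N then (i.+2%:R - s, - s)
    else if (k <= P.+1)%N then spiral (k%:R + M%:R - P.+1%:R + s)
    else if k == P.+2 then (i.+2%:R, M.+1%:R * (1 - s))
    else arc (V k) q s
  else arc (V k) q s.

(* The same link after the spiral has been pulled over the axis. *)
Definition unwound k q s : R * R :=
  if (q < i)%N then pressed (merged k) q s
  else if q == i then
    if k == 0%N then (i.+2%:R - s, - s)
    else if (k < P)%N then pressed (merged k) q s
    else if k == P then (i.+1%:R, s - 1)
    else if k == P.+1 then (i.+1%:R + s, M.+1%:R * s)
    else if k == P.+2 then (i.+2%:R, M.+1%:R * (1 - s))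
    else ((arc (merged k) q s).1 + 1, (arc (merged k) q s).2)
  else ((arc (merged k) q s).1 + 1, (arc (merged k) q s).2).

Let L : R := M.+1%:R.
Let L0 : 0 < L. Proof. by rewrite ltr0n. Qed.

Let LE : L = M%:R + 1. Proof. by rewrite natr1. Qed.

Let P1R : P.+1%:R + 2 <= M%:R :> R. Proof. by rewrite -natrD ler_nat addn2. Qed.

Let PR : 1 <= P%:R :> R. Proof. by rewrite ler1n. Qed.

Let P1E : P.+1%:R = P%:R + 1 :> R. Proof. by rewrite natr1. Qed.

Let i1E : i.+1%:R = i%:R + 1 :> R. Proof. by rewrite natr1. Qed.

Let i2E : i.+2%:R = i%:R + 2 :> R. Proof. by rewrite -natrD addn2. Qed.

Let i0 : 0 <= i%:R :> R. Proof. by []. Qed.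

Lemma spiral_ge x : 0 <= x -> i.+1%:R <= (spiral x).1.
Proof. by move=> x0; rewrite lerDl divr_ge0// ltW. Qed.

Lemma spiral_gt x : 0 < x -> i.+1%:R < (spiral x).1.
Proof. by move=> x0; rewrite ltrDl divr_gt0. Qed.

Lemma spiral_le x : x <= L -> (spiral x).1 <= i.+2%:R.
Proof.
by move=> xL; rewrite /spiral -[i.+2%:R]natr1 lerD2l ler_pdivrMr// mul1r.
Qed.

Lemma spiral_lt x : x < L -> (spiral x).1 < i.+2%:R.
Proof.
by move=> xL; rewrite /spiral -[i.+2%:R]natr1 ltrD2l ltr_pdivrMr// mul1r.
Qed.

Lemma spiral_mono x y : x < y -> (spiral x).1 < (spiral y).1.
Proof. by move=> xy; rewrite /spiral ltrD2l ltr_pM2r// invr_gt0. Qed.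

Lemma time_cases k : (k < M)%N -> [\/ k = 0%N,
  (0 < k < P)%N, k = P | [\/ k = P.+1, k = P.+2 | (P.+2 < k)%N]].
Proof.
move=> kM; have [->|k0] := posnP k; first exact: Or41.
case: (ltngtP k P) => [kP|Pk|->]; [exact: Or42|apply: Or44|exact: Or43].
case: (ltngtP k P.+1) => [|h|->]; [nlia|  |exact: Or31].
by case: (ltngtP k P.+2) => [|h'|->]; [nlia|exact: Or33|exact: Or32].
Qed.

Lemma wound_lt k q s : (q < i)%N -> wound k q s = pressed (V k) q s.
Proof. by rewrite /wound => ->. Qed.

Lemma wound_gt k q s : (i.+1 < q)%N -> wound k q s = arc (V k) q s.
Proof. by move=> h; rewrite /wound !ifF//; apply/negP; nlia. Qed.

Lemma wound_i k s : wound k i s =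
    if k == 0%N then spiral (M%:R - P.+1%:R + s)
    else if (k < P)%N then pressed (V k) i s
    else if k == P then (i.+1%:R, s - 1)
    else spiral (k%:R - P.+1%:R + s).
Proof. by rewrite /wound ltnn eqxx. Qed.

Lemma wound_i1 k s : wound k i.+1 s =
    if k == 0%N then (i.+2%:R - s, - s)
    else if (k <= P.+1)%N then spiral (k%:R + M%:R - P.+1%:R + s)
    else if k == P.+2 then (i.+2%:R, M.+1%:R * (1 - s))
    else arc (V k) i.+1 s.
Proof. by rewrite /wound ltnNge leqnSn /= (gtn_eqF (ltnSn i)) eqxx. Qed.

Lemma arc_V0 q s : arc (V 0) q s =
  if q == i then (i.+1%:R + s, s * (1 - s))
  else if q == i.+1 then (i.+2%:R - s, - (s * (1 - s))) else (q.+1%:R, 0).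
Proof.
rewrite V0 /= expr0 mul1r; case: eqP => [->//|_].
by case: eqP => [->|].
Qed.

Lemma time_high k s : (P.+2 < k)%N -> (k < M)%N -> 0 <= s <= 1 ->
  0 < k%:R - P.+1%:R + s < L /\
  [/\ (k == 0%N) = false, (k < P)%N = false, (k == P) = false,
    (k <= P.+1)%N = false & (k == P.+2) = false].
Proof.
move=> kh kM /andP[s0 s1]; have := nat1R kM; have := nat1R kh.
have -> : P.+2%:R = P.+1%:R + 1 :> R by rewrite natr1.
have P1 := P1E; have := PR; rewrite LE.
by split; [apply/andP; split; lra|move: kh; clear; split; nlia].
Qed.

(** Radial comparisons in the original and in the wound picture, sorted by the pairs of strands for
    which [wound_order] needs them. *)
Lemma wound_facts k s : (k < M)%N -> 0 <= s <= 1 ->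
  let A q := (arc (V k) q s).1 in
  [/\ (forall q, (q < i)%N -> A q <= i.+1%:R) /\
        (forall q, (i.+1 < q)%N -> i.+2%:R <= A q),
      wound k i s = pressed (V k) i s \/
        [/\ (forall q, (q < i)%N -> A q <= i%:R), i.+1%:R <= A i &
          i.+1%:R <= (wound k i s).1],
      (forall q, (q < i)%N -> A q < A i.+1 /\ A q < (wound k i.+1 s).1),
      (forall q, (i.+1 < q)%N -> A i < A q /\ (wound k i s).1 < A q)
    & wound k i.+1 s = arc (V k) i.+1 s \/
        forall q, (i.+1 < q)%N -> A i.+1 < A q /\ (wound k i.+1 s).1 < A q].
Proof.
move=> kM s01 A; move: (s01) => /andP[s0 s1]; have [l0 l1 p1] := And3 L0 LE P1R.
have [j0 j1 j2] := And3 i0 i1E i2E.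
have lt1 q : (q < i)%N -> q.+1%:R <= i%:R :> R by move=> qi; rewrite ler_nat.
have gt1 q : (i.+1 < q)%N -> i.+2%:R + 1 <= q.+1%:R :> R.
  by move=> qi; rewrite natr1 ler_nat.
have [pr p2] := (PR, P1E).
have [kE|kl|kE|[kE|kE|kh]] := time_cases kM.
- have Aq q : q <> i -> q <> i.+1 -> A q = q.+1%:R.
    by move=> /eqP/negbTE h1 /eqP/negbTE h2; rewrite /A kE arc_V0 h1 h2.
  have Alt q : (q < i)%N -> A q <= i%:R by move=> qi; rewrite Aq; [exact: lt1|nlia|nlia].
  have Agt q : (i.+1 < q)%N -> i.+2%:R + 1 <= A q.
    by move=> qi; rewrite Aq; [exact: gt1|nlia|nlia].
  have Ai : A i = i.+1%:R + s by rewrite /A kE arc_V0 eqxx.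
  have Ai1 : A i.+1 = i.+2%:R - s by rewrite /A kE arc_V0 (gtn_eqF (ltnSn i)) eqxx.
  have w1 : (wound k i.+1 s).1 = i.+2%:R - s by rewrite wound_i1 kE.
  have w0 : i.+1%:R <= (wound k i s).1 <= i.+2%:R.
    by rewrite wound_i kE eqxx spiral_ge ?spiral_le//; lra.
  split; first split.
  + by move=> q /Alt; lra.
  + by move=> q /Agt; lra.
  + by right; split=> //; [lra|case/andP: w0].
  + by move=> q /Alt; rewrite Ai1 w1; lra.
  + by move=> q /Agt; case/andP: w0 => _ w0; rewrite Ai; split; lra.
  + by right=> q /Agt; rewrite Ai1 w1; split; lra.
- have lo := Vlow kl; move: (kl) => /andP[k0 kP].
  have Alt q : (q <= i)%N -> A q <= i.+1%:R by move=> qi; exact: arc_below_in.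
  have Agt q : (i < q)%N -> A q = q.+1%:R by move=> qi; rewrite /A arc_below_out.
  have e1 : (k == 0%N) = false by nlia.
  have kR := nat1R kP; have k0R : 1 <= k%:R :> R by rewrite ler1n.
  have w0 : wound k i s = pressed (V k) i s by rewrite wound_i e1 kP.
  have w1 : i.+1%:R < (wound k i.+1 s).1 <= i.+2%:R.
    rewrite wound_i1 e1 (_ : (k <= P.+1)%N); last by nlia.
    by rewrite spiral_gt ?spiral_le//; lra.
  have Ai1 : A i.+1 = i.+2%:R by rewrite Agt.
  split; first split.
  + by move=> q qi; apply: Alt; nlia.
  + by move=> q qi; rewrite Agt; [have := gt1 _ qi; lra|nlia].
  + by left.
  + move=> q qi; have := Alt q (ltnW qi); case/andP: w1 => w1 _.
    by rewrite Ai1; split; lra.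
  + move=> q qi; rewrite w0 /= -/(A i) (Agt q) ?(ltn_trans _ qi)//.
    by have := Alt i (leqnn i); have := gt1 _ qi; split; lra.
  + right=> q qi; rewrite Ai1 (Agt q) ?(ltn_trans _ qi)//.
    by case/andP: w1 => _ w1; have := gt1 _ qi; split; lra.
- have Aq q : A q = q.+1%:R by rewrite /A Vmid// kE; nlia.
  have w0 : (wound k i s).1 = i.+1%:R.
    by rewrite wound_i (_ : (k == 0%N) = false) ?kE ?ltnn ?eqxx//; nlia.
  have w1 : i.+1%:R < (wound k i.+1 s).1 <= i.+2%:R.
    rewrite wound_i1 (_ : (k == 0%N) = false); last by nlia.
    by rewrite kE leqnSn spiral_gt ?spiral_le//; lra.
  case/andP: w1 => w1 w1'.
  split; first split.
  + by move=> q /lt1; rewrite Aq; lra.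
  + by move=> q /gt1; rewrite Aq; lra.
  + by right; rewrite w0 !Aq; split=> // q /lt1; rewrite Aq.
  + by move=> q /lt1; rewrite !Aq; split; lra.
  + by move=> q /gt1; rewrite w0 !Aq; split; lra.
  + by right=> q /gt1; rewrite !Aq; split; lra.
- have Aq q : A q = q.+1%:R by rewrite /A Vmid// kE; nlia.
  have w0 : i.+1%:R <= (wound k i s).1 < i.+2%:R.
    rewrite wound_i (_ : (k == 0%N) = false); last by nlia.
    rewrite (_ : (k < P)%N = false); last by nlia.
    rewrite (_ : (k == P) = false); last by nlia.
    by rewrite kE spiral_ge ?spiral_lt//; lra.
  have w1 : i.+1%:R < (wound k i.+1 s).1 <= i.+2%:R.
    rewrite wound_i1 (_ : (k == 0%N) = false); last by nlia.
    by rewrite kE leqnn spiral_gt ?spiral_le//; lra.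
  case/andP: w1 => w1 w1'; case/andP: w0 => w0 w0'.
  split; first split.
  + by move=> q /lt1; rewrite Aq; lra.
  + by move=> q /gt1; rewrite Aq; lra.
  + by right; rewrite !Aq; split=> // q /lt1; rewrite Aq.
  + by move=> q /lt1; rewrite !Aq; split; lra.
  + by move=> q /gt1; rewrite !Aq; split; lra.
  + by right=> q /gt1; rewrite !Aq; split; lra.
- have Aq q : A q = q.+1%:R by rewrite /A Vmid// kE; nlia.
  have w0 : i.+1%:R <= (wound k i s).1 < i.+2%:R.
    rewrite wound_i (_ : (k == 0%N) = false); last by nlia.
    rewrite (_ : (k < P)%N = false); last by nlia.
    rewrite (_ : (k == P) = false); last by nlia.
    have -> : k%:R = P.+1%:R + 1 :> R by rewrite kE natr1.
    by rewrite spiral_ge ?spiral_lt//; lra.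
  have w1 : (wound k i.+1 s).1 = i.+2%:R.
    rewrite wound_i1 (_ : (k == 0%N) = false); last by nlia.
    by rewrite (_ : (k <= P.+1)%N = false) ?kE ?eqxx//; nlia.
  case/andP: w0 => w0 w0'.
  split; first split.
  + by move=> q /lt1; rewrite Aq; lra.
  + by move=> q /gt1; rewrite Aq; lra.
  + by right; rewrite !Aq; split=> // q /lt1; rewrite Aq.
  + by move=> q /lt1; rewrite w1 !Aq; split; lra.
  + by move=> q /gt1; rewrite !Aq; split; lra.
  + by right=> q /gt1; rewrite w1 !Aq; split; lra.
- have hi := Vhigh kh.
  have Alt q : (q <= i)%N -> A q = q.+1%:R by move=> qi; rewrite /A arc_above_in.
  have Agt q : (i < q)%N -> i.+2%:R <= A q by move=> qi; exact: arc_above_out.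
  have [/andP[x0 xL] [e1 e2 e3 e4 e5]] := time_high kh kM s01.
  have w0 : i.+1%:R < (wound k i s).1 < i.+2%:R.
    by rewrite wound_i e1 e2 e3 spiral_gt ?spiral_lt.
  have w1 : wound k i.+1 s = arc (V k) i.+1 s by rewrite wound_i1 e1 e4 e5.
  case/andP: w0 => w0 w0'.
  split; first split.
  + by move=> q qi; rewrite Alt 1?ltnW//; have := lt1 _ qi; lra.
  + by move=> q qi; apply: Agt; nlia.
  + right; rewrite (Alt i)//; split=> //; last by lra.
    by move=> q qi; rewrite Alt 1?ltnW//; exact: lt1.
  + move=> q qi; rewrite w1 -/(A i.+1) (Alt q) 1?ltnW//.
    by have := lt1 _ qi; have := Agt i.+1 (ltnSn i); split; lra.
  + move=> q qi; rewrite (Alt i)//; have := Agt q (ltn_trans (ltnSn i) qi).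
    by split; lra.
  + by left.
Qed.

(** Strands that move by a common vector keep their difference, and almost all other pairs keep
    their radial order. Heights decide only at the crossing of sector 0, where the spiral stays
    above. *)
Lemma wound_order : same_order M n.+1 (fun k q s => arc (V k) q s) wound.
Proof.
move=> k q q' s kM _ _ qq' s01.
wlog qlt : q q' qq' / (q < q')%N => [H|].
  case: (ltngtP q q') qq' => // [lt _|lt _]; first by apply: H; nlia.
  have := H q' q ltac:(nlia) lt.
  by case=> [h|h]; [left|right]; rewrite /= -mulrNN !opprB.
move: (s01) => /andP[s0 s1].
have same : wound k q s = arc (V k) q s -> wound k q' s = arc (V k) q' s ->
    0 < (arc (V k) q s - arc (V k) q' s).1 * (wound k q s - wound k q' s).1 \/
    0 < (arc (V k) q s - arc (V k) q' s).2 * (wound k q s - wound k q' s).2.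
  by move=> -> ->; exact: arc_embedded.
have same1 : wound k q s = pressed (V k) q s -> wound k q' s = pressed (V k) q' s ->
    0 < (arc (V k) q s - arc (V k) q' s).1 * (wound k q s - wound k q' s).1 \/
    0 < (arc (V k) q s - arc (V k) q' s).2 * (wound k q s - wound k q' s).2.
  move=> -> ->; have := arc_embedded (V k) qq' s01; rewrite /pressed /=.
  have -> (x y : R) : x - 1 - (y - 1) = x - y by ring.
  by [].
have strict : (arc (V k) q s).1 < (arc (V k) q' s).1 ->
    (wound k q s).1 < (wound k q' s).1 ->
    0 < (arc (V k) q s - arc (V k) q' s).1 * (wound k q s - wound k q' s).1 \/
    0 < (arc (V k) q s - arc (V k) q' s).2 * (wound k q s - wound k q' s).2.
  by move=> h1 h2; left; rewrite nmulr_rgt0 /= subr_lt0.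
have [[B1 B2] B3 B4 B5 B6] := wound_facts kM s01.
have [j0 j1 j2] := And3 i0 i1E i2E.
case: (ltngtP q' i) => [q'i|iq'|q'E].
- by apply: same1; apply: wound_lt => //; exact: ltn_trans qlt q'i.
- case: (ltngtP q i) => [qi|iq|qE].
  + have [q'1|q'1] := eqVneq q' i.+1.
      by rewrite q'1 in strict *; have [h1 h2] := B4 q qi; apply: strict;
        rewrite ?(wound_lt _ _ qi).
    have q'2 : (i.+1 < q')%N by nlia.
    have h1 := B1 q qi; have h2 := B2 q' q'2.
    by apply: strict; rewrite ?(wound_lt _ _ qi) ?(wound_gt _ _ q'2) /=; lra.
  + have q'2 : (i.+1 < q')%N by nlia.
    have [q1|q1] := eqVneq q i.+1; last by apply: same; apply: wound_gt; nlia.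
    rewrite q1 in same strict *; case: B6 => [e|h]; first by apply: same => //; exact: wound_gt.
    by have [h1 h2] := h q' q'2; apply: strict; rewrite ?(wound_gt _ _ q'2).
  + rewrite qE in strict *; have [q'1|q'1] := eqVneq q' i.+1; last first.
      have q'2 : (i.+1 < q')%N by nlia.
      by have [h1 h2] := B5 q' q'2; apply: strict; rewrite ?(wound_gt _ _ q'2).
    rewrite q'1 in strict *; have [l0 l1 p1 pr p2] := And5 L0 LE P1R PR P1E.
    have [kE|kl|kE|[kE|kE|kh]] := time_cases kM.
    (* At the two ends of sector 0 the radii separate the strands; in between the spiral has
       positive height, and the other strand goes down from 0 to -1. *)
    * rewrite wound_i wound_i1 kE !eqxx !arc_V0 eqxx (gtn_eqF (ltnSn i)) eqxx /=.
      have [s1'|s1'] := eqVneq s 1.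
        left; rewrite s1'; apply: mulr_gt0; first by lra.
        have := @spiral_gt (M%:R - P.+1%:R + 1) ltac:(lra); rewrite /=.
        by move: (_ / M.+1%:R) => z; lra.
      have [s0'|s0'] := eqVneq s 0.
        left; rewrite s0' nmulr_rgt0; last by lra.
        have := @spiral_lt (M%:R - P.+1%:R + 0) ltac:(lra); rewrite /=.
        by move: (_ / M.+1%:R) => z; lra.
      right; have s0'' : 0 < s by rewrite lt_neqAle eq_sym s0'.
      have s1'' : 0 < 1 - s by rewrite subr_gt0 lt_neqAle s1'.
      have m0 : 0 < s * (1 - s) by rewrite mulr_gt0.
      by rewrite !opprK; apply: mulr_gt0; lra.
    * have lo := Vlow kl; move: (kl) => /andP[k0 kP].
      have h1 := arc_below_in lo (leqnn i) s01.
      have h2 := arc_below_out s lo (ltnSn i).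
      have e1 : (k == 0%N) = false by nlia.
      have kR := nat1R kP; have k0R : 1 <= k%:R :> R by rewrite ler1n.
      apply: strict; first by rewrite h2 /=; lra.
      rewrite wound_i wound_i1 e1 kP (_ : (k <= P.+1)%N); last by nlia.
      by apply: le_lt_trans h1 _; apply: spiral_gt; lra.
    * have h q0 : arc (V k) q0 s = (q0.+1%:R, 0) by rewrite Vmid// kE; nlia.
      apply: strict; first by rewrite !h /=; lra.
      rewrite wound_i wound_i1 (_ : (k == 0%N) = false); last by nlia.
      rewrite kE ltnn eqxx leqnSn; apply: spiral_gt; lra.
    * have h q0 : arc (V k) q0 s = (q0.+1%:R, 0) by rewrite Vmid// kE; nlia.
      apply: strict; first by rewrite !h /=; lra.
      rewrite wound_i wound_i1 (_ : (k == 0%N) = false); last by nlia.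
      rewrite kE leqnn (_ : (P.+1 < P)%N = false); last by nlia.
      rewrite (_ : (P.+1 == P) = false); last by nlia.
      by apply: spiral_mono; lra.
    * have h q0 : arc (V k) q0 s = (q0.+1%:R, 0) by rewrite Vmid// kE; nlia.
      apply: strict; first by rewrite !h /=; lra.
      rewrite wound_i wound_i1 (_ : (k == 0%N) = false); last by nlia.
      rewrite (_ : (k < P)%N = false); last by nlia.
      rewrite (_ : (k == P) = false); last by nlia.
      rewrite (_ : (k <= P.+1)%N = false); last by nlia.
      have kR : k%:R = P.+1%:R + 1 :> R by rewrite kE natr1.
      by rewrite kE eqxx -kE; apply: spiral_lt; rewrite kR; lra.
    * have [/andP[x0 xL] [e1 e2 e3 e4 e5]] := time_high kh kM s01; have hi := Vhigh kh.
      have h1 := arc_above_out hi (ltnSn i) s01.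
      apply: strict; first by rewrite (arc_above_in s hi (leqnn i)) /=; lra.
      rewrite wound_i wound_i1 e1 e2 e3 e4 e5.
      by apply: lt_le_trans h1; exact: spiral_lt.
- have qi : (q < i)%N by nlia.
  rewrite q'E in same1 strict *; case: B3 => [e|[h1 h2 h3]].
    by apply: same1 => //; exact: wound_lt.
  by have h4 := h1 q qi; apply: strict; rewrite ?(wound_lt _ _ qi) /=; lra.
Qed.

Let i01 : 0 <= (0 : R) <= 1. Proof. by rewrite lexx ler01. Qed.

Lemma swap_V0 q : swap (V 0) q = if q == i then i.+1 else if q == i.+1 then i else q.
Proof. by rewrite V0. Qed.

Lemma wound_start_in k q : (q < i)%N -> wound k q 0 = (q.+1%:R, -1).
Proof. by move=> h; rewrite wound_lt// /pressed arc0 sub0r. Qed.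

Lemma wound_start_low k q : (0 < k <= P)%N -> (q <= i)%N -> wound k q 0 = (q.+1%:R, -1).
Proof.
move=> kP; rewrite leq_eqVlt => /predU1P[->|]; last exact: wound_start_in.
rewrite wound_i (_ : (k == 0%N) = false); last by nlia.
case: ifP => kP1; first by rewrite /pressed arc0 sub0r.
by rewrite (_ : k = P) ?eqxx ?sub0r//; nlia.
Qed.

Lemma wound_start_spiral k : (P <= k < M)%N ->
  wound (k.+1 %% M)%N i 0 = spiral (k.+1%:R - P.+1%:R).
Proof.
move=> /andP[Pk]; rewrite leq_eqVlt => /predU1P[kE|kM].
  by rewrite kE modnn wound_i addr0.
rewrite modn_small// wound_i (_ : (k.+1 < P)%N = false); last by nlia.
by rewrite (_ : (k.+1 == P) = false) ?addr0//; nlia.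
Qed.

Lemma wound_start_spiral2 k : (k <= P)%N ->
  wound k.+1 i.+1 0 = spiral (k.+1%:R + M%:R - P.+1%:R).
Proof. by move=> kP; rewrite wound_i1 /= ltnS kP addr0. Qed.

Lemma wound_start_fall : wound P.+2 i.+1 0 = (i.+2%:R, L).
Proof. by rewrite wound_i1 /= ltnn eqxx subr0 mulr1. Qed.

Lemma wound_start_out k q : (P.+2 <= k < M)%N -> (i < q)%N ->
  wound (k.+1 %% M)%N q 0 = (q.+1%:R, 0).
Proof.
move=> /andP[Pk kM]; rewrite leq_eqVlt => /predU1P[<-|iq]; last by rewrite wound_gt// arc0.
move: kM; rewrite leq_eqVlt => /predU1P[kE|kM].
  by rewrite kE modnn wound_i1 /= subr0 oppr0.
rewrite modn_small// wound_i1 /= (_ : (k.+1 <= P.+1)%N = false); last by nlia.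
by rewrite (_ : (k.+1 == P.+2) = false) ?arc0//; nlia.
Qed.

Lemma wound_start_far k q : (i.+1 < q)%N -> wound k q 0 = (q.+1%:R, 0).
Proof. by move=> iq; rewrite wound_gt// arc0. Qed.

Lemma wound_junction k q : (k < M)%N -> wound k q 1 = wound (k.+1 %% M)%N (swap (V k) q) 0.
Proof.
move=> kM; have k1 : (k < P.+2)%N -> (k.+1 %% M)%N = k.+1 by move=> ?; rewrite modn_small; nlia.
have [kE|kl|kE|[kE|kE|kh]] := time_cases kM.
- rewrite k1 ?kE; last by nlia.
  rewrite swap_V0; case: (ltngtP q i) => [qi|iq|->].
  + rewrite (_ : (q == i.+1) = false); last by nlia.
    by rewrite wound_lt// /pressed arc1 sub0r wound_start_in// swap_V0 !ifF//; nlia.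
  + have [->|q1] := eqVneq q i.+1.
      by rewrite wound_i1 /= wound_start_low// -natr1 addrK.
    rewrite wound_gt ?wound_start_far ?arc1; [|nlia|nlia].
    by rewrite swap_V0 !ifF//; nlia.
  + by rewrite wound_i wound_start_spiral2//; congr spiral; ring.
- have lo := Vlow kl; move: (kl) => /andP[k0 kP]; rewrite k1; last by nlia.
  have low q' : (q' <= i)%N -> wound k.+1 (swap (V k) q') 0 = ((swap (V k) q').+1%:R, -1).
    by move=> q'i; apply: wound_start_low; [nlia|exact: swap_below_in].
  case: (ltngtP q i) => [qi|iq|->].
  + by rewrite wound_lt// low 1?ltnW// /pressed arc1 sub0r.
  + rewrite (swap_below_out lo iq); have [->|q1] := eqVneq q i.+1.
      rewrite wound_start_spiral2; last by nlia.
      rewrite wound_i1 (_ : (k == 0%N) = false); last by nlia.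
      rewrite (_ : (k <= P.+1)%N); last by nlia.
      by congr spiral; rewrite -natr1; ring.
    by rewrite wound_gt ?wound_start_far ?arc1 ?(swap_below_out lo iq)//; nlia.
  + rewrite low// wound_i (_ : (k == 0%N) = false) ?kP ?/pressed ?arc1 ?sub0r//; nlia.
- rewrite k1; last by nlia.
  have VE : V k = None by apply: Vmid; nlia.
  rewrite VE /=; case: (ltngtP q i) => [qi|iq|->].
  + by rewrite wound_lt// wound_start_in// /pressed arc1 VE sub0r.
  + have [->|q1] := eqVneq q i.+1.
      rewrite kE wound_start_spiral2// wound_i1 (_ : (P == 0%N) = false); last by nlia.
      by rewrite leqnSn; congr spiral; rewrite -natr1; ring.
    by rewrite wound_gt ?wound_start_far ?arc1 ?VE//; nlia.
  + have := @wound_start_spiral k; rewrite k1; last by nlia.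
    rewrite kE => ->; last by nlia.
    rewrite wound_i (_ : (P == 0%N) = false) ?ltnn ?eqxx; last by nlia.
    by rewrite !subrr /spiral mul0r addr0.
- rewrite k1; last by nlia.
  have VE : V k = None by apply: Vmid; nlia.
  rewrite VE /=; case: (ltngtP q i) => [qi|iq|->].
  + by rewrite wound_lt// wound_start_in// /pressed arc1 VE sub0r.
  + have [->|q1] := eqVneq q i.+1.
      rewrite kE wound_start_fall wound_i1 /= leqnn /spiral.
      have -> : P.+1%:R + M%:R - P.+1%:R + 1 = L by rewrite LE; ring.
      by rewrite divff ?gt_eqF// natr1.
    by rewrite wound_gt ?wound_start_far ?arc1 ?VE//; nlia.
  + have := @wound_start_spiral k; rewrite k1; last by nlia.
    rewrite kE => ->; last by nlia.
    rewrite wound_i /= (_ : (P.+1 < P)%N = false); last by nlia.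
    rewrite (_ : (P.+1 == P) = false); last by nlia.
    by congr spiral; rewrite -[P.+2%:R]natr1; ring.
- have VE : V k = None by apply: Vmid; nlia.
  rewrite VE /=; case: (ltngtP q i) => [qi|iq|->].
  + by rewrite wound_lt// wound_start_in// /pressed arc1 VE sub0r.
  + rewrite wound_start_out//; last by nlia.
    have [->|q1] := eqVneq q i.+1; last by rewrite wound_gt ?arc1 ?VE//; nlia.
    by rewrite kE wound_i1 /= ltnn eqxx subrr mulr0.
  + rewrite wound_start_spiral; last by nlia.
    rewrite wound_i (_ : (k == 0%N) = false); last by nlia.
    rewrite (_ : (k < P)%N = false); last by nlia.
    rewrite (_ : (k == P) = false); last by nlia.
    by congr spiral; rewrite -[k.+1%:R]natr1; ring.
- have hi := Vhigh kh; have [_ [e1 e2 e3 e4 e5]] := time_high kh kM i01.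
  case: (ltngtP q i) => [qi|iq|->].
  + rewrite (swap_above_in hi (ltnW qi)) wound_lt// wound_start_in// /pressed arc1.
    by rewrite (swap_above_in hi (ltnW qi)) sub0r.
  + rewrite wound_start_out; [|nlia|exact: swap_above_out hi iq].
    have [->|q1] := eqVneq q i.+1; first by rewrite wound_i1 e1 e4 e5 arc1.
    by rewrite wound_gt ?arc1//; nlia.
  + rewrite (swap_above_in hi (leqnn i)) wound_start_spiral; last by nlia.
    by rewrite wound_i e1 e2 e3; congr spiral; rewrite -[k.+1%:R]natr1; ring.
Qed.

Lemma lip1_affine (a b c : R) : lip1 (fun s => a + (b + s) * c).
Proof.
have lc x := @lip1_cst R x; have li := @lip1_id R.
by apply: lip1D => //; apply: lip1M => //; exact: lip1D.
Qed.

Lemma wound_picture : picture M n.+1 (fun k => swap (V k)) wound.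
Proof.
move=> k q kM qn; have [a1 a2] := @lip1_arc R (V k) q.
have a3 := @arc_ge1 R (V k) q.
have lc x := @lip1_cst R x; have li := @lip1_id R.
have sp x : lip1 (fun s => (spiral (x + s)).1) /\ lip1 (fun s => (spiral (x + s)).2).
  by split; [exact: lip1_affine|exact: lip1D].
have sp1 x : 0 <= x -> 1 <= (spiral x).1.
  by move=> /(@spiral_ge _); apply: le_trans; rewrite ler1n.
have pr : lip1 (fun s => (pressed (V k) q s).1) /\ lip1 (fun s => (pressed (V k) q s).2).
  by split=> //; exact: lip1B.
split; [exact: swap_lt|exact: wound_junction| | |].
- rewrite /wound; case: (q < i)%N; first by case: pr.
  case: (q == i).
    case: (k == 0%N); first by case: (sp (M%:R - P.+1%:R)).
    case: (k < P)%N; first by case: pr.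
    by case: (k == P); [exact: lc|case: (sp (k%:R - P.+1%:R))].
  case: (q == i.+1) => //; case: (k == 0%N); first exact: lip1B.
  case: (k <= P.+1)%N; first by case: (sp (k%:R + M%:R - P.+1%:R)).
  by case: (k == P.+2) => //; exact: lc.
- rewrite /wound; case: (q < i)%N; first by case: pr.
  case: (q == i).
    case: (k == 0%N); first by case: (sp (M%:R - P.+1%:R)).
    case: (k < P)%N; first by case: pr.
    by case: (k == P); [exact: lip1B|case: (sp (k%:R - P.+1%:R))].
  case: (q == i.+1) => //; case: (k == 0%N); first exact: lip1N.
  case: (k <= P.+1)%N; first by case: (sp (k%:R + M%:R - P.+1%:R)).
  by case: (k == P.+2) => //; apply: lip1M => //; exact: lip1B.
- move=> s s01; move: (s01) => /andP[s0 s1].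
  have k0 : 0 <= k%:R :> R by [].
  have p1 := P1R.
  rewrite /wound; case: (q < i)%N; first exact: a3.
  case: (q == i).
    case: ifP => _; first by apply: sp1; lra.
    case: ifP => [_|kP]; first exact: a3.
    case: (altP eqP) => [_|kP']; first by rewrite ler1n.
    have : P.+1%:R <= k%:R :> R by rewrite ler_nat; nlia.
    by move=> ?; apply: sp1; lra.
  case: (q == i.+1); last exact: a3.
  case: ifP => _ /=.
    by rewrite -[i.+2%:R]natr1; have : 1 <= i.+1%:R :> R by [rewrite ler1n]; lra.
  case: ifP => _; first by apply: sp1; lra.
  by case: ifP => _ /=; [rewrite ler1n|exact: a3].
Qed.

Lemma merged_low k : (k <= P.+2)%N -> below (merged k).
Proof.
move=> kP; rewrite /merged kP; case: eqP => // /eqP k0.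
have [kP'|kP'] := ltnP k P; first by apply: Vlow; rewrite lt0n k0.
by rewrite Vmid ?kP' ?kP.
Qed.

Lemma merged_high k : (P.+2 < k)%N -> merged k = lower (V k).
Proof.
move=> kP; rewrite /merged (_ : (k == 0%N) = false); last by nlia.
by rewrite leqNgt kP.
Qed.

Lemma merged_mid k : (P <= k <= P.+2)%N -> merged k = None.
Proof. by move=> kP; rewrite /merged; case: eqP => // _; rewrite Vmid//; case: ifP. Qed.

Lemma merged_fits k : fits n (merged k).
Proof.
have [kP|kP] := leqP k P.+2.
  have := merged_low kP; case: (merged k) => [[j e]|] //= ji.
  by rewrite /fits /=; nlia.
rewrite merged_high//; have := Vhigh kP; have := Vn k.
by case: (V k) => [[j e]|] //=; rewrite /fits /=; nlia.
Qed.

Lemma unwound_lt k q s : (q < i)%N -> unwound k q s = pressed (merged k) q s.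
Proof. by rewrite /unwound => ->. Qed.

Lemma unwound_gt k q s : (i < q)%N ->
  unwound k q s = ((arc (merged k) q s).1 + 1, (arc (merged k) q s).2).
Proof. by move=> h; rewrite /unwound !ifF//; apply/negbTE; nlia. Qed.

Lemma unwound_i k s : unwound k i s =
    if k == 0%N then (i.+2%:R - s, - s)
    else if (k < P)%N then pressed (merged k) i s
    else if k == P then (i.+1%:R, s - 1)
    else if k == P.+1 then (i.+1%:R + s, M.+1%:R * s)
    else if k == P.+2 then (i.+2%:R, M.+1%:R * (1 - s))
    else ((arc (merged k) i s).1 + 1, (arc (merged k) i s).2).
Proof. by rewrite /unwound ltnn eqxx. Qed.

Lemma unwound_start_in k q : (q < i)%N -> unwound k q 0 = (q.+1%:R, -1).
Proof. by move=> h; rewrite unwound_lt// /pressed arc0 sub0r. Qed.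

Lemma unwound_start_low k q : (0 < k <= P)%N -> (q <= i)%N ->
  unwound k q 0 = (q.+1%:R, -1).
Proof.
move=> kP; rewrite leq_eqVlt => /predU1P[->|]; last exact: unwound_start_in.
rewrite unwound_i (_ : (k == 0%N) = false); last by nlia.
case: ifP => kP1; first by rewrite /pressed arc0 sub0r.
by rewrite (_ : k = P) ?eqxx ?sub0r//; nlia.
Qed.

Lemma unwound_start_gt k q : (i < q)%N -> unwound k q 0 = (q.+2%:R, 0).
Proof. by move=> iq; rewrite unwound_gt// arc0 natr1. Qed.

Lemma unwound_start_out k q : (P.+2 <= k < M)%N -> (i <= q)%N ->
  unwound (k.+1 %% M)%N q 0 = (q.+2%:R, 0).
Proof.
move=> /andP[Pk kM]; rewrite leq_eqVlt => /predU1P[<-|]; last exact: unwound_start_gt.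
move: kM; rewrite leq_eqVlt => /predU1P[kE|kM].
  by rewrite kE modnn unwound_i /= subr0 oppr0.
rewrite modn_small// unwound_i /= (_ : (k.+1 < P)%N = false); last by nlia.
rewrite (_ : (k.+1 == P) = false); last by nlia.
rewrite (_ : (k.+1 == P.+1) = false); last by nlia.
by rewrite (_ : (k.+1 == P.+2) = false) ?arc0 ?natr1//; nlia.
Qed.

Lemma unwound_start1 : unwound P.+1 i 0 = (i.+1%:R, 0).
Proof.
rewrite unwound_i /= (_ : (P.+1 < P)%N = false); last by nlia.
by rewrite (_ : (P.+1 == P) = false) ?eqxx ?addr0 ?mulr0//; nlia.
Qed.

Lemma unwound_start2 : unwound P.+2 i 0 = (i.+2%:R, L).
Proof.
rewrite unwound_i /= (_ : (P.+2 < P)%N = false); last by nlia.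
rewrite (_ : (P.+2 == P) = false); last by nlia.
by rewrite (_ : (P.+2 == P.+1) = false) ?eqxx ?subr0 ?mulr1//; nlia.
Qed.

Lemma unwound_junction k q : (k < M)%N ->
  unwound k q 1 = unwound (k.+1 %% M)%N (swap (merged k) q) 0.
Proof.
move=> kM; have k1 : (k < P.+2)%N -> (k.+1 %% M)%N = k.+1 by move=> ?; rewrite modn_small; nlia.
have inside q' : (q' < i)%N -> swap (merged k) q' = q' ->
    unwound k q' 1 = unwound (k.+1 %% M)%N (swap (merged k) q') 0.
  by move=> qi e; rewrite unwound_lt// /pressed arc1 e sub0r unwound_start_in.
have outside q' : (i < q')%N -> (i < swap (merged k) q')%N ->
    unwound k q' 1 = unwound (k.+1 %% M)%N (swap (merged k) q') 0.
  by move=> iq e; rewrite unwound_gt// arc1 unwound_start_gt// natr1.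
have mid : (k == 0%N) || (P <= k <= P.+2)%N -> (q != i -> unwound k q 1 =
    unwound (k.+1 %% M)%N (swap (merged k) q) 0) /\ swap (merged k) q = q.
  move=> h; have e : merged k = None by case/predU1P: h => [->|/merged_mid].
  split; last by rewrite e.
  by rewrite neq_ltn => /orP[qi|iq]; [apply: inside|apply: outside]; rewrite ?e.
have [kE|kl|kE|[kE|kE|kh]] := time_cases kM.
- have [|H ->] := mid; first by rewrite kE.
  have [->|/H] := eqVneq q i; last by rewrite /swap kE.
  rewrite k1 ?kE// unwound_start_low// unwound_i /=; congr pair.
  by rewrite -natr1 addrK.
- have lo : below (merged k) by apply: merged_low; nlia.
  rewrite k1; last by nlia.
  have [qi|iq] := leqP q i; last first.
    by have := outside q iq; rewrite (swap_below_out lo iq) k1; [exact|nlia].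
  rewrite unwound_start_low; [|nlia|exact: swap_below_in].
  move: qi; rewrite leq_eqVlt => /predU1P[->|qi].
    rewrite unwound_i (_ : (k == 0%N) = false); last by nlia.
    by rewrite (_ : (k < P)%N) ?/pressed ?arc1 ?sub0r//; nlia.
  by rewrite unwound_lt// /pressed arc1 sub0r.
- have [|H e] := mid; first by rewrite kE leqnn; nlia.
  have [qE|/H//] := eqVneq q i; rewrite e qE k1; last by nlia.
  rewrite kE unwound_start1 unwound_i (_ : (P == 0%N) = false); last by nlia.
  by rewrite ltnn eqxx subrr.
- have [|H e] := mid; first by rewrite kE leqnSn ltnW// orbT.
  have [qE|/H//] := eqVneq q i; rewrite e qE k1; last by nlia.
  rewrite kE unwound_start2 unwound_i /= (_ : (P.+1 < P)%N = false); last by nlia.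
  by rewrite (_ : (P.+1 == P) = false) ?eqxx ?mulr1 ?natr1//; nlia.
- have [|H e] := mid; first by rewrite kE leqnn; nlia.
  have [qE|/H//] := eqVneq q i; rewrite e qE.
  rewrite unwound_start_out; [|nlia|by []].
  rewrite kE unwound_i /= (_ : (P.+2 < P)%N = false); last by nlia.
  rewrite (_ : (P.+2 == P) = false); last by nlia.
  by rewrite (_ : (P.+2 == P.+1) = false) ?eqxx ?subrr ?mulr0//; nlia.
- have hi := Vhigh kh; have mE := merged_high kh.
  have [qi|iq] := ltnP q i.
    by apply: inside => //; rewrite mE (swap_lower_in hi qi).
  have sq : (i <= swap (merged k) q)%N.
    by have := swap_above_out hi (_ : i < q.+1)%N; rewrite (swap_lower_out hi iq) mE; apply.
  rewrite unwound_start_out//; last by nlia.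
  have -> : unwound k q 1 = ((arc (merged k) q 1).1 + 1, (arc (merged k) q 1).2).
    move: iq; rewrite leq_eqVlt => /predU1P[<-|]; last exact: unwound_gt.
    rewrite unwound_i (_ : (k == 0%N) = false); last by nlia.
    rewrite (_ : (k < P)%N = false); last by nlia.
    rewrite (_ : (k == P) = false); last by nlia.
    rewrite (_ : (k == P.+1) = false); last by nlia.
    by rewrite (_ : (k == P.+2) = false)//; nlia.
  by rewrite arc1 natr1.
Qed.

Lemma unwound_picture : picture M n (fun k => swap (merged k)) unwound.
Proof.
move=> k q kM qn; have [a1 a2] := @lip1_arc R (merged k) q.
have a3 := @arc_ge1 R (merged k) q.
have lc x := @lip1_cst R x; have li := @lip1_id R.
have sh : lip1 (fun s => (arc (merged k) q s).1 + 1) by exact: lip1D.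
have pr1 : lip1 (fun s => (pressed (merged k) q s).1) by [].
have pr2 : lip1 (fun s => (pressed (merged k) q s).2) by exact: lip1B.
split; [exact: (swap_lt (merged_fits k))|exact: unwound_junction| | |].
- rewrite /unwound; case: (q < i)%N; first by [].
  case: (q == i) => //; case: (k == 0%N); first exact: lip1B.
  case: (k < P)%N => //; case: (k == P); first exact: lc.
  case: (k == P.+1); first exact: lip1D.
  by case: (k == P.+2); [exact: lc|exact: sh].
- rewrite /unwound; case: (q < i)%N; first by [].
  case: (q == i) => //; case: (k == 0%N); first exact: lip1N.
  case: (k < P)%N => //; case: (k == P); first exact: lip1B.
  case: (k == P.+1); first exact: lip1M.
  by case: (k == P.+2); [apply: lip1M => //; exact: lip1B|exact: a2].
- move=> s s01; move: (s01) => /andP[s0 s1].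
  have j1 j : 1 <= j.+1%:R :> R by rewrite ler1n.
  have a4 : 1 <= (arc (merged k) q s).1 + 1 by have := a3 s s01; lra.
  rewrite /unwound; case: (q < i)%N; first exact: a3.
  case: (q == i); last exact: a4.
  case: (k == 0%N) => /=.
    by rewrite -[i.+2%:R]natr1; have := j1 i; lra.
  case: (k < P)%N; first exact: a3.
  case: (k == P); first exact: j1.
  case: (k == P.+1); first by have := j1 i; rewrite /=; lra.
  by case: (k == P.+2); [exact: j1|exact: a4].
Qed.

Lemma unwound_order : same_order M n (fun k q s => arc (merged k) q s) unwound.
Proof.
move=> k q q' s kM _ _ qq' s01.
wlog qlt : q q' qq' / (q < q')%N => [H|].
  case: (ltngtP q q') qq' => // [lt _|lt _]; first by apply: H; nlia.
  have := H q' q ltac:(nlia) lt.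
  by case=> [h|h]; [left|right]; rewrite /= -mulrNN !opprB.
move: (s01) => /andP[s0 s1].
set A := fun q => arc (merged k) q s.
have same b c : unwound k q s = ((A q).1 + b, (A q).2 + c) ->
    unwound k q' s = ((A q').1 + b, (A q').2 + c) ->
    0 < (A q - A q').1 * (unwound k q s - unwound k q' s).1 \/
    0 < (A q - A q').2 * (unwound k q s - unwound k q' s).2.
  move=> -> ->; have := arc_embedded (merged k) qq' s01 => /=.
  have e (x y z : R) : x + z - (y + z) = x - y by ring.
  by rewrite !e.
have strict : (A q).1 < (A q').1 -> (unwound k q s).1 < (unwound k q' s).1 ->
    0 < (A q - A q').1 * (unwound k q s - unwound k q' s).1 \/
    0 < (A q - A q').2 * (unwound k q s - unwound k q' s).2.
  by move=> h1 h2; left; rewrite nmulr_rgt0 /= subr_lt0.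
have inU q0 : (q0 < i)%N -> unwound k q0 s = ((A q0).1 + 0, (A q0).2 - 1).
  by move=> h; rewrite unwound_lt// addr0.
have outU q0 : (i < q0)%N -> unwound k q0 s = ((A q0).1 + 1, (A q0).2 + 0).
  by move=> h; rewrite unwound_gt// addr0.
have [q'i|iq'] := ltnP q' i.
  by apply: same; apply: inU => //; exact: ltn_trans qlt q'i.
have [iq|qi] := ltnP i q.
  by apply: same; apply: outU => //; exact: ltn_trans iq qlt.
have le1 (a b : nat) : (a <= b)%N -> a.+1%:R <= b.+1%:R :> R by rewrite ler_nat.
have i2S : i.+2%:R = i.+1%:R + 1 :> R by rewrite natr1.
(* In these sectors [merged] is idle, so the strand [i] only has to stay between the radii of the
   positions [i] and [i.+1] of the larger braid. *)
have zone : (k == 0%N) || (P <= k <= P.+2)%N ->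
    i.+1%:R <= (unwound k i s).1 <= i.+2%:R -> 
    0 < (A q - A q').1 * (unwound k q s - unwound k q' s).1 \/
    0 < (A q - A q').2 * (unwound k q s - unwound k q' s).2.
  move=> h /andP[u0 u1].
  have AE q0 : A q0 = (q0.+1%:R, 0) by rewrite /A; case/predU1P: h => [->|/merged_mid->].
  have lt1 : q.+1%:R + 1 <= q'.+1%:R :> R by rewrite natr1 ler_nat.
  apply: strict; first by rewrite !AE /=; lra.
  move: qi; rewrite leq_eqVlt => /predU1P[qE|qi].
    rewrite qE in lt1 qlt *; rewrite (outU q')//.
    by rewrite AE /=; lra.
  rewrite inU// AE; have := le1 _ _ qi; move: iq'; rewrite leq_eqVlt => /predU1P[<-|iq'].
    have := @le1 q.+1 i qi; rewrite -[q.+2%:R]natr1 /=; lra.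
  by rewrite outU// AE /=; lra.
have [kE|kl|kE|[kE|kE|kh]] := time_cases kM.
- apply: zone; first by rewrite kE.
  by rewrite unwound_i kE /=; apply/andP; split; lra.
- have lo : below (merged k) by apply: merged_low; nlia.
  have kP : (k < P)%N by nlia.
  have e1 : (k == 0%N) = false by nlia.
  have inU' q0 : (q0 <= i)%N -> unwound k q0 s = ((A q0).1 + 0, (A q0).2 - 1).
    rewrite leq_eqVlt => /predU1P[->|/inU//].
    by rewrite unwound_i e1 kP addr0.
  have [q'i|{}iq'] := leqP q' i; first by apply: same; exact: inU'.
  have h1 := arc_below_in lo qi s01.
  have h2 := arc_below_out s lo iq'; have h3 := le1 _ _ iq'.
  have h4 : i.+1%:R < (A q').1 by rewrite /A h2 /=; lra.
  by apply: strict; [exact: le_lt_trans h1 _|rewrite inU' ?outU//= -/(A q); move: h1;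
    rewrite -/(A q); lra].
- apply: zone; first by rewrite kE; nlia.
  rewrite unwound_i kE ltnn eqxx (_ : (P == 0%N) = false); last by nlia.
  by rewrite lexx /= ler_nat.
- apply: zone; first by rewrite kE; nlia.
  rewrite unwound_i kE /= (_ : (P.+1 < P)%N = false); last by nlia.
  by rewrite (_ : (P.+1 == P) = false) ?eqxx /=; [apply/andP; split; lra|nlia].
- apply: zone; first by rewrite kE; nlia.
  rewrite unwound_i kE /= (_ : (P.+2 < P)%N = false); last by nlia.
  rewrite (_ : (P.+2 == P) = false); last by nlia.
  by rewrite (_ : (P.+2 == P.+1) = false) ?eqxx /= ?lexx ?ler_nat ?leqnSn//; nlia.
- have hi := Vhigh kh; have mE := merged_high kh.
  have outU' q0 : (i <= q0)%N -> unwound k q0 s = ((A q0).1 + 1, (A q0).2 + 0).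
    rewrite leq_eqVlt => /predU1P[<-|/outU//].
    rewrite unwound_i (_ : (k == 0%N) = false); last by nlia.
    rewrite (_ : (k < P)%N = false); last by nlia.
    rewrite (_ : (k == P) = false); last by nlia.
    rewrite (_ : (k == P.+1) = false); last by nlia.
    by rewrite (_ : (k == P.+2) = false) ?addr0//; nlia.
  have [{}qi|iq] := ltnP q i; last by apply: same; exact: outU'.
  have h0 : (A q).1 = q.+1%:R by rewrite /A mE (arc_lower_in s hi qi).
  have h1 := @arc_above_out _ q'.+1 s hi ltac:(nlia) s01.
  rewrite (arc_lower_out s hi iq') -mE -/(A q') /= in h1.
  have h2 := @le1 q.+1 i qi; rewrite -[q.+2%:R]natr1 in h2.
  have h3 : (A q).1 < (A q').1 by rewrite h0; lra.
  by apply: strict => //; rewrite inU// outU'//=; lra.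
Qed.

Local Notation Th := (@steady R M).

Let M0 : 0 < M%:R :> R. Proof. by rewrite ltr0n; move: PM; clear; lia. Qed.

Lemma wound_unwound_in k q s : (q < i)%N -> wound k q s = unwound k q s.
Proof.
move=> qi; rewrite wound_lt// /unwound qi /pressed.
suff -> : arc (V k) q s = arc (merged k) q s by [].
have [kP|kP] := leqP k P.+2; last first.
  by rewrite merged_high// (arc_lower_in _ (Vhigh kP) qi) (arc_above_in _ (Vhigh kP) (ltnW qi)).
rewrite /merged kP; case: eqP => [->|//].
by rewrite arc_V0 !ifF//; nlia.
Qed.

Lemma wound_unwound_low k s : (0 < k <= P)%N -> wound k i s = unwound k i s.
Proof.
move=> kP; rewrite wound_i /unwound ltnn eqxx /pressed /merged.
rewrite (_ : (k == 0%N) = false); last by nlia.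
rewrite (_ : (k <= P.+2)%N); last by nlia.
by case: ifP => // h; rewrite (_ : (k == P))//; nlia.
Qed.

Lemma wound_unwound_out k q s : (i < q)%N -> wound k q.+1 s = unwound k q s.
Proof.
move=> iq; rewrite wound_gt// /unwound !ifF; [|nlia|nlia].
have [kP|kP] := leqP k P.+2; last by rewrite merged_high// (arc_lower_out s (Vhigh kP) (ltnW iq)).
rewrite (arc_below_out s (merged_low kP) iq) natr1.
move: kP; rewrite /= leq_eqVlt; have [->|k0] := posnP k => kP.
  by rewrite arc_V0 !ifF//; nlia.
have [kP'|kP'] := ltnP k P.
  by rewrite (arc_below_out s (Vlow _))//; nlia.
by rewrite Vmid//; move: kP; rewrite -leq_eqVlt; nlia.
Qed.

Lemma wound_unwound_edge k s : (k == 0%N) || (P.+2 <= k)%N ->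
  wound k i.+1 s = unwound k i s.
Proof.
move=> h; rewrite wound_i1 /unwound ltnn eqxx.
case: eqP h => //= _ kP.
rewrite (_ : (k <= P.+1)%N = false); last by nlia.
rewrite (_ : (k < P)%N = false); last by nlia.
rewrite (_ : (k == P) = false); last by nlia.
rewrite (_ : (k == P.+1) = false); last by nlia.
case: (altP eqP) => // kE.
by rewrite merged_high ?(arc_lower_out s (Vhigh _))//; nlia.
Qed.

Lemma wound_spiral k s : (k == 0%N) || (P < k)%N ->
  wound k i s = spiral ((if k == 0%N then M%:R else k%:R) - P.+1%:R + s).
Proof.
move=> h; rewrite wound_i; case: eqP h => //= _ kP.
rewrite (_ : (k < P)%N = false); last by nlia.
by rewrite (_ : (k == P) = false)//; nlia.
Qed.

Lemma wound_spiral1 k s : (0 < k <= P.+1)%N ->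
  wound k i.+1 s = spiral (k%:R + M%:R - P.+1%:R + s).
Proof.
move=> h; rewrite wound_i1 (_ : (k == 0%N) = false); last by nlia.
by rewrite (_ : (k <= P.+1)%N)//; nlia.
Qed.

(** The hypothesis of [unwind_arc]: apart from the arc of sector [P.+1], everything lies at height
    at most 0 or outside the spiral. *)
Lemma unwound_free k q s : (k < M)%N -> 0 <= s <= 1 -> (k, q) != (P.+1, i) ->
  (unwound k q s).2 <= 0 \/ i.+2%:R <= (unwound k q s).1.
Proof.
move=> kM s01 kq; move: (s01) => /andP[s0 s1].
have pr a q' : (pressed a q' s).2 <= 0 :> R.
  by rewrite subr_le0; exact: arc_height_le.
case: (ltngtP q i) => [qi|iq|qE].
- by left; rewrite unwound_lt.
- right; rewrite -wound_unwound_out//.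
  have [[_ B2] _ _ _ _] := wound_facts kM s01.
  by rewrite wound_gt//; exact: B2.
- rewrite qE; have [kE|kl|kE|[kE|kE|kh]] := time_cases kM.
  + by left; rewrite unwound_i kE /= oppr_le0.
  + left; rewrite unwound_i (_ : (k == 0%N) = false); last by nlia.
    by rewrite (_ : (k < P)%N); [exact: pr|nlia].
  + left; rewrite unwound_i (_ : (k == 0%N) = false); last by nlia.
    by rewrite kE ltnn eqxx /= subr_le0.
  + by rewrite qE kE eqxx in kq.
  + right; rewrite -wound_unwound_edge ?kE ?leqnn ?orbT// wound_i1 /=.
    by rewrite ltnn eqxx.
  + right; rewrite -wound_unwound_edge; last by nlia.
    rewrite wound_i1 (_ : (k == 0%N) = false); last by nlia.
    rewrite (_ : (k <= P.+1)%N = false); last by nlia.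
    rewrite (_ : (k == P.+2) = false); last by nlia.
    exact: arc_above_out (Vhigh kh) (ltnSn i) s01.
Qed.

Let X : set E := place unwound Th @`
  [set a | sites M n a /\ (a.1.1, a.1.2) != (P.+1, i)].
Let r (x : R) := i.+1%:R + (i.+2%:R - i.+1%:R) * (x / L).
(** The unwound arc rises by [L] within one sector, of angle [2 * pi / M]; the additional turn of
    [old] makes it follow the clock sector by sector. *)
Let new (x : R) := Th P.+1%:R + 2 * pi / (M%:R * L) * x.
Let old (x : R) := new x + 2 * pi * (x / L).

Let r_spiral x : (r x, x) = spiral x.
Proof.
by rewrite /r /spiral -[i.+2%:R]natr1 [_ + 1]addrC addrK mul1r.
Qed.

Let old_steady x : old x = Th (P.+1%:R + x).
Proof.
rewrite /old /new /steady LE; field.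
by rewrite (gt_eqF M0) /= gt_eqF//; have := M0; lra.
Qed.

Lemma unwound_arcs : closed_picture M n unwound Th =
  X `|` [set cyl (r x, x) (new x) | x in [set x | 0 <= x <= L]].
Proof.
have arcE s : unwound P.+1 i s = (r (L * s), L * s).
  rewrite unwound_i /= (_ : (P.+1 < P)%N = false); last by nlia.
  rewrite (_ : (P.+1 == P) = false); last by nlia.
  by rewrite eqxx r_spiral /spiral mulrC mulfK ?gt_eqF.
have newE s : new (L * s) = Th (P.+1%:R + s).
  rewrite /new /steady LE; field.
  by rewrite (gt_eqF M0) /= gt_eqF//; have := M0; lra.
apply/seteqP; split=> p.
  move=> [[[k q] s] a <-]; have [e|ne] := eqVneq (k, q) (P.+1, i); last first.
    by left; exists (k, q, s).
  case: e => -> ->; right; exists (L * s).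
    by case: a => /= _ _ /andP[s0 s1]; rewrite mulr_ge0 ?(ltW L0)// ler_piMr// ltW.
  by rewrite -arcE newE.
move=> [[a [h _] <-]|[x /andP[x0 xL] <-]]; first by exists a.
have xE : x = L * (x / L) by rewrite mulrC divfK ?gt_eqF.
exists (P.+1, i, x / L).
  by split=> //=; [nlia|rewrite divr_ge0 ?(ltW L0)//= ler_pdivrMr ?mul1r].
by rewrite /place /= arcE /turn /= -newE -xE.
Qed.

(** The spiral is followed along position [i] to the end of sector 0, then along position [i.+1].
    Beyond time [M] its angle is read modulo a full turn. *)
Lemma wound_arcs : closed_picture M n.+1 wound Th =
  X `|` [set cyl (r x, x) (old x) | x in [set x | 0 <= x <= L]].
Proof.
have turnD u : Th (M%:R + u) = Th u + 2 * pi.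
  by rewrite /steady; field; rewrite gt_eqF.
have spiralE x : cyl (r x, x) (old x) = cyl (spiral x) (Th (P.+1%:R + x)).
  by rewrite r_spiral old_steady.
apply/seteqP; split=> p.
  move=> [[[k q] s] [/= kM qn s01] <-]; move: (s01) => /andP[s0 s1].
  rewrite /place /=; have p1 := P1R; have lE := LE.
  have inX q' : (q' < n)%N -> (k, q') != (P.+1, i) -> wound k q s = unwound k q' s ->
      (X `|` [set cyl (r x, x) (old x) | x in [set x | 0 <= x <= L]])
        (cyl (wound k q s) (Th (turn (k, q, s)))).
    by move=> q'n ne ->; left; exists (k, q', s) => //.
  case: (ltngtP q i) => [qi|iq|qE].
  + apply: (inX q); [nlia| |exact: wound_unwound_in].
    by rewrite xpair_eqE negb_and orbC ltn_eqF.
  + case: q iq qn inX => // q iq qn inX; rewrite ltnS in iq.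
    move: iq; rewrite leq_eqVlt => /predU1P[qE|iq]; last first.
      apply: (inX q); [nlia| |exact: wound_unwound_out].
      by rewrite xpair_eqE negb_and orbC gtn_eqF.
    rewrite -qE in inX *; have [h|h] := boolP ((k == 0%N) || (P.+2 <= k)%N).
      apply: (inX i) => //; last exact: wound_unwound_edge.
      by rewrite xpair_eqE negb_and; apply/orP; left; move: h; clear; lia.
    rewrite wound_spiral1; last by nlia.
    right; exists (k%:R + M%:R - P.+1%:R + s).
      have kP : k%:R <= P.+1%:R :> R by rewrite ler_nat; nlia.
      have k0 : 0 <= k%:R :> R by [].
      by apply/andP; split; lra.
    rewrite spiralE -(cylD2pi _ (Th (turn _))) -turnD /turn /=.
    by congr (cyl _ (Th _)); ring.
  + rewrite qE in inX *; have [h|h] := boolP ((k == 0%N) || (P < k)%N); last first.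
      apply: (inX i) => //; last by apply: wound_unwound_low; nlia.
      by rewrite xpair_eqE negb_and; apply/orP; left; nlia.
    rewrite wound_spiral//; right.
    set y := if k == 0%N then M%:R else k%:R.
    exists (y - P.+1%:R + s).
      have : P.+1%:R <= y <= M%:R.
        rewrite /y; move: h; case: eqP => [_ _|_ /= kP]; first by rewrite /= lexx andbT; lra.
        by rewrite !ler_nat kP ltnW.
      have pp : 0 <= P.+1%:R :> R by [].
      by move=> /andP[y0 y1]; apply/andP; split; lra.
    rewrite spiralE (_ : P.+1%:R + (y - P.+1%:R + s) = y + s); last by ring.
    rewrite /turn /y /=; case: eqP => [->|//].
    by rewrite turnD cylD2pi add0r.
move=> [[[[k q] s] [[/= kM qn s01] ne] <-]|[x /andP[x0 xL] <-]].
  case: (ltngtP q i) => [qi|iq|qE].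
  + exists (k, q, s); first by split=> //=; nlia.
    by rewrite /place /= wound_unwound_in.
  + exists (k, q.+1, s); first by split=> //=; nlia.
    by rewrite /place /= wound_unwound_out.
  + rewrite qE in ne *; have [h|h] := boolP ((k == 0%N) || (P.+2 <= k)%N).
      exists (k, i.+1, s); first by split=> //=; nlia.
      by rewrite /place /= wound_unwound_edge.
    exists (k, i, s); first by split=> //=; nlia.
    rewrite /place /= wound_unwound_low//.
    by move: ne; rewrite xpair_eqE eqxx andbT; nlia.
rewrite spiralE; have p1 := P1R; have lE := LE.
(* Three stretches of the spiral: position [i] up to the last sector, the crossing in sector 0, and
   position [i.+1] afterwards. *)
have [xM|xM] := leP (P.+1%:R + x) M%:R.
  have [||k [s [kl s01 e]]] := @real_split R (M - P.+1) x; first by nlia.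
    by rewrite x0 natrB ?(ltnW (ltnW PM))//; lra.
  have kE : (P.+1 + k)%:R = P.+1%:R + k%:R :> R by rewrite natrD.
  exists (P.+1 + k, i, s)%N; first by split=> //=; nlia.
  rewrite /place /turn /= wound_spiral /=; last by nlia.
  by rewrite kE; congr (cyl (spiral _) (Th _)); rewrite e; ring.
have [xM1|xM1] := leP (P.+1%:R + x) (M%:R + 1).
  exists (0%N, i, P.+1%:R + x - M%:R).
    by split=> //=; [nlia|nlia|apply/andP; split; lra].
  rewrite /place /turn /= wound_spiral//= -(cylD2pi _ (Th _)) -turnD.
  by congr (cyl (spiral _) (Th _)); ring.
have [||k [s [kl s01 e]]] := @real_split R P.+1 (P.+1%:R + x - M%:R - 1); first by [].
  by apply/andP; split; lra.
have kE : k.+1%:R = k%:R + 1 :> R by rewrite natr1.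
exists (k.+1, i.+1, s); first by split=> //=; nlia.
rewrite /place /turn /= wound_spiral1; last by nlia.
rewrite -(cylD2pi _ (Th _)) -turnD kE.
have -> : x = k%:R + s - P.+1%:R + M%:R + 1 by rewrite -e; ring.
by congr (cyl (spiral _) (Th _)); ring.
Qed.

Lemma merge_iso3 : iso3 (closed_picture M n.+1 (fun k q s => arc (V k) q s) Th)
  (closed_picture M n (fun k q s => arc (merged k) q s) Th).
Proof.
have M0' : (0 < M)%N by move: PM; clear; lia.
have cl := @steady_clock R M M0'.
have pic m W : (forall k, fits m (W k)) ->
    picture M m (fun k => swap (W k)) (fun k q s => arc (W k) q s : R * R).
  move=> Wm k q kM qm; have [a1 a2] := @lip1_arc R (W k) q; split=> //.
  - exact: swap_lt.
  - by rewrite arc1 arc0.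
  - exact: arc_ge1.
have h1 := picture_homotopy (pic _ _ Vn)
  wound_picture wound_order cl.
apply: iso3_trans h1 _; rewrite wound_arcs.
have h2 := picture_homotopy (pic _ _ merged_fits)
  unwound_picture unwound_order cl.
apply: iso3_trans _ (iso3_sym h2); rewrite unwound_arcs.
apply: unwind_arc => //; [by rewrite ltr_nat|].
move=> p [[[k q] s] [[/= kM qn s01] ne] <-].
have [h|h] := unwound_free kM s01 ne; [by left|right].
rewrite /place /cyl /= !exprMn -mulrDr cos2Dsin2 mulr1.
by rewrite ler_sqr ?nnegrE//; exact: le_trans h.
Qed.

End Merge.

(** * Destabilization and relations for closed words *)

Section MergeWords.
Variable R : realType.
Local Notation E := (R3 R).
Local Notation closure := (@closure R).
Local Notation closed_word := (@closed_word R).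
Implicit Types (w x y : seq letter) (i j k n : nat) (l : letter).

(** Renumbers the letters beyond a removed strand. It is applied to letters larger than some index,
    so the predecessor is never truncated. *)
Definition down l : letter := (l.1.-1, l.2).

Lemma closed_word_merge_pos i n w1 w2 : (i < n)%N ->
  all (fit n.+1) w1 -> all (fit n.+1) w2 ->
  all (fun l => l.1 < i)%N w1 -> all (fun l => i < l.1)%N w2 ->
  iso3 (closed_word n.+1 ((i, true) :: w1 ++ w2)) (closed_word n (w1 ++ map down w2)).
Proof.
move=> iLn n1 n2 h1 h2.
(* The three idle sectors that the spiral construction needs, inserted between the small and the
   large letters. *)
pose rest w : seq (option letter) := map Some w1 ++ [:: None; None; None] ++ map Some w.
pose v := Some (i, true) :: rest w2; pose v' := None :: rest (map down w2).
have sw : size (rest (map down w2)) = size (rest w2) by rewrite !size_cat !size_map.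
have sv : size v = (size w1 + 4 + size w2)%N by rewrite /= !size_cat !size_map /=; lia.
have pm w : pmap id (rest w) = w1 ++ w by rewrite !pmap_cat !map_SomeK.
have restE w k : nth None (rest w) k = if (k < size w1)%N then Some (nth (0%N, true) w1 k)
    else if (k < size w1 + 3)%N then None
    else nth None (map Some w) (k - size w1 - 3).
  rewrite /rest nth_cat size_map; case: ltnP => [kw|kw].
    by rewrite (nth_map (0%N, true)).
  rewrite nth_cat; have -> : (k - size w1 < 3)%N = (k < size w1 + 3)%N by lia.
  case: ifP => // _; have [h|h] := ltnP (k - size w1)%N 3; last by rewrite nth_default.
  by case: (k - size w1)%N h => [|[|[|]]].
have fit2 : all (fit n) (map down w2).
  apply/allP => l /mapP[l' l'w ->]; rewrite /fit /=.
  by have := allP n2 _ l'w; have := allP h2 _ l'w; rewrite /fit /=; lia.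
have fit1 : all (fit n) w1.
  by apply: sub_all h1 => l; rewrite /fit; move: iLn; clear; lia.
have fv : all (fits n.+1) v by rewrite /v /rest /= all_cat /= !fits_Some n1 n2 !andbT.
have fv' : all (fits n) v' by rewrite /v' /rest /= all_cat /= !fits_Some fit1 fit2.
have e1 := iso3_sym (@closure_erase R n.+1 v (fun e => ltac:(by [])) fv).
have e2 := @closure_erase R n v' (fun e => ltac:(by [])) fv'.
rewrite /= !pm in e1 e2; apply: iso3_trans e1 _; apply: iso3_trans _ e2.
pose V k := nth None v k.
have W0 : (0 < (size w1).+1)%N by [].
have WM : ((size w1).+3 < size v)%N by rewrite sv; lia.
have V0 : V 0 = Some (i, true) by [].
have Vlow k : (0 < k < (size w1).+1)%N -> below i (V k).
  case: k => // k /andP[_ kw]; rewrite /V /= restE ltnS in kw *; rewrite kw.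
  rewrite /below /=; have := all_nthP (0%N, true) h1 k kw.
  by case: (nth _ _ _).
have Vmid k : ((size w1).+1 <= k <= (size w1).+3)%N -> V k = None.
  case: k => // k /andP[wk kw]; rewrite /V /= restE ifF; last by lia.
  by rewrite ifT//; lia.
have Vhigh k : ((size w1).+3 < k)%N -> above i (V k).
  case: k => // k kw; rewrite /V /= restE !ifF; [|lia|lia].
  have [h|h] := ltnP (k - size w1 - 3) (size w2); last by rewrite nth_default ?size_map.
  rewrite (nth_map (0%N, true))// /above; have := all_nthP (0%N, true) h2 _ h.
  by case: (nth _ _ _).
have Vn k : fits n.+1 (V k).
  have [kv|kv] := ltnP k (size v); last by rewrite /V nth_default.
  exact: (all_nthP None fv).
have := merge_iso3 R iLn W0 WM V0 Vlow Vmid Vhigh Vn.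
rewrite /closure; congr iso3.
have -> : size v' = size v by rewrite /= sw.
rewrite /closed_picture; apply: eq_imagel => -[[k q] s] _; rewrite /place /movie /=.
suff -> : nth None v' k = merged (size w1).+1 V k by [].
case: k => // k; rewrite /merged /V /= !restE.
rewrite ltnS (_ : (k <= (size w1).+2)%N = (k < size w1 + 3)%N); last by lia.
case: ifP => // kw; first by rewrite (_ : (k < size w1 + 3)%N)//; lia.
case: ifP => // kw'; rewrite -map_comp.
set j := (k - size w1 - 3)%N.
have [h|h] := ltnP j (size w2); last by rewrite !nth_default ?size_map.
by rewrite !(nth_map (0%N, true))//=; case: (nth _ _ _).
Qed.

Lemma closed_word_merge i e n w1 w2 : (i < n)%N ->
  all (fit n.+1) w1 -> all (fit n.+1) w2 ->
  all (fun l => l.1 < i)%N w1 -> all (fun l => i < l.1)%N w2 ->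
  iso3 (closed_word n.+1 ((i, e) :: w1 ++ w2)) (closed_word n (w1 ++ map down w2)).
Proof.
case: e; first exact: closed_word_merge_pos.
move=> iLn n1 n2 h1 h2; apply: closed_word_unflip.
have -> : map flip (w1 ++ map down w2) = map flip w1 ++ map down (map flip w2).
  by rewrite map_cat -!map_comp.
by rewrite /= map_cat; apply: closed_word_merge_pos; rewrite ?all_map.
Qed.

(** The Markov move, read backwards from a merge in which the new generator is the largest one. *)
Lemma closed_word_stabilize n w : (0 < n)%N -> all (fit n) w ->
  iso3 (closed_word n w) (closed_word n.+1 ((n.-1, true) :: w)).
Proof.
case: n => // n _ wn; apply: iso3_sym.
have := @closed_word_merge n true n.+1 w [::] (ltnSn n); rewrite !cats0; apply=> //.
by apply: sub_all wn => l; rewrite /fit; lia.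
Qed.

(** Rotation brings the layered factor to the front, so it can be replaced inside any word. *)
Lemma closed_word_swap n x y v v' rank : all (fit n) x -> all (fit n) y ->
  all (fit n) v -> all (fit n) v' -> size v = size v' ->
  {in gtn n &, injective rank} -> layered rank (map Some v) -> layered rank (map Some v') ->
  (forall q, (q < n)%N ->
    trail (map Some v) (size v) q = trail (map Some v') (size v') q) ->
  iso3 (closed_word n (x ++ v ++ y)) (closed_word n (x ++ v' ++ y)).
Proof.
move=> xn yn vn v'n sv ri lv lv' tE.
have rot u : all (fit n) u -> iso3 (closed_word n (x ++ u ++ y)) (closed_word n (u ++ y ++ x)).
  by move=> un; rewrite [u ++ _ ++ _]catA; apply: closed_word_rot; rewrite ?all_cat ?un.
apply: iso3_trans (rot _ vn) _; apply: iso3_trans _ (iso3_sym (rot _ v'n)).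
have := @closed_word_layered R n (map Some v) (map Some v') rank (y ++ x).
by rewrite !map_SomeK !fits_Some !size_map all_cat yn xn; apply.
Qed.

Definition far j k := ((j.+1 < k) || (k.+1 < j))%N.

Lemma closed_word_commute n x y (a b : letter) : far a.1 b.1 -> all (fit n) (x ++ a :: b :: y) ->
  iso3 (closed_word n (x ++ a :: b :: y)) (closed_word n (x ++ b :: a :: y)).
Proof.
case: a b => [j e] [k f] /= jk; rewrite all_cat /= => /and4P[xn an bn yn].
have h1 : (j == k) = false by move: jk; rewrite /far; lia.
have h2 : (j == k.+1) = false by move: jk; rewrite /far; lia.
have h3 : (j.+1 == k) = false by move: jk; rewrite /far; lia.
have h4 : (k == j.+1) = false by rewrite eq_sym.
have h5 : (k.+1 == j) = false by rewrite eq_sym.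
have h6 : (k == j) = false by rewrite eq_sym.
have [g1 g2] : (j == j.+1) = false /\ (k == k.+1) = false by lia.
have [g3 g4] : (j.+1 == j) = false /\ (k.+1 == k) = false by lia.
(* The two letters act on disjoint pairs of positions, so composing their rankings layers both
   words. *)
apply: (@closed_word_swap n x y [:: (j, e); (k, f)] [:: (k, f); (j, e)]
  (ranking (Some (j, e)) \o ranking (Some (k, f)))) => //; rewrite ?[all _ [:: _;
    _]]/= ?an ?bn //.
- by apply: in2W; apply: inj_comp; exact: ranking_inj.
- by case: e f {an bn} => [] [];
    rewrite /= ?eqxx ?eqSS ?(h1, h2, h3, h4, h5, h6, g1, g2, g3, g4) /=
      ?eqxx ?eqSS ?(h1, h2, h3, h4, h5, h6, g1, g2, g3, g4) /=
      ?eqxx ?eqSS ?(h1, h2, h3, h4, h5, h6, g1, g2, g3, g4) ?ltnSn.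
- by case: e f {an bn} => [] [];
    rewrite /= ?eqxx ?eqSS ?(h1, h2, h3, h4, h5, h6, g1, g2, g3, g4) /=
      ?eqxx ?eqSS ?(h1, h2, h3, h4, h5, h6, g1, g2, g3, g4) /=
      ?eqxx ?eqSS ?(h1, h2, h3, h4, h5, h6, g1, g2, g3, g4) ?ltnSn.
- move=> q _; rewrite -[LHS]/(swap (Some (k, f)) (swap (Some (j, e)) q)).
  rewrite -[RHS]/(swap (Some (j, e)) (swap (Some (k, f)) q)).
  have id m g p : p != m -> p != m.+1 -> swap (Some (m, g)) p = p.
    by rewrite /= => /negbTE-> /negbTE->.
  have kj : swap (Some (k, f)) j = j by rewrite id ?h1 ?h2.
  have kj1 : swap (Some (k, f)) j.+1 = j.+1 by rewrite id ?h3 // eqSS h1.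
  have sj : swap (Some (j, e)) j = j.+1 by rewrite /= eqxx.
  have sj1 : swap (Some (j, e)) j.+1 = j by rewrite /= g3 eqxx.
  have [->|qj] := eqVneq q j; first by rewrite kj sj kj1.
  have [->|qj1] := eqVneq q j.+1; first by rewrite kj1 sj1 kj.
  rewrite (id j e q)// (id j e (swap _ q))//.
    by apply/eqP => h; case/eqP: qj; apply: (can_inj (swapK (Some (k, f)))); rewrite h kj.
  by apply/eqP => h; case/eqP: qj1; apply: (can_inj (swapK (Some (k, f)))); rewrite h kj1.
Qed.

Lemma closed_word_move n x y t l : all (fun k : letter => far l.1 k.1) t ->
  all (fit n) (x ++ l :: t ++ y) ->
  iso3 (closed_word n (x ++ l :: t ++ y)) (closed_word n (x ++ t ++ l :: y)).
Proof.
elim: t x => [|k t IH] x /=; first by move=> _ _; exact: iso3_refl.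
move=> /andP[lk lt] fx; apply: iso3_trans (closed_word_commute lk fx) _.
rewrite -!(cat_rcons k); apply: IH => //; move: fx.
by rewrite !all_cat all_rcons /= all_cat => /and5P[-> -> -> -> ->].
Qed.

(** A letter smaller than [i] and a letter larger than [i] have indices that differ by at least 2,
    so they commute. *)
Lemma closed_word_sort n i x u : all (fun l => l.1 != i) u -> all (fit n) (x ++ u) ->
  iso3 (closed_word n (x ++ u))
    (closed_word n (x ++ [seq l <- u | (l.1 < i)%N] ++ [seq l <- u | (i < l.1)%N])).
Proof.
elim: u x => [|l u IH] x; first by rewrite /= !cats0 => _ _; exact: iso3_refl.
move=> /= /andP[li ui] fx; rewrite -cat_rcons in fx *.
apply: iso3_trans (IH _ ui fx) _; move: li; rewrite cat_rcons neq_ltn.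
case: ltngtP => // il _; first exact: iso3_refl.
apply: closed_word_move.
  apply/allP => k; rewrite mem_filter /far => /andP[ki _]; lia.
apply/allP => k kin; apply: (allP fx); move: kin.
rewrite cat_rcons !(mem_cat, in_cons, mem_filter).
by case/or4P => [->|->|/andP[_ ->]|/andP[_ ->]]; rewrite ?orbT.
Qed.

(** The letter is rotated to the front, the others are sorted around [i], and the two strands are
    merged. *)
Theorem closed_word_once n i e x y : (i < n)%N -> all (fit n.+1) (x ++ y) ->
  all (fun l => l.1 != i) (x ++ y) ->
  iso3 (closed_word n.+1 (x ++ (i, e) :: y))
    (closed_word n ([seq l <- y ++ x | (l.1 < i)%N] ++
                    map down [seq l <- y ++ x | (i < l.1)%N])).
Proof.
move=> iLn fxy ixy.
have fyx : all (fit n.+1) (y ++ x) by rewrite all_cat andbC -all_cat.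
have iyx : all (fun l : letter => l.1 != i) (y ++ x) by rewrite all_cat andbC -all_cat.
have fi : fit n.+1 (i, e) by [].
apply: iso3_trans (@closed_word_rot R n.+1 x ((i, e) :: y) _ _) _.
- by move: fxy; rewrite all_cat => /andP[].
- by move: fxy; rewrite all_cat /= fi => /andP[].
have := @closed_word_sort n.+1 i [:: (i, e)] (y ++ x) iyx.
rewrite /= fi fyx => /(_ isT) h; apply: iso3_trans h _.
apply: closed_word_merge => //; try exact: filter_all.
- by apply/allP => l; rewrite mem_filter => /andP[_ /(allP fyx)].
- by apply/allP => l; rewrite mem_filter => /andP[_ /(allP fyx)].
Qed.

End MergeWords.
(** * Braids of the unknot, the trefoil and the figure eight knot *)

Section Unknot.
Variable R : realType.
Local Notation E := (R3 R).

(** Cuts a parametrized knot into unit pieces, to be matched with the sites of a picture. *)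
Lemma periodic_split (f : R -> E) (m : nat) (u : R) : (0 < m)%N ->
  (forall v, f (v + m%:R) = f v) ->
  exists k s, [/\ (k < m)%N, 0 <= s <= 1 & f u = f (k%:R + s)].
Proof.
move=> m0 fper; have m0R : 0 < m%:R :> R by rewrite ltr0n.
have pos (j : nat) v : f (v + j%:R * m%:R) = f v.
  elim: j => [|j IH]; first by rewrite mul0r addr0.
  by rewrite -natr1 mulrDl mul1r addrA fper.
have shift (z : int) v : f (v + z%:~R * m%:R) = f v.
  case: z => j; first exact: pos.
  by have := pos j.+1 (v - j.+1%:R * m%:R); rewrite NegzE mulrNz mulNr subrK => ->.
pose z := Num.floor (u / m%:R).
have [z0 z1] : z%:~R <= u / m%:R /\ u / m%:R <= z%:~R + 1.
  have := floor_le_tmp (u / m%:R); have := floorD1_gt (u / m%:R).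
  by rewrite intrD -/z => h1 h2; split=> //; exact: ltW.
have [|k [s [km s01 e]]] := @real_split R m (u - z%:~R * m%:R) m0.
  move: z0 z1; rewrite ler_pdivlMr// ler_pdivrMr// mulrDl mul1r => z0 z1.
  by apply/andP; split; lra.
exists k, s; split=> //; rewrite -e -[RHS](shift z); congr f; ring.
Qed.

Lemma unknot_closed_word : @unknot R = Some @` @closed_word R 1 [::].
Proof.
pose f (u : R) : E := (cos (2 * pi * u), sin (2 * pi * u), 0).
have fper v : f (v + 1%:R) = f v.
  by rewrite /f mulrDr mulr1 cosD2pi sinD2pi.
apply/seteqP; split.
  move=> _ [t _ <-]; exists (cos t, sin t, 0) => //.
  have p0 : 2 * pi != 0 :> R by rewrite mulf_neq0 ?gt_eqF ?pi_gt0.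
  have te : t = 2 * pi * (t / (2 * pi)) by rewrite mulrC divfK.
  have [k [s [k0 s01 e]]] := @periodic_split f 1 (t / (2 * pi)) isT fper.
  exists (0%N, 0%N, s) => //; rewrite /place /movie /= /cyl /turn /steady /=.
  have {k0}k0 : k = 0%N by case: k k0 {e}.
  rewrite {k}k0 in e; rewrite !mul1r divr1 -/(f (0%:R + s)) -e /f -te.
  by [].
move=> _ [_ [[[k q] s] [/= k1 q1 s01] <-] <-].
have {k1}-> : k = 0%N by case: k k1.
have {q1}-> : q = 0%N by case: q q1.
exists (2 * pi * s) => //=; rewrite /place /movie /cyl /turn /steady /=.
by rewrite !mul1r divr1 add0r.
Qed.

End Unknot.

Section Trefoil.
Variable R : realType.
Local Notation E := (R3 R).
Variable e : bool.

Let word : seq (option letter) := nseq 3 (Some (0%N, e)).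
(** The torus knot itself: in each of the three sectors [3 * t] grows by [pi], so the two strands
    make half a turn around the core circle of radius 2 and exchange places. *)
Let G (k q : nat) (s : R) : R * R :=
  (2 + (-1) ^+ (q == 0%N) * cos (pi * s), (-1) ^+ e * ((-1) ^+ (q == 0%N) * sin (pi * s))).

(** Both in the elementary braid and on the torus, the radial order of the two strands changes at
    time [1 / 2] only. *)
Lemma cos_half_sign (s : R) : 0 <= s <= 1 -> s != 1 / 2 -> 0 < (1 - 2 * s) * cos (pi * s).
Proof.
move=> /andP[s0 s1] s2; have p0 := pi_gt0 R.
have cosE : cos (pi * s) = sin (pi * (1 / 2 - s)).
  have -> : pi * (1 / 2 - s) = pi / 2 - pi * s by field.
  by rewrite sinB sin_pihalf cos_pihalf mul1r mul0r subr0.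
have sin_pos x : 0 < x -> x <= 1 / 2 -> 0 < sin (pi * x) :> R.
  by move=> x0 x1; apply: sin_gt0_pi; rewrite mulr_gt0//= gtr_pMr//; lra.
move: s2; rewrite neq_lt cosE => /orP[h|h].
  by apply: mulr_gt0; [lra|apply: sin_pos; lra].
have -> : pi * (1 / 2 - s) = - (pi * (s - 1 / 2)) by ring.
rewrite sinN mulrN -mulNr.
by apply: mulr_gt0; [lra|apply: sin_pos; lra].
Qed.

Lemma trefoil_picture : picture 3 2 (fun k => swap (nth None word k)) G.
Proof.
have lc x := @lip1_cst R x; have li := @lip1_id R.
have lp : lip1 (fun s : R => pi * s) by exact: lip1M.
move=> k q k3 q2; have wE : nth None word k = Some (0%N, e) by rewrite nth_nseq k3.
split.
- by rewrite wE; exact: swap_lt.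
- rewrite /G wE mulr1 mulr0 cospi sinpi cos0 sin0.
  by case: q q2 => [|[|]]//= _; congr pair; rewrite ?expr0 ?expr1 ?mulr0//; ring.
- by apply: lip1D => //; apply: lip1M => //; exact: lip1_cos.
- by apply: lip1M => //; apply: lip1M => //; exact: lip1_sin.
move=> s _ /=; have := cos_le1 (pi * s); have := cos_geN1 (pi * s).
by case: eqP => _; rewrite ?expr0 ?expr1; lra.
Qed.

Lemma trefoil_order : same_order 3 2 (movie word) G.
Proof.
move=> k q q' s k3 q2 q'2 qq' s01.
wlog qlt : q q' qq' q2 q'2 / (q < q')%N => [H|].
  case: (ltngtP q q') qq' => // [lt _|lt _]; first by apply: H => //; lia.
  have := H q' q ltac:(lia) q'2 q2 lt.
  by case=> [h|h]; [left|right]; rewrite /= -mulrNN !opprB.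
have -> : q = 0%N by lia.
have -> : q' = 1%N by lia.
rewrite /movie nth_nseq k3 /G /= !expr0 !expr1.
have [->|s2] := eqVneq s (1 / 2).
  right; have -> : pi * (1 / 2) = pi / 2 :> R by rewrite mul1r.
  rewrite sin_pihalf !mulr1.
  by case: e; rewrite /= !expr0 !expr1; lra.
left; have := cos_half_sign s01 s2; set c := cos _; move=> h.
have -> : (1 + s - (2 - s)) * (2 + -1 * c - (2 + 1 * c)) = 2 * ((1 - 2 * s) * c) by ring.
by rewrite mulr_gt0.
Qed.

Lemma trefoil_closed_word : exists2 K, @trefoil R e = Some @` K &
  iso3 (@closed_word R 2 (nseq 3 (0%N, e))) K.
Proof.
exists (closed_picture 3 2 G (steady 3)); last first.
  apply: iso3_trans (iso3_sym (@closed_word_closure R 2 (nseq 3 (0%N, e)) _ _)) _ => //.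
  have N0 : (0 < 3)%N by [].
  apply: picture_homotopy (@movie_picture R 2 word _) trefoil_picture trefoil_order
    (@steady_clock R 3 N0).
  by [].
pose f (u : R) : E :=
  cyl (2 + cos (pi * u), (-1) ^+ e * sin (pi * u)) (2 * pi * (u / 3)).
have turnE (v : R) : 2 * pi * ((v + 3) / 3) = 2 * pi * (v / 3) + 2 * pi by field.
have flipE (v : R) : cos (pi * (v + 1)) = - cos (pi * v) /\ sin (pi * (v + 1)) = - sin (pi * v).
  by rewrite mulrDr mulr1 cosDpi sinDpi.
have alt (k : nat) s : cos (pi * (k%:R + s)) = (-1) ^+ odd k * cos (pi * s) /\
    sin (pi * (k%:R + s)) = (-1) ^+ odd k * sin (pi * s) :> R.
  elim: k => [|k [h1 h2]]; first by rewrite add0r !mul1r.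
  have [f1 f2] := flipE (k%:R + s); rewrite -natr1 -addrA [1 + s]addrC addrA f1 f2 h1 h2 /=.
  by case: (odd k); rewrite !expr0 !expr1; split; ring.
have fE (k : nat) s : f (k%:R + s) =
    cyl (2 + (-1) ^+ odd k * cos (pi * s), (-1) ^+ e * ((-1) ^+ odd k * sin (pi * s)))
        (2 * pi * ((k%:R + s) / 3)).
  by rewrite /f; have [-> ->] := alt k s.
have f3 (k : nat) (s : R) : 2 * pi * (((k + 3)%:R + s) / 3) = 2 * pi * ((k%:R + s) / 3) + 2 * pi.
  by rewrite natrD; field.
have fper v : f (v + 6%:R) = f v.
  rewrite /f (_ : v + 6%:R = v + 3 + 3); last by ring.
  rewrite !turnE !cylD2pi; congr (cyl (_, _) _).
    have := alt 6%N v; rewrite /= expr0 !mul1r => -[<- _]; congr (2 + cos (_ * _)); ring.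
  have := alt 6%N v; rewrite /= expr0 !mul1r => -[_ <-]; congr (_ * sin (_ * _)); ring.
apply/seteqP; split.
  move=> _ [t _ <-]; have p0 : pi != 0 :> R by rewrite gt_eqF ?pi_gt0.
  rewrite (_ : Some _ = Some (f (3 * t / pi)) :> S3 R); last first.
    have e1 : pi * (3 * t / pi) = 3 * t by rewrite mulrC divfK.
    have e2 : 2 * pi * (3 * t / pi / 3) = 2 * t.
      rewrite [LHS](_ : _ = 2 * (pi * (3 * t / pi)) / 3); first by rewrite e1; field.
      by rewrite !mulrA.
    by rewrite /f /cyl e1 e2.
  have [k [s [k6 s01 ->]]] := @periodic_split R f 6 (3 * t / pi) isT fper.
  exists (f (k%:R + s)) => //.
  (* At even multiples of [pi] the curve is at its outer radius, in position 1. *)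
  exists ((k %% 3)%N, (~~ odd k) : nat, s).
    by split=> //=; [rewrite ltn_mod|case: (odd k)].
  rewrite /place /turn /steady /= fE /G.
  have -> : (~~ odd k == 0%N :> nat) = odd k by case: (odd k).
  have [k3|k3] := ltnP k 3; first by rewrite modn_small.
  have kE : (k - 3 + 3)%N = k by rewrite subnK.
  have -> : (k %% 3)%N = (k - 3)%N by move: k6 k3; clear; lia.
  by have := f3 (k - 3)%N s; rewrite kE => ->; rewrite cylD2pi.
move=> _ [_ [[[k q] s] [/= k3 q2 s01] <-] <-].
(* Sectors [k] and [k + 3] of the knot lie over the same sector of the braid; their parity tells the
   position. *)
have [K KE KF] : exists2 K, odd K = (q == 0%N) &
    cyl (G k q s) (steady 3 (k%:R + s)) = f (K%:R + s).
  have [ok|ok] := eqVneq (odd k) (q == 0%N).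
    by exists k => //; rewrite fE /G ok.
  exists (k + 3)%N; first by rewrite oddD addbT; case: (odd k) (q == 0%N) ok => [] [].
  rewrite fE /G /steady f3 cylD2pi oddD addbT.
  by case: (odd k) (q == 0%N) ok => [] [].
exists (pi * (K%:R + s) / 3) => //=; rewrite /place /turn /= KF /f /cyl /=.
have -> : 3 * (pi * (K%:R + s) / 3) = pi * (K%:R + s) :> R by field.
by have -> : 2 * (pi * (K%:R + s) / 3) = 2 * pi * ((K%:R + s) / 3) :> R by field.
Qed.

End Trefoil.

Section FigureEight.
Variable R : realType.
Local Notation E := (R3 R).

Let word : seq (option letter) :=
  [:: Some (0%N, true); Some (1%N, false); Some (0%N, true); Some (1%N, false)].
Let third (v : R) := pi / 3 * v.
(** The motion of the knot in the half-plane of radius and height, with [third v] for [2 * t]: it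
    repeats after 6 units, the rotation around the axis after 4. *)
Let g (v : R) : R * R := (2 + cos (third v), 2 * (sin (third v) * cos (third v))).
(* In units of a third of [pi], the strand in position [q] of the sector [k] starts
   with the longitude [phase k q - 1 / 2] on the generating closed curve [g]. *)
Let phase (k q : nat) : nat := nth 0%N (if odd k then [:: 3; 5; 1] else [:: 4; 2; 0])%N q.
Let G (k q : nat) (s : R) : R * R := g ((phase k q)%:R + (s - 1 / 2)).
(** This is [3 * t]. The shift by one half puts the crossings in the middle of the sectors. *)
Let Th (u : R) := pi / 2 * (u - 1 / 2).

Let r : R := sin (third 1).

Lemma cos_third : cos (third 1) = 1 / 2.
Proof.
have p0 := pi_gt0 R; have c0 : 0 < cos (third 1).
  by apply: cos_gt0_pihalf; rewrite /third mulr1; apply/andP; split; lra.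
(* The double of the angle is its supplement, so its cosine is a root of [(2 * c - 1) * (c + 1)]. *)
have e : third 1 *+ 2 = - third 1 + pi by rewrite /third; field.
have := cos_mulr2n (third 1); rewrite e cosDpi cosN => h.
have : (2 * cos (third 1) - 1) * (cos (third 1) + 1) = 0 by move: h; rewrite -mulr_natl expr2;
  lra.
by move/eqP; rewrite mulf_eq0 => /orP[|] /eqP; lra.
Qed.

Lemma sin_third : 0 < r /\ r * r = 3 / 4.
Proof.
have p0 := pi_gt0 R; split.
  by apply: sin_gt0_pi; rewrite /third mulr1; apply/andP; split; lra.
by rewrite -expr2 /r sin2cos2 cos_third expr2; field.
Qed.

Lemma third_step (v : R) :
  cos (third (v + 1)) = cos (third v) / 2 - sin (third v) * r /\
  sin (third (v + 1)) = sin (third v) / 2 + cos (third v) * r.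
Proof.
have -> : third (v + 1) = third v + third 1 by rewrite /third mulrDr.
by rewrite cosD sinD cos_third /r !mul1r.
Qed.

Lemma third_values (x : R) : let c := cos (third x) in let d := sin (third x) in
  [/\ cos (third (0%:R + x)) = c /\ sin (third (0%:R + x)) = d,
      cos (third (1%:R + x)) = c / 2 - d * r /\ sin (third (1%:R + x)) = d / 2 + c * r,
      cos (third (2%:R + x)) = - c / 2 - d * r /\ sin (third (2%:R + x)) = - d / 2 + c * r,
      cos (third (3%:R + x)) = - c /\ sin (third (3%:R + x)) = - d
    & (cos (third (4%:R + x)) = - c / 2 + d * r /\ sin (third (4%:R + x)) = - d / 2 - c * r) /\
      (cos (third (5%:R + x)) = c / 2 + d * r /\ sin (third (5%:R + x)) = d / 2 - c * r)].
Proof.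
move=> c d; have [r0 r2] := sin_third.
have st (k : nat) : k.+1%:R + x = k%:R + x + 1 by rewrite -natr1 addrAC.
have a0 : cos (third (0%:R + x)) = c /\ sin (third (0%:R + x)) = d by rewrite add0r.
have a1 : cos (third (1%:R + x)) = c / 2 - d * r /\ sin (third (1%:R + x)) = d / 2 + c * r.
  by rewrite (st 0%N); have [-> ->] := third_step (0%:R + x); case: a0 => -> ->.
have a2 : cos (third (2%:R + x)) = - c / 2 - d * r /\ sin (third (2%:R + x)) = - d / 2 + c * r.
  rewrite (st 1%N); have [-> ->] := third_step (1%:R + x); case: a1 => -> ->.
  rewrite !mulrDl !mulNr -!mulrA; split.
    by rewrite r2; field.
  by rewrite r2; field.
have a3 : cos (third (3%:R + x)) = - c /\ sin (third (3%:R + x)) = - d.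
  rewrite (st 2%N); have [-> ->] := third_step (2%:R + x); case: a2 => -> ->.
  by rewrite !mulrDl !mulNr -!mulrA r2; split; field.
have a4 : cos (third (4%:R + x)) = - c / 2 + d * r /\ sin (third (4%:R + x)) = - d / 2 - c * r.
  rewrite (st 3%N); have [-> ->] := third_step (3%:R + x); case: a3 => -> ->.
  by split; ring.
split=> //; split=> //.
rewrite (st 4%N); have [-> ->] := third_step (4%:R + x); case: a4 => -> ->.
by rewrite !mulrDl !mulNr -!mulrA r2; split; field.
Qed.

Lemma third6 (v : R) : cos (third (v + 6%:R)) = cos (third v) /\ sin (third
  (v + 6%:R)) = sin (third v).
Proof.
have -> : third (v + 6%:R) = third v + 2 * pi by rewrite /third; field.
by rewrite cosD2pi sinD2pi.
Qed.

Lemma g6 (v : R) : g (v + 6%:R) = g v.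
Proof. by rewrite /g; have [-> ->] := third6 v. Qed.

Lemma eight_picture : picture 4 3 (fun k => swap (nth None word k)) G.
Proof.
have lc x := @lip1_cst R x; have li := @lip1_id R.
have lp (k q : nat) : lip1 (fun s : R => third ((phase k q)%:R + (s - 1 / 2))).
  by apply: lip1M => //; apply: lip1D => //; exact: lip1B.
move=> k q k4 q3; split.
- by case: k k4 => [|[|[|[|]]]]//= _; case: q q3 => [|[|[|]]].
- have up (a : nat) : g (a%:R + (1 - 1 / 2)) = g (a.+1%:R + (0 - 1 / 2)).
    by congr g; rewrite -natr1; ring.
  have wrap : g (5%:R + (1 - 1 / 2)) = g (0%:R + (0 - 1 / 2)).
    by rewrite -[RHS]g6; congr g; ring.
  by case: k k4 => [|[|[|[|]]]]//= _; case: q q3 => [|[|[|]]]//= _;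
    rewrite /G /phase /= ?wrap ?up.
- by apply: lip1D => //; exact: lip1_cos.
- by apply: lip1M => //; apply: lip1M; [exact: lip1_sin|exact: lip1_cos].
- by move=> s _ /=; have := cos_geN1 (third ((phase k q)%:R + (s - 1 / 2))); lra.
Qed.

(** The angle stays within a sixth of [pi] of 0, so the cosine dominates the sine; this keeps apart
    the strands that do not cross. The last clause describes the pair that crosses at time
    [1 / 2]. *)
Lemma third_small (s : R) : 0 <= s <= 1 ->
  let c := cos (third (s - 1 / 2)) in let d := sin (third (s - 1 / 2)) in
  [/\ 0 < 3 / 2 * c - d * r, 0 < 3 / 2 * c + d * r &
      (s = 1 / 2 /\ c = 1 /\ d = 0) \/ 0 < (2 * s - 1) * (d * r)].
Proof.
move=> /andP[s0 s1] c d; have [r0 r2] := sin_third; have p0 := pi_gt0 R.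
have small (x : R) : -1 <= x <= 1 -> - (pi / 2) < third x < pi / 2.
  move=> /andP[x0 x1]; rewrite /third.
  have h1 : pi * x <= pi * 1 by rewrite ler_pM2l.
  have h2 : pi * (-1) <= pi * x by rewrite ler_pM2l.
  by apply/andP; split; lra.
have c0 : 0 < c by apply/cos_gt0_pihalf/small; apply/andP; split; lra.
have cd : 0 < c ^+ 2 - d ^+ 2.
  have -> : c ^+ 2 - d ^+ 2 = cos (third (2 * (s - 1 / 2))).
    have -> : third (2 * (s - 1 / 2)) = third (s - 1 / 2) + third (s - 1 / 2).
      by rewrite /third; ring.
    by rewrite cosD !expr2.
  by apply/cos_gt0_pihalf/small; apply/andP; split; lra.
have drc : `|d * r| < 3 / 2 * c.
  have c1 : 0 <= 3 / 2 * c by rewrite mulr_ge0// ltW.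
  rewrite -ltr_sqr ?nnegrE// real_normK ?num_real// !exprMn [r ^+ 2]expr2 r2.
  have := sqr_ge0 c; move: cd; rewrite expr2; lra.
move: drc; rewrite ltr_norml => /andP[h1 h2].
split; [lra|lra|].
have [sE|sE] := eqVneq s (1 / 2).
  by left; rewrite /c /d sE subrr /third mulr0 cos0 sin0.
right; have sin_pos x : 0 < x -> x <= 1 -> 0 < sin (third x) :> R.
  move=> x0 x1; apply: sin_gt0_pi; have /andP[_ h] := small x ltac:(apply/andP; split; lra).
  by apply/andP; split; [rewrite /third mulr_gt0// divr_gt0|lra].
rewrite mulrA; apply: mulr_gt0 => //.
move: sE; rewrite neq_lt => /orP[h|h].
  have -> : d = - sin (third (1 / 2 - s)).
    by rewrite /d -sinN; congr sin; rewrite /third; ring.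
  by rewrite mulrN -mulNr; apply: mulr_gt0; [lra|apply: sin_pos; lra].
by apply: mulr_gt0; [lra|apply: sin_pos; lra].
Qed.

Lemma eight_order : same_order 4 3 (movie word) G.
Proof.
move=> k q q' s k4 q3 q'3 qq' s01.
wlog qlt : q q' qq' q3 q'3 / (q < q')%N => [H|].
  case: (ltngtP q q') qq' => // [lt _|lt _]; first by apply: H => //; lia.
  have := H q' q ltac:(lia) q'3 q3 lt.
  by case=> [h|h]; [left|right]; rewrite /= -mulrNN !opprB.
have [r0 r2] := sin_third; move: (s01) => /andP[s0 s1].
have [c1 c2 c3] := third_small s01.
have [v0 v1 v2 v3 [v4 v5]] := third_values (s - 1 / 2).
have neg (a b : R) : a < 0 -> b < 0 -> 0 < a * b by move=> *; rewrite nmulr_rgt0.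
have cases : [\/ q = 0%N /\ q' = 1%N, q = 0%N /\ q' = 2%N | q = 1%N /\ q' = 2%N].
  case: q q3 qlt {qq'} => [|[|[|]]]// _; case: q' q'3 => [|[|[|]]]// _ _.
  - exact: Or31.
  - exact: Or32.
  - exact: Or33.
set c := cos _ in c1 c2 c3 v0 v1 v2 v3 v4 v5.
set d := sin _ in c1 c2 c3 v0 v1 v2 v3 v4 v5.
case: v0 v1 v2 v3 v4 v5 => [v0 w0] [v1 w1] [v2 w2] [v3 w3] [v4 w4] [v5 w5].
have [ok|ok] := boolP (odd k).
  have wE : nth None word k = Some (1%N, false).
    by case: k k4 ok => [|[|[|[|]]]].
  rewrite /movie wE /G /phase ok /g.
  case: cases => -[-> ->]; rewrite /= ?expr1.
  - left; rewrite v3 v5; apply: neg; lra.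
  - left; rewrite v3 v1; apply: neg; lra.
  rewrite v5 w5 v1 w1; case: c3 => [[-> [-> ->]]|h].
    by right; apply: neg; lra.
  left; set x := (_ * _); have -> : x = 2 * ((2 * s - 1) * (d * r)) by rewrite /x; field.
  by rewrite mulr_gt0.
have wE : nth None word k = Some (0%N, true).
  by case: k k4 ok => [|[|[|[|]]]].
rewrite /movie wE /G /phase (negbTE ok) /g.
case: cases => -[-> ->]; rewrite /= ?expr0.
- rewrite v4 w4 v2 w2; case: c3 => [[-> [-> ->]]|h].
    by right; apply: mulr_gt0; lra.
  left; set x := (_ * _); have -> : x = 2 * ((2 * s - 1) * (d * r)) by rewrite /x; field.
  by rewrite mulr_gt0.
- by left; rewrite v4 v0; apply: neg; lra.
- by left; rewrite v2 v0; apply: neg; lra.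
Qed.

Lemma eight_clock : clock 4 Th (pi / 2) (pi / 2).
Proof.
split; first by rewrite divr_gt0 ?pi_gt0.
  by rewrite /Th; field.
move=> u v _ _ _; rewrite (_ : Th v - Th u = pi / 2 * (v - u)) ?lexx//.
by rewrite /Th; ring.
Qed.

Lemma figure_eight_closed_word : exists2 K, @figure_eight R = Some @` K &
  iso3 (@closed_word R 3 [:: (0%N, true); (1%N, false); (0%N, true); (1%N, false)]) K.
Proof.
exists (closed_picture 4 3 G Th); last first.
  apply: iso3_trans (iso3_sym (@closed_word_closure R 3
    [:: (0%N, true); (1%N, false); (0%N, true); (1%N, false)] _ _)) _ => //.
  have N0 : (0 < 4)%N by [].
  have wp := @movie_picture R 3 word isT.
  apply: iso3_trans (clock_change wp (@movie_embedded R 3 word)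
    (@steady_clock R 4 N0) eight_clock) _.
  exact: picture_homotopy wp eight_picture eight_order eight_clock.
pose f (u : R) : E := cyl (g (u - 1 / 2)) (Th u).
have ThD (u : R) : Th (u + 4%:R) = Th u + 2 * pi by rewrite /Th; field.
have fper v : f (v + 12%:R) = f v.
  have gE : g (v + 12%:R - 1 / 2) = g (v - 1 / 2).
    by rewrite -[RHS]g6 -[RHS]g6; congr g; ring.
  rewrite /f gE (_ : v + 12%:R = v + 4%:R + 4%:R + 4%:R); last by ring.
  by rewrite !ThD !cylD2pi.
(* The list inverts [phase]: it gives the position of the curve in its sector [a], whose parity is
   the same modulo 4 and modulo 6. *)
have fE (a : nat) s : f (a%:R + s) = cyl (G (a %% 4) (nth 0%N [:: 2; 2; 1; 0; 0; 1]%N (a %% 6)) s)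
    (Th ((a %% 4)%:R + s)).
  have red4 (b : nat) : cyl (g (a%:R + s - 1 / 2)) (Th (b%:R + s)) =
      cyl (g (a%:R + s - 1 / 2)) (Th ((b %% 4)%:R + s)).
    rewrite {1}(divn_eq b 4); elim: (b %/ 4)%N => [|j IH]; first by rewrite mul0n add0n.
    by rewrite -IH mulSn -[RHS]cylD2pi -ThD -addnA natrD; congr (cyl _ (Th _)); ring.
  have red6 (b : nat) : g (b%:R + s - 1 / 2) = g ((b %% 6)%:R + (s - 1 / 2)).
    rewrite {1}(divn_eq b 6); elim: (b %/ 6)%N => [|j IH]; first by rewrite mul0n add0n addrA.
    by rewrite -IH mulSn -[RHS]g6 -addnA natrD; congr g; ring.
  rewrite /f red4 red6 /G; congr (cyl (g (_%:R + _)) _); rewrite /phase.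
  have -> : odd (a %% 4) = odd (a %% 6).
    by rewrite !odd_mod.
  have : (a %% 6 < 6)%N by rewrite ltn_mod.
  by case: (a %% 6)%N => [|[|[|[|[|[|]]]]]].
have dbl (t : R) : sin (4 * t) = 2 * (sin (2 * t) * cos (2 * t)).
  rewrite (_ : 4 * t = (2 * t) *+ 2) ?sin_mulr2n; last by ring.
  by rewrite -mulr_natl [cos _ * _]mulrC.
apply/seteqP; split.
  move=> _ [t _ <-]; have p0 : pi != 0 :> R by rewrite gt_eqF ?pi_gt0.
  pose u : R := t * 6 / pi + 1 / 2.
  have uE : pi * (u - 1 / 2) = t * 6 by rewrite /u addrK mulrC divfK.
  have e1 : third (u - 1 / 2) = 2 * t by rewrite /third mulrAC uE; field.
  have e2 : Th u = 3 * t by rewrite /Th mulrAC uE; field.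
  rewrite (_ : Some _ = Some (f u) :> S3 R); last by rewrite /f /cyl /g e1 e2 dbl.
  have [k [s [k12 s01 ->]]] := @periodic_split R f 12 u isT fper.
  exists (f (k%:R + s)) => //; rewrite fE.
  exists ((k %% 4)%N, nth 0%N [:: 2; 2; 1; 0; 0; 1]%N (k %% 6), s) => //.
  split=> //=; first by rewrite ltn_mod.
  have : (k %% 6 < 6)%N by rewrite ltn_mod.
  by case: (k %% 6)%N => [|[|[|[|[|[|]]]]]].
move=> _ [_ [[[k q] s] [/= k4 q3 s01] <-] <-].
(* The required residues modulo 4 and modulo 6 have the same parity, so some [a] below 12 has
   both. *)
have [a ak aq] : exists2 a, (a %% 4)%N = k & nth 0%N [:: 2; 2; 1; 0; 0; 1]%N (a %% 6) = q.
  case: k k4 => [|[|[|[|]]]]// _; case: q q3 => [|[|[|]]]// _.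
  - by exists 4%N.
  - by exists 8%N.
  - by exists 0%N.
  - by exists 9%N.
  - by exists 5%N.
  - by exists 1%N.
  - by exists 10%N.
  - by exists 2%N.
  - by exists 6%N.
  - by exists 3%N.
  - by exists 11%N.
  - by exists 7%N.
exists (pi / 6 * (a%:R + s - 1 / 2)) => //; rewrite /place /turn /= -ak -aq -fE /f /cyl /g.
set u := a%:R + s.
have -> : Th u = 3 * (pi / 6 * (u - 1 / 2)) by rewrite /Th; field.
have -> : third (u - 1 / 2) = 2 * (pi / 6 * (u - 1 / 2)) by rewrite /third; field.
by rewrite dbl.
Qed.

End FigureEight.
(** * Short words with a connected closure *)

Section Classification.
Variable R : realType.
Local Notation E := (R3 R).
Local Notation closed_word := (@closed_word R).
Implicit Types (w x y : seq letter) (i j k n : nat) (l : letter).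

(** A letter followed by its inverse is layered by the ranking of the letter and induces the
    identity, as two idle sectors do. *)
Lemma closed_word_cancel n i e x y : all (fit n) (x ++ (i, e) :: (i, ~~ e) :: y) ->
  iso3 (closed_word n (x ++ (i, e) :: (i, ~~ e) :: y)) (closed_word n (x ++ y)).
Proof.
rewrite all_cat /= => /and4P[xn en _ yn].
have yx : all (fit n) (y ++ x) by rewrite all_cat yn.
apply: iso3_trans (@closed_word_rot R n x ((i, e) :: (i, ~~ e) :: y) xn _) _.
  by rewrite /= yn andbT; apply/andP.
apply: iso3_trans (closed_word_rot R yn xn).
pose a : option letter := Some (i, e); pose b : option letter := Some (i, ~~ e).
apply: (@closed_word_layered R n [:: a; b] [:: None; None] (ranking a) (y ++ x)) => //.
- by rewrite /= andbT; apply/andP.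
- by apply: in2W; exact: ranking_inj.
- have i1 := gtn_eqF (ltnSn i); rewrite /a /b; case: e {en a b}.
    by do 3!rewrite /= ?i1 ?eqxx; rewrite ltnSn.
  by do 3!rewrite /= ?i1 ?eqxx; rewrite ltnSn.
by move=> q _; rewrite -[LHS]/(swap b (swap a q)) -[swap b _]/(swap a (swap a q)) swapK.
Qed.

(* The Yang-Baxter relation, in all the cases where the three strands can be layered. *)
Lemma closed_word_triple a b c x y : all (fit 3) (x ++ y) -> ~~ ((a == c) && (a != b)) ->
  iso3 (closed_word 3 (x ++ [:: (0%N, a); (1%N, b); (0%N, c)] ++ y))
       (closed_word 3 (x ++ [:: (1%N, c); (0%N, b); (1%N, a)] ++ y)).
Proof.
rewrite all_cat => /andP[x3 y3] abc.
(* Each of the six admissible sign patterns corresponds to one of the six orders of three layers; in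
   the excluded ones the three strands would lie cyclically above each other. *)
have [rank [ri r1 r2]] : exists rank : nat -> nat,
    [/\ {in gtn 3 &, injective rank},
      layered rank (map Some [:: (0%N, a); (1%N, b); (0%N, c)]) &
      layered rank (map Some [:: (1%N, c); (0%N, b); (1%N, a)])].
  have inj s : uniq s -> size s = 3 -> {in gtn 3 &, injective (nth 0%N s)}.
    by move=> us ss p q; rewrite !inE -ss => p3 q3 /eqP; rewrite nth_uniq// => /eqP.
  case: a b c abc => [] [] []// _.
  - by exists (nth 0%N [:: 2; 1; 0]%N); split=> //; exact: inj.
  - by exists (nth 0%N [:: 2; 0; 1]%N); split=> //; exact: inj.
  - by exists (nth 0%N [:: 1; 0; 2]%N); split=> //; exact: inj.
  - by exists (nth 0%N [:: 1; 2; 0]%N); split=> //; exact: inj.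
  - by exists (nth 0%N [:: 0; 2; 1]%N); split=> //; exact: inj.
  - by exists (nth 0%N [:: 0; 1; 2]%N); split=> //; exact: inj.
apply: (closed_word_swap R x3 y3 _ _ _ ri r1 r2) => //.
by move=> [|[|[|]]].
Qed.

(** Without the generator [i] no strand passes between the positions up to [i] and the others. *)
Lemma every_generator n i w : all (fit n) w -> connected (closed_word n w) ->
  (i.+1 < n)%N -> has (fun l => l.1 == i) w.
Proof.
move=> wn cw iLn; apply/negPn/negP => /hasPn noi.
have := @connected_closure R n (None :: map Some w) (fun q => (q <= i)%N) i i.+1 isT.
rewrite /= fits_Some wn ltnn leqnn => /(_ isT cw) H.
suff /H : forall p, (p < n)%N ->
    (swap (nth None (None :: map Some w) (size (map Some w)))
       (trail (None :: map Some w) (size (map Some w)) p) <= i)%N = (p <= i)%N.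
  by move=> /(_ (ltnW iLn) iLn isT).
move=> p _; rewrite -[swap _ _]/(trail (None :: map Some w) (size (map Some w)).+1 p).
elim: _.+1 => //= k <-; set v := None :: _; set q := trail v k p.
have : if nth None v k is Some l then l.1 != i else true.
  rewrite /v; case: k {q} => // k /=; have [kw|kw] := ltnP k (size w); last first.
    by rewrite nth_default ?size_map.
  by rewrite (nth_map (0%N, true))//; apply: noi; exact: mem_nth.
case: (nth None v k) => [[j e]|] //= ji.
by do 2?case: eqP => [->|_]; move: ji; clear; lia.
Qed.

(** Each letter contributes a transposition, so the signature of the permutation counts the letters
    modulo 2. *)
Lemma trail_parity m v k : all (fits m.+1) v -> exists s : 'S_m.+1,
  (forall q : 'I_m.+1, trail v k q = s q) /\
  s = odd (count (fun a => a != None) (take k v)) :> bool.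
Proof.
move=> vm; elim: k => [|k [s [sE so]]].
  by exists 1%g; rewrite take0 odd_perm1; split=> // q; rewrite perm1.
have [kv|kv] := ltnP k (size v); last first.
  exists s; split=> [q|]; last by rewrite so !take_oversize// ltnW.
  by rewrite /= sE nth_default.
rewrite (take_nth None kv) -cats1 count_cat oddD -so /= addn0.
have := all_nthP None vm k kv; case: (nth None v k) => [[i e]|] /= iv; last first.
  by exists s; rewrite addbF.
have i1m : (i < m.+1)%N by exact: ltnW.
exists (s * tperm (Ordinal i1m) (Ordinal iv))%g; split=> [q|]; last first.
  by rewrite odd_permM odd_tperm -val_eqE /= ltn_eqF.
rewrite sE permM; case: tpermP => [->|->|h1 h2] /=.
- by rewrite eqxx.
- by rewrite eqxx (gtn_eqF (ltnSn i)).
rewrite (_ : (s q == i :> nat) = false); last by apply/eqP => h; apply/h1/val_inj.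
by rewrite (_ : (s q == i.+1 :> nat) = false)//; apply/eqP => h; apply/h2/val_inj.
Qed.

Lemma connected_parity m w : all (fit m.+1) w -> connected (closed_word m.+1 w) ->
  odd (size w) = odd m.
Proof.
move=> wm cw; set v := None :: map Some w.
have vm : all (fits m.+1) v by rewrite /= fits_Some.
have [s [sE so]] := trail_parity (size v) vm.
have {}so : s = odd (size w) :> bool.
  by rewrite so take_size /v /= add0n; congr odd; elim: (w) => //= l w' ->.
rewrite -so /odd_perm card_ord /=.
suff -> : #|porbits s| = 1%N by rewrite addbT negbK.
suff -> : porbits s = finset.set1 (porbit s ord0) by rewrite cards1.
apply/setP => C; rewrite inE; apply/imsetP/eqP => [[q _ ->]|->]; last by exists ord0.
apply/eqP; rewrite eq_porbit_mem.
(* Connectedness is applied to the orbit of position 0, which must then contain every position. *)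
pose S p := (inord p : 'I_m.+1) \in porbit s ord0.
suff h : S q by move: h; rewrite /S inord_val.
apply: (@connected_closure R m.+1 v S 0%N q isT vm cw) => //; last first.
  by rewrite /S (_ : inord 0 = ord0) ?porbit_id//; apply/val_inj; rewrite /= inordK.
move=> p pm; rewrite /S; have -> : trail v (size v) p = s (Ordinal pm) by rewrite -sE.
rewrite inord_val (_ : inord p = Ordinal pm); last by apply/val_inj; rewrite /= inordK.
by have := porbit_perm s 1 (Ordinal pm); rewrite -!eq_porbit_mem expg1 => ->.
Qed.

Lemma sum_generators n w : all (fit n.+1) w ->
  (\sum_(i < n) count (fun l => l.1 == i) w)%N = size w.
Proof.
elim: w => [|l w IH] /=; first by rewrite big1.
move=> /andP[ln wn]; have li : (l.1 < n)%N by [].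
rewrite big_split /= IH// (bigD1 (Ordinal li)) //= eqxx.
by rewrite big1 ?addn0// => j; rewrite -val_eqE /= eq_sym => /negbTE ->.
Qed.

Lemma generators_le n w : all (fit n.+1) w -> connected (closed_word n.+1 w) ->
  (n <= size w)%N.
Proof.
move=> wn cw; rewrite -(sum_generators wn) -[X in (X <= _)%N]card_ord -sum1_card.
by apply: leq_sum => i _; rewrite -has_count (every_generator wn cw)// ltnS.
Qed.

Lemma reduce_once n i w : (i < n)%N -> all (fit n.+1) w ->
  count (fun l => l.1 == i) w = 1%N ->
  exists w', [/\ size w = (size w').+1, all (fit n) w' &
    iso3 (closed_word n.+1 w) (closed_word n w')].
Proof.
move=> iLn wn ci; have hi : has (fun l => l.1 == i) w by rewrite has_count ci.
pose j := find (fun l => l.1 == i) w; pose a := nth (0%N, true) w j.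
have jw : (j < size w)%N by rewrite -has_find.
have ai : a.1 == i by exact: (nth_find (0%N, true) hi).
pose x := take j w; pose y := drop j.+1 w.
have wE : w = x ++ a :: y by rewrite /a /y -drop_nth// cat_take_drop.
have aE : a = (i, a.2) by case: (a) ai => [b c] /= /eqP->.
have xy0 : all (fun l => l.1 != i) (x ++ y).
  move: ci; rewrite wE count_cat /= ai addnCA -count_cat => -[]; rewrite add0n => c0.
  by apply/allPn => -[l lxy]; rewrite negbK => li;
    have : has (fun l => l.1 == i) (x ++ y) by [apply/hasP; exists l]; rewrite has_count c0.
have xyn : all (fit n.+1) (x ++ y).
  by move: wn; rewrite wE !all_cat /= => /and3P[-> _ ->].
have yxn : all (fit n.+1) (y ++ x) by rewrite all_cat andbC -all_cat.
have yx0 : all (fun l => l.1 != i) (y ++ x) by rewrite all_cat andbC -all_cat.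
exists ([seq l <- y ++ x | (l.1 < i)%N] ++ map down [seq l <- y ++ x | (i < l.1)%N]).
split.
- have -> : size w = (size (y ++ x)).+1 by rewrite wE !size_cat /= addnS addnC.
  congr _.+1; rewrite [RHS]size_cat size_map !size_filter.
  elim: (y ++ x) yx0 => //= l u IH /andP[li /IH->].
  by move: li; rewrite neq_ltn => /orP[h|h]; rewrite h ltnNge ltnW//= ?addnS.
- rewrite all_cat; apply/andP; split; apply/allP => l.
    by rewrite mem_filter => /andP[li _]; rewrite /fit; exact: leq_ltn_trans li iLn.
  move=> /mapP[l' ]; rewrite mem_filter => /andP[li l'w] ->.
  by have := allP yxn _ l'w; rewrite /fit /down /=; move: li; clear; lia.
rewrite {1}wE aE; exact: closed_word_once.
Qed.

Lemma word1_nil w : all (fit 1) w -> w = [::].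
Proof. by case: w => // l w; rewrite /= /fit ltnS ltn0. Qed.

(** Pigeonhole: each of the [n] generators occurs, and twice each would already take [2 * n]
    letters. *)
Lemma single_generator n w : all (fit n.+1) w -> connected (closed_word n.+1 w) ->
  (size w < n.*2)%N -> exists2 i, (i < n)%N & count (fun l => l.1 == i) w = 1%N.
Proof.
move=> wn cw; rewrite -(sum_generators wn) ltnNge => /negP sw.
have [i /eqP ci|none] := pickP (fun i : 'I_n => count (fun l => l.1 == i) w == 1%N).
  by exists i.
case: sw; have -> : n.*2 = (\sum_(i < n) 2)%N by rewrite sum_nat_const card_ord muln2.
apply: leq_sum => i _; have := none i; have := every_generator wn cw (ltn_ord i :
  (i.+1 < n.+1)%N).
by rewrite has_count; case: (count _ _) => [|[|]].
Qed.

Lemma minimal_unknot n w : all (fit n.+1) w -> connected (closed_word n.+1 w) ->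
  size w = n -> iso3 (closed_word n.+1 w) (closed_word 1 [::]).
Proof.
elim: n w => [|n IH] w wn cw sw; first by rewrite (word1_nil wn); exact: iso3_refl.
have [|i iLn ci] := single_generator wn cw; first by rewrite sw; lia.
have [w' [sw' w'n iso]] := reduce_once iLn wn ci.
apply: iso3_trans iso (IH w' w'n (iso3_connected iso cw) _).
by move: sw'; rewrite sw => -[].
Qed.

Lemma reduce_two a b c :
  let w := [:: (0%N, a); (0%N, b); (0%N, c)] in connected (closed_word 2 w) ->
  iso3 (closed_word 2 w) (closed_word 1 [::]) \/
  iso3 (closed_word 2 w) (closed_word 2 (nseq 3 (0%N, a))).
Proof.
move=> w cw; have one d : connected (closed_word 2 [:: (0%N, d)]) ->
    iso3 (closed_word 2 [:: (0%N, d)]) (closed_word 1 [::]).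
  by move=> cd; apply: minimal_unknot.
have [ab|ab] := eqVneq a b; last first.
  have h := @closed_word_cancel 2 0 a [::] [:: (0%N, c)] isT.
  rewrite (_ : ~~ a = b) in h; last by move: ab; clear; case: a b => [] [].
  by left; apply: iso3_trans h (one _ (iso3_connected h cw)).
have [bc|bc] := eqVneq b c; first by right; rewrite /w -bc -ab; exact: iso3_refl.
have h := @closed_word_cancel 2 0 b [:: (0%N, a)] [::] isT.
rewrite (_ : ~~ b = c) in h; last by move: bc; clear; case: b c => [] [].
by left; apply: iso3_trans h (one _ (iso3_connected h cw)).
Qed.

Definition eight_word : seq letter := [:: (0%N, true); (1%N, false); (0%N, true); (1%N, false)].

(* Conjugation by the half twist exchanges the two generators. *)
Lemma eight_word_flip :
  iso3 (closed_word 3 (map flip eight_word)) (closed_word 3 eight_word).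
Proof.
(* The half twist of either sign. Inserted next to its inverse, it moves past the letters of the
   word one at a time and exchanges the two generators. *)
pose h e : seq letter := [:: (0%N, e); (1%N, e); (0%N, e)].
have step1 x y : all (fit 3) (x ++ y) ->
    iso3 (closed_word 3 (x ++ h false ++ (0%N, false) :: y))
         (closed_word 3 (x ++ (1%N, false) :: h false ++ y)).
  move=> xy; apply: (@closed_word_triple false false false x ((0%N, false) :: y)) => //.
  by move: xy; rewrite !all_cat.
have step2 x y : all (fit 3) (x ++ y) ->
    iso3 (closed_word 3 (x ++ h false ++ (1%N, true) :: y))
         (closed_word 3 (x ++ (0%N, true) :: h false ++ y)).
  move=> xy; apply: (@iso3_trans _ _ (closed_word 3 (x ++ [:: (1%N, false); (0%N, false)] ++ y))).
    apply: iso3_trans (@closed_word_triple false false false x ((1%N, true) :: y) _ _) _ => //.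
      by move: xy; rewrite !all_cat.
    have := @closed_word_cancel 3 1 false (x ++ [:: (1%N, false); (0%N, false)]) y.
    by rewrite -!catA; apply; move: xy; rewrite !all_cat.
  apply: iso3_sym; apply: (@closed_word_cancel 3 0 true x) => //.
  by move: xy; rewrite !all_cat.
pose w := map flip eight_word; pose w' := map (fun l : letter => (1 - l.1, l.2)%N) w.
have c1 : iso3 (closed_word 3 (h true ++ h false ++ w)) (closed_word 3 w).
  apply: iso3_trans (@closed_word_cancel 3 0 true [:: (0%N, true);
    (1%N, true)] ((1%N, false) :: (0%N, false) :: w) isT) _.
  apply: iso3_trans (@closed_word_cancel 3 1 true [:: (0%N, true)] ((0%N, false) :: w) isT) _.
  exact: (@closed_word_cancel 3 0 true [::] w isT).
have c2 : iso3 (closed_word 3 (w' ++ h false ++ h true)) (closed_word 3 w').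
  apply: iso3_trans (@closed_word_cancel 3 0 false (w' ++ [:: (0%N, false);
    (1%N, false)]) [:: (1%N, true); (0%N, true)] isT) _.
  apply: iso3_trans (@closed_word_cancel 3 1 false (w' ++ [:: (0%N, false)]) [::
    (0%N, true)] isT) _.
  exact: (@closed_word_cancel 3 0 false w' [::] isT).
apply: iso3_trans (iso3_sym c1) _.
apply: iso3_trans (step1 (h true) [:: (1%N, true); (0%N, false); (1%N, true)] isT) _.
apply: iso3_trans (step2 (h true ++ [:: (1%N, false)]) [:: (0%N, false); (1%N, true)] isT) _.
apply: iso3_trans (step1 (h true ++ [:: (1%N, false); (0%N, true)]) [:: (1%N, true)] isT) _.
apply: iso3_trans (step2 (h true ++ [:: (1%N, false); (0%N, true); (1%N, false)]) [::] isT) _.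
apply: iso3_trans (@closed_word_rot R 3 (h true) (w' ++ h false) isT isT) _.
apply: iso3_trans c2 _.
exact: (@closed_word_rot R 3 [:: (1%N, false)] [:: (0%N, true); (1%N, false);
  (0%N, true)] isT isT).
Qed.

Definition classified w n : Prop :=
  [\/ iso3 (closed_word n w) (closed_word 1 [::]),
      exists e, iso3 (closed_word n w) (closed_word 2 (nseq 3 (0%N, e)))
    | iso3 (closed_word n w) (closed_word 3 eight_word)].

Lemma classified_iso3 n n' w w' : iso3 (closed_word n w) (closed_word n' w') ->
  classified w' n' -> classified w n.
Proof.
move=> h [h1|[e h1]|h1]; [apply: Or31|apply: Or32; exists e|apply: Or33];
  exact: iso3_trans h h1.
Qed.

Lemma classify2 w : all (fit 2) w -> connected (closed_word 2 w) -> size w = 3 ->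
  classified w 2.
Proof.
case: w => [|[[|i] a] [|[[|j] b] [|[[|k] c] [|? ?]]]]//= _ cw _.
have [h|h] := reduce_two cw; first exact: Or31.
by apply: Or32; exists a.
Qed.

Lemma classify3_once w i : (i < 2)%N -> all (fit 3) w -> connected (closed_word 3 w) ->
  size w = 4 -> count (fun l => l.1 == i) w = 1%N -> classified w 3.
Proof.
move=> i2 w3 cw sw ci; have [w' [sw' w'2 iso]] := reduce_once i2 w3 ci.
apply: classified_iso3 iso (classify2 w'2 (iso3_connected iso cw) _).
by move: sw'; rewrite sw => -[].
Qed.

Lemma classify_alternating a b c d :
  let w := [:: (0%N, a); (1%N, b); (0%N, c); (1%N, d)] in
  connected (closed_word 3 w) -> classified w 3.
Proof.
(* Outside the excluded sign patterns the Yang-Baxter relation on the first or on the last three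
   letters leaves a generator that occurs once. If neither applies, the signs alternate with the
   generators. *)
move=> w cw; have [/andP[/eqP ac ab]|abc] := boolP ((a == c) && (a != b)); last first.
  have h := @closed_word_triple a b c [::] [:: (1%N, d)] isT abc.
  by apply: (classified_iso3 h); apply: (@classify3_once _ 0) => //; exact: iso3_connected h cw.
have [/andP[/eqP db dc]|dbc] := boolP ((d == b) && (d != c)); last first.
  have h := iso3_sym (@closed_word_triple d c b [:: (0%N, a)] [::] isT dbc).
  by apply: (classified_iso3 h); apply: (@classify3_once _ 1) => //; exact: iso3_connected h cw.
rewrite /w -ac db; have -> : b = ~~ a by move: ab; clear; case: a b => [] [].
apply: Or33; case: (a); [exact: iso3_refl|exact: eight_word_flip].
Qed.

Lemma classify3 w : all (fit 3) w -> connected (closed_word 3 w) -> size w = 4 ->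
  classified w 3.
Proof.
move=> w3 cw sw; have once i : (i < 2)%N -> count (fun l => l.1 == i) w = 1%N -> classified w 3.
  by move=> i2; exact: classify3_once.
have gen i : (i < 2)%N -> has (fun l => l.1 == i) w by move=> i2; apply: every_generator cw _.
(* Words that induce the identity permutation do not have a connected closure. The 5 counts the four
   letters and the leading [None]. *)
have pure : (forall p, (p < 3)%N -> trail (None :: map Some w) 5 p = p) -> classified w 3.
  move=> tr; exfalso; have w3' : all (fits 3) (None :: map Some w) by rewrite /= fits_Some.
  have := @connected_closure R 3 (None :: map Some w) (pred1 0%N) 0 1 isT w3' cw.
  rewrite /= size_map sw => /(_ _ isT isT isT) h; suff: false by [].
  by apply: h => p p3; rewrite -[in RHS](tr p p3).
move: w3 cw sw once gen pure.
case: w => [|[i a] [|[j b] [|[k c] [|[l d] [|? ?]]]]] // w3 cw _ once gen pure.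
case: i j k l w3 cw once gen pure => [|[|i]] [|[|j]] [|[|k]] [|[|l]]//= w3 cw once gen pure.
- by have := gen 1 isT.
- exact: (once 1%N isT).
- exact: (once 1%N isT).
- by apply: pure => -[|[|[|]]].
- exact: (once 1%N isT).
- exact: classify_alternating.
- by apply: pure => -[|[|[|]]].
- exact: (once 0%N isT).
- exact: (once 1%N isT).
- by apply: pure => -[|[|[|]]].
- have h := @closed_word_rot R 3 [:: (1%N, a)] [:: (0%N, b); (1%N, c); (0%N, d)] isT isT.
  exact: classified_iso3 h (classify_alternating (iso3_connected h cw)).
- exact: (once 0%N isT).
- by apply: pure => -[|[|[|]]].
- exact: (once 0%N isT).
- exact: (once 0%N isT).
- by have := gen 0 isT.
Qed.

(** With [n] generators, [n + 2] letters are fewer than [2 * n] once [n] is at least 3; then some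
    generator occurs once and can be removed. *)
Theorem classify n w : all (fit n.+1) w -> connected (closed_word n.+1 w) ->
  size w = n.+2 -> classified w n.+1.
Proof.
elim: n w => [|n IH] w wn cw sw; first by rewrite (word1_nil wn) in sw.
case: n IH wn cw sw => [|[|n]] IH wn cw sw; [exact: classify2|exact: classify3|].
have [|i iLn ci] := single_generator wn cw; first by rewrite sw; lia.
have [w' [sw' w'n iso]] := reduce_once iLn wn ci.
apply: classified_iso3 iso (IH w' w'n (iso3_connected iso cw) _).
by move: sw'; rewrite sw => -[].
Qed.

End Classification.
(** * Braid words representing a knot *)

Section Bridge.
Variable R : realType.
Local Notation S := (S3 R).
Local Notation closed_word := (@closed_word R).
Implicit Types (K : set S) (u : seq letter) (m n : nat).

Definition nat_word n (w : braid_word n) : seq letter :=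
  [seq (nat_of_ord a.1, a.2) | a <- w].

Lemma fit_nat_word n (w : braid_word n) : all (fit n) (nat_word w).
Proof.
rewrite all_map; apply/allP => -[[i iLn] e] _; rewrite /= /fit /=.
by move: iLn; clear; lia.
Qed.

Lemma nat_word_surj n u : all (fit n) u -> exists w : braid_word n, nat_word w = u.
Proof.
elim: u => [|[i e] u IH] /=; first by exists [::].
move=> /andP[iLn /IH[w <-]]; have i1 : (i < n.-1)%N by move: iLn; rewrite /fit /=; clear; lia.
by exists ((Ordinal i1, e) :: w).
Qed.

(** The statement puts the closing sector at the end, while [closed_word] has it in front; one
    rotation reconciles the two. *)
Lemma braid_closureE n (w : braid_word n) : @braid_closure R n w =
  Some @` (@closure R n (rcons (map Some (nat_word w)) None)).
Proof.
have sN : size (rcons (map Some (nat_word w)) None) = (size w).+1.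
  by rewrite size_rcons !size_map.
have strandE k (j : 'I_n) (s : R) :
    strand (onth w k) j s = movie (rcons (map Some (nat_word w)) None) k j s.
  rewrite /movie; have -> : nth None (rcons (map Some (nat_word w)) None) k =
      omap (fun a : braid_letter n => (nat_of_ord a.1, a.2)) (onth w k).
    by elim: (w) k => [|a w' IH] [|k] //=; rewrite nth_nil.
  by case: (onth w k) => [[i e]|].
rewrite /closure sN; apply/seteqP; split.
  move=> _ [k [j [s [kw s01 ->]]]]; rewrite strandE.
  exists (cyl (movie (rcons (map Some (nat_word w)) None) k j s)
    (steady (size w).+1 (k%:R + s))) => //.
  by exists (k, nat_of_ord j, s) => //; split=> //=; rewrite ltnS.
move=> _ [_ [[[k q] s] [/= kw qn s01] <-] <-].
by exists k, (Ordinal qn), s; split=> //; rewrite strandE.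
Qed.

Definition spells n K u : Prop := all (fit n) u /\ isotopic (Some @` closed_word n u) K.

Lemma represents_spells n (w : braid_word n) K : represents w K <-> spells n K (nat_word w).
Proof.
rewrite /represents braid_closureE.
have wn : all (fits n) (map Some (nat_word w)) by rewrite fits_Some fit_nat_word.
have /iso3_isotopic h := @closure_rot1 R n None _ isT wn.
split=> [wK|[_ wK]]; last exact: isotopic_trans (isotopic_sym h) wK.
by split; [exact: fit_nat_word|exact: isotopic_trans h wK].
Qed.

Lemma words_spelling n K : [set l | exists2 w : braid_word n, represents w K & size w = l] =
  [set l | exists2 u, spells n K u & size u = l].
Proof.
apply/seteqP; split=> l [].
  by move=> w /represents_spells wK <-; exists (nat_word w); rewrite ?size_map.
move=> u uK <-; have [un _] := uK; have [w wu] := nat_word_surj un.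
exists w; first by apply/represents_spells; rewrite wu.
by rewrite -wu size_map.
Qed.

Lemma indices_spelling K : [set n | exists w : braid_word n, represents w K] =
  [set n | exists u, spells n K u].
Proof.
apply/seteqP; split=> n [].
  by move=> w /represents_spells wK; exists (nat_word w).
move=> u uK; have [un _] := uK; have [w wu] := nat_word_surj un.
by exists w; apply/represents_spells; rewrite wu.
Qed.

Lemma minimum_exists (A : set nat) : A !=set0 -> exists m, is_minimum A m.
Proof.
move=> A0; have Ab : exists k, `[< A k >] by have [k Ak] := A0; exists k; apply/asboolP.
case: (ex_minnP Ab) => m /asboolP Am mmin; exists m; split=> // k Ak.
by apply: mmin; apply/asboolP.
Qed.

(** Shows that minimal lengths exist for every number of strands from the braid index on. *)
Lemma spells_stabilize n m K u : (0 < n)%N -> (n <= m)%N -> spells n K u ->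
  exists u', spells m K u'.
Proof.
move=> n0 nm uK; elim: m nm => [|m IH].
  by rewrite leqn0 => /eqP n00; rewrite n00 in n0.
rewrite leq_eqVlt => /predU1P[<-|]; first by exists u.
rewrite ltnS => nm; have [v [vm vK]] := IH nm; have m0 : (0 < m)%N by exact: leq_trans nm.
exists ((m.-1, true) :: v); split.
  rewrite /= {1}/fit /= prednK// ltnSn /=; apply: sub_all vm => l; rewrite /fit.
  exact: ltn_trans.
exact: isotopic_trans (isotopic_sym (iso3_isotopic (closed_word_stabilize R m0 vm))) vK.
Qed.

Section Nontrivial.
Variable K : set S.
Hypotheses (Kk : knot K) (Kn : nontrivial K).

(** The closure on zero strands is empty, and a knot is not. *)
Lemma spells_pos n u : spells n K u -> (0 < n)%N.
Proof.
case: n => // -[_ [H [_ _ _ HK]]]; have [[f [_ _ fK]] _] := Kk.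
have : K (f (1, 0)) by rewrite -fK; exists (1, 0) => //=; rewrite expr1n expr0n addr0.
by rewrite -HK => -[y [p [[[k q] s] [/= _ q0 _] _] _] _].
Qed.

Lemma spells_connected n u : spells n K u -> connected (closed_word n u).
Proof.
move=> [_ uK]; apply: connected_Some; apply: isotopic_connected (isotopic_sym uK) _.
by apply: simple_closed_curve_connected; case: Kk.
Qed.

(** A connected closure needs [m] letters; exactly [m] would give the unknot, and [m + 1] has the
    wrong parity. *)
Lemma spells_size m u : spells m.+1 K u -> (m.+2 <= size u)%N /\ odd (size u) = odd m.
Proof.
move=> uK; have [un uK'] := uK; have cu := spells_connected uK.
have par := connected_parity un cu; split=> //.
have := generators_le un cu; rewrite leq_eqVlt => /predU1P[mE|].
  case: Kn; have h := iso3_isotopic (minimal_unknot un cu (esym mE)).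
  by rewrite unknot_closed_word; exact: isotopic_trans (isotopic_sym uK') h.
by rewrite leq_eqVlt => /predU1P[mE|//]; move: par; rewrite -mE /=; case: odd.
Qed.

Lemma spells_short m u : spells m.+1 K u -> size u = m.+2 ->
  is_trefoil K \/ is_figure_eight K.
Proof.
move=> uK su; have [un uK'] := uK; have cu := spells_connected uK.
case: (classify un cu su) => [h|[e h]|h].
- case: Kn; rewrite unknot_closed_word.
  exact: isotopic_trans (isotopic_sym uK') (iso3_isotopic h).
- left; exists e; have [L -> h'] := trefoil_closed_word R e.
  exact: isotopic_trans (isotopic_sym uK') (iso3_isotopic (iso3_trans h h')).
- right; rewrite /is_figure_eight; have [L -> h'] := figure_eight_closed_word R.
  exact: isotopic_trans (isotopic_sym uK') (iso3_isotopic (iso3_trans h h')).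
Qed.

(** The given word is automatically shortest, by [spells_size]. *)
Lemma reduced_length_one m u : spells m.+1 K u -> size u = m.+2 ->
  exists k n : nat, [/\ braid_index K k, (k <= n)%N & reduced_length n K 1].
Proof.
move=> uK su; have [k kmin] : exists k, braid_index K k.
  by apply: minimum_exists; rewrite indices_spelling; exists m.+1, u.
exists k, m.+1; split=> //.
  by case: kmin => _; apply; rewrite indices_spelling; exists u.
exists m.+2; last by rewrite -[m.+2]addn1 PoszD addrAC subrr add0r.
rewrite /min_length words_spelling; split; first by exists u.
by move=> l [v vK <-]; case: (spells_size vK).
Qed.

End Nontrivial.
End Bridge.

Theorem theorem6 (R : realType) (K : set (S3 R)) :
  knot K -> nontrivial K ->
  ((exists m n : nat,
      [/\ braid_index K m, (m <= n)%N & reduced_length n K 1]) <->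
   (is_trefoil K \/ is_figure_eight K))
  /\
  (~ is_trefoil K -> ~ is_figure_eight K ->
   forall m n : nat, braid_index K m -> (m <= n)%N ->
     exists2 d : int, reduced_length n K d & 3 <= d).
Proof.
move=> Kk Kn; split; first split.
- move=> [m [n [_ _ [b [bmin _] bn]]]].
  rewrite words_spelling in bmin; have [u uK su] := bmin.
  have n0 := spells_pos Kk uK; case: n n0 uK bn {bmin} => // n _ uK bn.
  by apply: (spells_short Kk Kn uK); rewrite su; lia.
- move=> [[e Ke]|Ke].
    have [L Le h] := trefoil_closed_word R e; rewrite Le in Ke.
    apply: (@reduced_length_one R K Kk Kn 1 (nseq 3 (0%N, e))) => //; split=> //.
    exact: isotopic_trans (iso3_isotopic h) (isotopic_sym Ke).
  have [L Le h] := figure_eight_closed_word R; rewrite /is_figure_eight Le in Ke.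
  apply: (@reduced_length_one R K Kk Kn 2 eight_word) => //; split=> //.
  exact: isotopic_trans (iso3_isotopic h) (isotopic_sym Ke).
move=> nt nf m n [mK _] mn; rewrite indices_spelling in mK.
have [u uK] := mK; have m0 := spells_pos Kk uK.
have [v vK] := spells_stabilize m0 mn uK.
have [b bmin] : exists b, min_length n K b.
  by apply: minimum_exists; rewrite words_spelling; exists (size v), v.
exists (b%:Z - n%:Z); first by exists b.
have [bn _] := bmin; rewrite words_spelling in bn; have [w wK <-] := bn.
case: n mn v vK {bmin bn} wK => [|n] mn v vK wK; first by move: m0 mn; clear; lia.
have [w1 w2] := spells_size Kk Kn wK.
(* The number of strands is [n.+1]. Length [n.+2] would make [K] one of the two knots, and [n.+3]
   has the wrong parity, so at least [n + 4] letters remain. *)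
have w3 : size w <> n.+2 by move=> sw; have [] := spells_short Kk Kn wK sw.
have w4 : size w <> n.+3 by move=> sw; move: w2; rewrite sw /=; case: odd.
by move: w1 w3 w4; clear; lia.
Qed.
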